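(* Let $a<b$ be real numbers. The minimal relation $\mathrm{T}_{\min}$ is symmetric in $\mathcal{H}([a,b))$ with $$\mathrm{T}_{\min}^\ast=\mathrm{T}_{\max},\qquad \mathrm{T}_{\max}^\ast=\mathrm{T}_{\min}.$$ In particular, the linear relations $\mathrm{T}_{\min}$ and $\mathrm{T}_{\max}$ are closed.
   Context: Let $\omega$ be a real-valued Borel measure on $\mathbb{R}$ and $\upsilon$ a non-negative Borel measure on $\mathbb{R}$ (both locally finite; so $\omega$ is a signed measure assigning finite values to bounded Borel sets). The superscript $^\ast$ on numbers and functions denotes complex conjugation. For a Borel measure $\mu$, $\int_x^y f\,d\mu$ means $\int_{[x,y)}f\,d\mu$ if $y>x$, $0$ if $y=x$, and $-\int_{[y,x)}f\,d\mu$ if $y<x$. Let $\mathcal{H}_{\mathrm{loc}}(\mathbb{R})=H^1_{\mathrm{loc}}(\mathbb{R})\times L^2_{\mathrm{loc}}(\mathbb{R};\upsilon)$, where $H^1_{\mathrm{loc}}(\mathbb{R})$ consists of locally absolutely continuous functions with locally square integrable derivative; components of $f\in\mathcal{H}_{\mathrm{loc}}(\mathbb{R})$ are denoted $f_1,f_2$. The linear relation $\mathrm{T}_{\mathrm{loc}}$ consists of all pairs $(f,g)\in\mathcal{H}_{\mathrm{loc}}(\mathbb{R})\times\mathcal{H}_{\mathrm{loc}}(\mathbb{R})$ such that $-f_1''+\frac14 f_1=\omega g_1+\upsilon g_2$ in the sense of distributions and $f_2=g_1$ almost everywhere with respect to $\upsilon$. For such a pair, $f_1'$ always denotes the left-continuous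 representative satisfying $-f_1'(y)+f_1'(x)+\frac14\int_x^y f_1(s)\,ds=\int_x^y g_1\,d\omega+\int_x^y g_2\,d\upsilon$ for all $x,y\in\mathbb{R}$. An element of $\mathrm{T}_{\mathrm{loc}}$ is written $\mathbf{f}=(f,\tau f)$. $\mathcal{H}([a,b))=H^1([a,b))\times L^2([a,b);\upsilon)$ is the Hilbert space with scalar product $$\langle f,g\rangle=\frac14\int_a^b f_1g_1^\ast\,dx+\int_a^b f_1'(g_1')^\ast\,dx+\int_a^b f_2g_2^\ast\,d\upsilon .$$ The maximal relation is $\mathrm{T}_{\max}=\{\mathbf{f}\in\mathcal{H}([a,b))\times\mathcal{H}([a,b)) : \mathbf{f}=\mathbf{g}|_{[a,b)}\text{ for some }\mathbf{g}\in\mathrm{T}_{\mathrm{loc}}\}$. For $\mathbf f\in\mathrm{T}_{\max}$ the quantities $f_1(x),f_1'(x),\tau f_1(x)$ for $x\in[a,b]$ are defined through any representative $\mathbf{g}\in\mathrm{T}_{\mathrm{loc}}$ (they do not depend on the choice). The minimal relation is $$\mathrm{T}_{\min}=\{\mathbf{f}\in\mathrm{T}_{\max}:\tau f_1(a)=f_1'(a)=\tau f_1(b)=f_1'(b)=0\}.$$ The adjoint of a linear relation $\mathrm{S}$ in a Hilbert space is $\mathrm{S}^\ast=\{(u,v):\langle u,k\rangle=\langle v,h\rangle\text{ for all }(h,k)\in\mathrm{S}\}$; $\mathrm{S}$ is symmetric if $\mathrm{S}\subseteq\mathrm{S}^\ast$. *)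

(* Defs.v *)
From HB Require Import structures.
From mathcomp Require Import all_boot all_order all_algebra.
From mathcomp Require Import all_classical all_reals all_analysis.
From mathcomp Require Import complex.

Set Implicit Arguments.
Unset Strict Implicit.
Unset Printing Implicit Defensive.

Import Order.TTheory GRing.Theory Num.Theory.
Import numFieldNormedType.Exports.

Local Open Scope classical_set_scope.
Local Open Scope ring_scope.
Local Open Scope complex_scope.

(* A locally finite signed Borel measure need not be a charge on the whole line,
   since it may take infinite or undefined values on unbounded sets. It is a
   real-valued function that is countably additive on the Borel subsets of each
   bounded interval; its values on other sets are irrelevant. *)
Record loc_charge (R : realType) := LocCharge {
  loc_charge_fun :> set (measurableTypeR R) -> R ;
  loc_charge0 : loc_charge_fun set0 = 0 ;
  loc_charge_sigma_additive : forall (x y : R)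
      (F : (set (measurableTypeR R))^nat),
    (forall n, measurable (F n)) -> (forall n, F n `<=` `[x, y[) ->
    trivIset setT F ->
    (fun n => \sum_(0 <= i < n) loc_charge_fun (F i)) @ \oo -->
      loc_charge_fun (\bigcup_n F n) }.

Section LocChargeRestriction.
Context (R : realType) (om : loc_charge R) (x y : R).

Definition loc_charge_restr (A : set (measurableTypeR R)) : \bar R :=
  (om (A `&` `[x, y[))%:E.

Let restr0 : loc_charge_restr set0 = 0%E.
Proof. by rewrite /loc_charge_restr set0I loc_charge0. Qed.

Let restr_fin A : measurable A -> loc_charge_restr A \is a fin_num.
Proof. by []. Qed.

Let restr_sigma_additive : semi_sigma_additive loc_charge_restr.
Proof.
move=> F mF tF _; rewrite /loc_charge_restr setI_bigcupl.
under eq_fun do rewrite sumEFin.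
apply: cvg_EFin; first exact: nearW.
apply: (@loc_charge_sigma_additive R om x y).
- by move=> n; apply: measurableI => //; exact: measurable_itv.
- by move=> n; exact: subIsetr.
- exact: trivIset_setIr.
Qed.

HB.instance Definition _ := isCharge.Build _ (measurableTypeR R) R
  loc_charge_restr restr0 restr_fin restr_sigma_additive.

End LocChargeRestriction.

Section ChargeIntegral.
Context d (T : measurableType d) (R : realType) (nu : {charge set T -> \bar R}).

Let hahn_ex : exists PN : set T * set T, hahn_decomposition nu PN.1 PN.2.
Proof. by have [P [N nuPN]] := Hahn_decomposition nu; exists (P, N). Qed.

(* A Hahn decomposition is unique only up to null sets of the variation, so the
   integral below does not depend on the choice. *)
Definition hahn_pair := projT1 (cid hahn_ex).
Definition hahn_pairP : hahn_decomposition nu hahn_pair.1 hahn_pair.2 :=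
  projT2 (cid hahn_ex).

Definition charge_Rintegral (D : set T) (f : T -> R) : R :=
  \int[jordan_pos hahn_pairP]_(x in D) f x -
  \int[jordan_neg hahn_pairP]_(x in D) f x.

End ChargeIntegral.

Section ComplexValued.
Context (R : realType).
Implicit Types (f : R -> R[i]) (x y : R).

Definition cintegral (mu : {measure set (measurableTypeR R) -> \bar R})
    (D : set R) f : R[i] :=
  (\int[mu]_(x in D) complex.Re (f x)) +i* (\int[mu]_(x in D) complex.Im (f x)).

Definition loc_charge_cintegral (om : loc_charge R) x y f : R[i] :=
  charge_Rintegral (loc_charge_restr om x y) `[x, y[
      (fun s => complex.Re (f s)) +i*
  charge_Rintegral (loc_charge_restr om x y) `[x, y[
      (fun s => complex.Im (f s)).

(* [I x y] stands for the integral over the half-open interval from x to y. *)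
Definition oriented (I : R -> R -> R[i]) x y : R[i] :=
  if x < y then I x y else if y < x then - I y x else 0.

Definition oint (mu : {measure set (measurableTypeR R) -> \bar R}) f :=
  oriented (fun x y => cintegral mu `[x, y[ f).

Definition oint_charge (om : loc_charge R) f :=
  oriented (fun x y => loc_charge_cintegral om x y f).

(* The library derivative takes the default value 0 at points where it does not
   exist; these form a Lebesgue null set for locally absolutely continuous f. *)
Definition cderiv f : R -> R[i] := fun x =>
  derive1 (fun s => complex.Re (f s)) x +i*
  derive1 (fun s => complex.Im (f s)) x.

Definition abs_cont x y f := forall e : R, 0 < e -> exists2 d : R, 0 < d &
  forall (n : nat) (s t : 'I_n -> R),
    (forall i, x <= s i /\ s i <= t i /\ t i <= y) ->
    trivIset setT (fun i => `]s i, t i[%classic) ->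
    \sum_i (t i - s i) < d -> \sum_i Normc.normc (f (t i) - f (s i)) < e.

Definition loc_abs_cont (D : set R) f :=
  forall x y, x <= y -> `[x, y] `<=` D -> abs_cont x y f.

Definition L2 (mu : {measure set (measurableTypeR R) -> \bar R}) (D : set R) f :=
  [/\ measurable_fun (D : set (measurableTypeR R))
        (fun x => complex.Re (f x)),
      measurable_fun (D : set (measurableTypeR R))
        (fun x => complex.Im (f x)) &
      (\int[mu]_(x in D) ((Normc.normc (f x)) ^+ 2)%:E < +oo)%E].

Definition H1 (a b : R) f :=
  [/\ loc_abs_cont `[a, b[ f, L2 lebesgue_measure `[a, b[ f &
      L2 lebesgue_measure `[a, b[ (cderiv f)].

Definition H1loc f := loc_abs_cont setT f /\
  forall x y, L2 lebesgue_measure `[x, y[ (cderiv f).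

Definition smooth (h : R -> R) :=
  forall (n : nat) x, derivable (derive1n n h) x 1.

End ComplexValued.

Section Relations.
Context (R : realType) (om : loc_charge R)
  (up : {measure set (measurableTypeR R) -> \bar R}).

(* Elements of the function spaces are represented by pairs of total functions.
   For H([a, b)) the values outside [a, b) are irrelevant. Second components are
   only meaningful almost everywhere with respect to [up]: all sets below are
   saturated for that equality, so that equality of sets of representatives is
   equality of sets of classes. *)
Definition elt : Type := ((R -> R[i]) * (R -> R[i]))%type.

Definition relation : Type := set (elt * elt).

Definition Hloc (f : elt) := H1loc f.1 /\ forall x y, L2 up `[x, y[ f.2.

(* Testing against real-valued functions suffices by linearity. A smooth function
   that vanishes outside [c, d) has compact support in [c, d]. *)
Definition Tloc : relation := [set F | [/\ Hloc F.1, Hloc F.2,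
  (forall (h : R -> R) (c d : R), smooth h ->
     (forall x, x \notin `[c, d[ -> h x = 0) ->
     - cintegral lebesgue_measure `[c, d[
         (fun x => F.1.1 x * (derive1n 2 h x)%:C) +
     4^-1 * cintegral lebesgue_measure `[c, d[ (fun x => F.1.1 x * (h x)%:C) =
     loc_charge_cintegral om c d (fun x => F.2.1 x * (h x)%:C) +
     cintegral up `[c, d[ (fun x => F.2.2 x * (h x)%:C)) &
  {ae up, forall x, F.1.2 x = F.2.1 x}]].

(* [p] is the left-continuous representative of the derivative of the first
   component of F.1. The integral identity alone would fix [p] only up to an
   additive constant. *)
Definition left_deriv (F : elt * elt) (p : R -> R[i]) :=
  [/\ {ae (lebesgue_measure : {measure set (measurableTypeR R) -> \bar R}),
         forall x, p x = cderiv F.1.1 x},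
      (forall x, Normc.normc (p t - p x) @[t --> x^'-] --> (0 : R)) &
      forall x y, - p y + p x + 4^-1 * oint lebesgue_measure F.1.1 x y =
        oint_charge om F.2.1 x y + oint up F.2.2 x y].

Context (a b : R).

Definition H (f : elt) := H1 a b f.1 /\ L2 up `[a, b[ f.2.

Definition ip (f g : elt) : R[i] :=
  4^-1 * cintegral lebesgue_measure `[a, b[ (fun x => f.1 x * (g.1 x)^*) +
  cintegral lebesgue_measure `[a, b[
    (fun x => cderiv f.1 x * (cderiv g.1 x)^*) +
  cintegral up `[a, b[ (fun x => f.2 x * (g.2 x)^*).

Definition hnorm (f : elt) : R := Num.sqrt (complex.Re (ip f f)).

Definition eq_on (f g : elt) :=
  (forall x, x \in `[a, b[ -> f.1 x = g.1 x) /\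
  {ae up, forall x, x \in `[a, b[ -> f.2 x = g.2 x}.

Definition restricts (G F : elt * elt) := eq_on F.1 G.1 /\ eq_on F.2 G.2.

Definition Tmax : relation :=
  [set F | [/\ H F.1, H F.2 & exists2 G, Tloc G & restricts G F]].

(* The boundary values do not depend on the representative G: those at [a] and
   [b] of G.2.1 by continuity, those of [p] by its left continuity at [b] and the
   integral identity over [a, b). *)
Definition Tmin : relation :=
  [set F | Tmax F /\ exists G p, [/\ Tloc G, restricts G F, left_deriv G p &
    [/\ G.2.1 a = 0, p a = 0, G.2.1 b = 0 & p b = 0]]].

Definition adjoint (S : relation) : relation :=
  [set F | [/\ H F.1, H F.2 &
    forall K, S K -> ip F.1 K.2 = ip F.2 K.1]].

Definition symmetric_rel (S : relation) := S `<=` adjoint S.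

(* S contains all its adherent points in H([a, b)) x H([a, b)). *)
Definition closed_rel (S : relation) := forall F : elt * elt, H F.1 -> H F.2 ->
  (forall e : R, 0 < e -> exists2 K, S K &
     hnorm (F.1 - K.1) < e /\ hnorm (F.2 - K.2) < e) -> S F.

End Relations.

(* Main.v *)
Require Import Defs.
From HB Require Import structures.
From mathcomp Require Import all_boot all_order all_algebra.
From mathcomp Require Import all_classical all_reals all_analysis.
From mathcomp Require Import complex.
From mathcomp Require Import measurable_realfun realfun.
From mathcomp Require Import lra ring.

Set Implicit Arguments.
Unset Strict Implicit.
Unset Printing Implicit Defensive.

Import Order.TTheory GRing.Theory Num.Theory.
Import numFieldNormedType.Exports.

Local Open Scope classical_set_scope.
Local Open Scope ring_scope.

(** Everything rests on Green's formula. If (f, g) and (k, l) solve the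
    equation with left-continuous derivatives p and q, then
    <f, l> - <g, k> = [p l* - g q*] taken between a and b, the two integrals
    against the signed measure being equal. It follows from integration by
    parts of the absolutely continuous factor against the source
    ([source_by_parts], a Fubini argument) and yields at once that each of the
    minimal and the maximal relation is contained in the adjoint of the other,
    since all boundary terms of a pair of the minimal relation vanish
    ([Tmax_Tmin_green]).

    For the converse inclusions one has to solve boundary value problems
    ([dirichlet_problem], [neumann_problem]). The homogeneous equation
    - f'' + f / 4 = 0 is the same for all measures and has the solutions
    exp (x/2) and exp (-x/2), and a particular solution is found by variation
    of constants, so both problems are solvable on the interval. Let
    (u, v) be in the adjoint of the minimal relation. Let f solve the equation
    with right-hand side v and the boundary values of u, so that (f, v) is in
    the maximal relation. The difference r = u - f vanishes at a and b; the
    solution h of the equation with source r and vanishing derivative at both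
    ends gives a pair (h, r) of the minimal relation. Green's formula for
    (f, v) and the assumption on (u, v) now give <u, r> = <v, h> = <f, r>, so
    <r, r> = 0 and u = f ([adjoint_Tmin_sub]). Finally, an element of the
    adjoint of the maximal relation belongs to the maximal relation by what
    was just shown, and its boundary terms against all pairs of the maximal
    relation vanish. As these pairs attain arbitrary boundary values, its own
    boundary values are zero ([adjoint_Tmax_sub]). Both relations are thus
    adjoints, and adjoints are closed because the scalar product is continuous
    ([adjoint_closed]).

    The relations are given by a distributional equation between locally
    absolutely continuous functions, so the classical background enters in two
    places. First, absolutely continuous functions are primitives of their
    derivatives: the variation function is again absolutely continuous, its
    Stieltjes measure is dominated by Lebesgue measure, and a density exists by
    the Radon-Nikodym theorem ([abs_cont_primitive]). Secondly, a weak solution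
    is a strong one: integrating the equation twice gives a function with the
    same weak second derivative, and by the du Bois-Reymond lemma two such
    functions differ by an affine one ([weak_solution], [weak_affine]). The
    test functions needed there are built from exp (-1/x).

    The whole analysis is done for real functions; complex functions are
    treated through their real and imaginary parts, which satisfy the same
    real equation. *)

(** * Locally integrable functions *)

Section LocallyIntegrable.
Context {R : realType}.
Implicit Types (mu : {measure set (measurableTypeR R) -> \bar R}).
Implicit Types (f g phi : R -> R) (x y z : R).

Definition locfin mu := forall x y, (mu `[x, y[%classic < +oo)%E.

Definition locint mu f := forall x y, mu.-integrable `[x, y[ (EFin \o f).

Definition locbounded f := forall x y, exists M, forall t, x <= t <= y -> `|f t| <= M.

Lemma locboundedD f g : locbounded f -> locbounded g -> locbounded (fun x => f x + g x).
Proof.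
move=> bf bg x y; have [M1 B1] := bf x y; have [M2 B2] := bg x y.
by exists (M1 + M2) => t txy; apply: (le_trans (ler_normD _ _)); rewrite lerD ?B1 ?B2.
Qed.

Lemma locboundedM f g : locbounded f -> locbounded g -> locbounded (fun x => f x * g x).
Proof.
move=> bf bg x y; have [M1 B1] := bf x y; have [M2 B2] := bg x y.
by exists (M1 * M2) => t txy; rewrite normrM ler_pM ?B1 ?B2.
Qed.

Lemma locbounded_cst (k : R) : locbounded (fun _ : R => k).
Proof. by move=> x y; exists `|k|. Qed.

Lemma locboundedB f g : locbounded f -> locbounded g -> locbounded (fun x => f x - g x).
Proof.
move=> bf bg x y; have [M1 B1] := bf x y; have [M2 B2] := bg x y.
by exists (M1 + M2) => t txy; apply: (le_trans (ler_normB _ _)); rewrite lerD ?B1 ?B2.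
Qed.

Lemma setT_bigcup_itvco : [set: measurableTypeR R] = \bigcup_(n : nat) `[- n%:R : R, n%:R[%classic.
Proof.
apply/seteqP; split => // x _; exists (Num.truncn (`|x|)).+1 => //=.
rewrite in_itv /=; have := truncnS_gt `|x|.
by rewrite ltr_norml => /andP[h ->]; rewrite (ltW h).
Qed.

Lemma itvcoS (x y x' y' : R) : x <= x' -> y' <= y -> `[x', y'[ `<=` `[x, y[.
Proof.
move=> xx yy t; rewrite /= !in_itv /= => /andP[h1 h2].
by rewrite (le_trans xx h1) (lt_le_trans h2 yy).
Qed.

Lemma locint_chasles mu f x y z : locint mu f -> x <= y -> y <= z ->
  \int[mu]_(t in `[x, z[) f t = \int[mu]_(t in `[x, y[) f t + \int[mu]_(t in `[y, z[) f t.
Proof.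
move=> fi xy yz.
have E : `[x, z[%classic = `[x, y[%classic `|` `[y, z[%classic.
  apply/seteqP; split => t; rewrite /= !in_itv /=.
    by move=> /andP[h1 h2]; case: (ltP t y) => ?; [left; rewrite h1|right].
  move=> [/andP[h1 h2]|/andP[h1 h2]]; first by rewrite h1 (lt_le_trans h2 yz).
  by rewrite (le_trans xy h1).
rewrite E Rintegral_setU//.
- by rewrite -E; exact: fi.
- apply/disj_set2P; apply/seteqP; split => t //=; rewrite !in_itv /= => -[/andP[_ h1] /andP[h2 _]].
  by move: (lt_le_trans h1 h2); rewrite ltxx.
Qed.

Lemma locbounded_itv f x y : locbounded f -> [bounded f t | t in `[x, y[%classic].
Proof.
move=> /(_ x y)[M fM]; exists M; split; first exact: num_real.
move=> z Mz t /=; rewrite in_itv /= => /andP[h1 h2].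
by rewrite (le_trans (fM _ _) (ltW Mz))// h1 ltW.
Qed.

Lemma locint_bounded mu f : locfin mu -> measurable_fun [set: measurableTypeR R] f -> locbounded f ->
  locint mu f.
Proof.
move=> lm mf bf x y; apply: measurable_bounded_integrable => //.
- exact: (measurable_funS _ _ mf).
- exact: locbounded_itv.
Qed.

Lemma locintM mu f g : locint mu g -> measurable_fun [set: measurableTypeR R] f -> locbounded f ->
  locint mu (fun t => f t * g t).
Proof.
move=> gi mf bf x y; have mf' := measurable_funS measurableT (@subsetT _ `[x, y[) mf.
exact: (@integrableMr _ _ _ mu `[x, y[ (measurable_itv _) f _ mf'
  (locbounded_itv x y bf) (gi x y)).
Qed.

Lemma locintMr mu f g : locint mu g -> measurable_fun [set: measurableTypeR R] f ->
  locbounded f -> locint mu (fun t => g t * f t).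
Proof.
move=> gi mf bf; have := locintM gi mf bf.
by rewrite (_ : (fun t => f t * g t) = (fun t => g t * f t))//; apply/funext => t; rewrite mulrC.
Qed.

Lemma locint_norm mu f : locint mu f -> locint mu (fun t => `|f t|).
Proof. by move=> fi x y; apply: (integrable_norm (fi x y)). Qed.

Lemma locintD mu f g : locint mu f -> locint mu g -> locint mu (fun t => f t + g t).
Proof. by move=> fi gi x y; apply: (integrableD _ (fi x y) (gi x y)). Qed.

Lemma locintZ mu f c : locint mu f -> locint mu (fun t => c * f t).
Proof. by move=> fi x y; apply: (integrableZl _ c (fi x y)). Qed.

Lemma locintB mu f g : locint mu f -> locint mu g -> locint mu (fun t => f t - g t).
Proof. by move=> fi gi x y; apply: (integrableB _ (fi x y) (gi x y)). Qed.

Lemma locint_measurable mu f : locint mu f -> measurable_fun [set: measurableTypeR R] f.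
Proof.
move=> fi; rewrite setT_bigcup_itvco; apply/measurable_fun_bigcup => // n.
by have /integrableP[/measurable_EFinP] := fi (- n%:R) n%:R.
Qed.

Lemma normr_int_le mu f x y : locint mu f ->
  `|\int[mu]_(t in `[x, y[) f t| <= \int[mu]_(t in `[x, y[) `|f t|.
Proof. by move=> fi; apply: le_normr_Rintegral. Qed.

Lemma int_mono mu f x y x' y' : locint mu f -> (forall t, 0 <= f t) ->
  x' <= x -> y <= y' ->
  \int[mu]_(t in `[x, y[) f t <= \int[mu]_(t in `[x', y'[) f t.
Proof.
move=> fi f0 xx yy; apply: fine_le.
- exact: (integrable_fin_num _ (fi x y)).
- exact: (integrable_fin_num _ (fi x' y')).
apply: ge0_subset_integral => //.
- by have /integrableP[] := fi x' y'.
- by move=> t _; rewrite lee_fin.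
- exact: itvcoS.
Qed.

Lemma int_itvco0 mu f x y : y <= x -> \int[mu]_(t in `[x, y[) f t = 0.
Proof. by move=> yx; rewrite set_itv_ge ?Rintegral_set0// bnd_simp -leNgt. Qed.

(** The integral over [`[c, y[] is the difference of the integrals of [`|f|]
    and of [`|f| - f], which are monotone in [y]. *)
Lemma int_primitive_measurable mu f c : locint mu f ->
  measurable_fun [set: measurableTypeR R] (fun y => \int[mu]_(t in `[c, y[) f t).
Proof.
move=> fi.
have -> : (fun y => \int[mu]_(t in `[c, y[) f t) =
  (fun y => \int[mu]_(t in `[c, y[) `|f t| - \int[mu]_(t in `[c, y[) (`|f t| - f t)).
  apply/funext => y; rewrite RintegralB//; last exact: locint_norm.
    by rewrite opprB addrC subrK.
apply: measurable_funB; apply: nondecreasing_measurable => // y y' yy.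
- by apply: int_mono => //; exact: locint_norm.
- apply: int_mono => //; first by apply: locintB => //; exact: locint_norm.
  by move=> t; rewrite subr_ge0 ler_norm.
Qed.

Lemma int_primitive_bounded mu f c : locint mu f ->
  locbounded (fun y => \int[mu]_(t in `[c, y[) f t).
Proof.
move=> fi x y; exists (\int[mu]_(t in `[c, y[) `|f t|) => t /andP[_ ty].
apply: (le_trans (normr_int_le c t fi)).
by apply: int_mono => //; exact: locint_norm.
Qed.

(** The intervals [`[x, y[] shrink to the empty set as [x] increases to [y],
    so their measures vanish in the limit. This is where the half-open
    intervals of the statement produce left continuity. *)
Lemma int_left_continuous mu f c y : locfin mu -> locint mu f -> c < y ->
  \int[mu]_(t in `[c, x[) f t @[x --> y^'-] --> \int[mu]_(t in `[c, y[) f t.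
Proof.
move=> lm fi cy.
have mcy : measurable (`[c, y[%classic : set (measurableTypeR R)) by exact: measurable_itv.
have fi' : mu.-integrable setT (EFin \o (f \_ `[c, y[)).
  by rewrite -restrict_EFin; exact: ((integrable_mkcond _ mcy).1 (fi c y)).
apply/cvgrPdist_lt => e e0.
have [d [d0 dP]] := integral_normr_continuous fi' e0.
have [dd ddP] : exists dd : R, dd < y /\ forall x, dd < x -> x < y -> (mu `[x, y[%classic < d%:E)%E.
  (* Continuity from above, along a sequence of intervals ending at [y]. *)
  pose F (n : nat) := `[y - n.+1%:R^-1, y[%classic : set (measurableTypeR R).
  have cF : \bigcap_n F n = set0.
    apply/seteqP; split => // t /= h.
    have : F 0%N t by apply: h.
    rewrite /F /= in_itv /= => /andP[_ ty].
    have yt : 0 < y - t by rewrite subr_gt0.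
    have [n nP] := ltr_add_invr yt.
    have := h n I; rewrite /F /= in_itv /= => /andP[+ _].
    by rewrite lerBlDr -lerBlDl leNgt -[X in X < _]add0r nP.
  have cv : mu (F n) @[n --> \oo] --> mu (\bigcap_n F n).
    apply: nonincreasing_cvg_mu => //.
    - exact: lm.
    - by move=> n; exact: measurable_itv.
    - by rewrite cF.
    - move=> m n mn; rewrite subsetEset; apply: itvcoS => //.
      by rewrite lerB// lef_pV2 ?posrE// ler_nat.
  move: cv; rewrite cF measure0 => cv.
  have [N _ NP] : \forall n \near \oo, (mu (F n) < d%:E)%E.
    have h0 : (0 < d%:E)%E by rewrite lte_fin.
      exact: (cv (fun u => (u < d%:E)%E) (open_ereal_lt' h0)).
  exists (y - N.+1%:R^-1); split; first by rewrite ltrBlDr ltrDl.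
  move=> x dx xy; apply: le_lt_trans (NP N (leqnn _)).
  by apply: le_measure; rewrite ?inE//; [exact: measurable_itv..|apply: itvcoS => //; exact: ltW].
near=> x.
have xy : x < y by near: x; exact: nbhs_left_lt.
have cx : c <= x by near: x; exact: nbhs_left_ge.
rewrite (locint_chasles fi cx (ltW xy)) addrAC subrr add0r.
apply: le_lt_trans (normr_int_le _ _ fi) _.
have := dP _ (measurable_itv `[x,y[); rewrite (_ : \int[mu]_(x in _) _ = \int[mu]_(t in `[x, y[) `|f t|); last first.
  apply: eq_Rintegral => t; rewrite inE /= in_itv /= => /andP[h1 h2].
  by rewrite patchE mem_set//= in_itv /= h2 (le_trans cx h1).
apply; apply: ddP.2 => //.
Unshelve. all: by end_near. Qed.

End LocallyIntegrable.

(** * Primitives with respect to Lebesgue measure *)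

Notation leb := lebesgue_measure.

Section Primitives.
Context {R : realType}.
Implicit Types (mu : {measure set (measurableTypeR R) -> \bar R}).
Implicit Types (f g phi psi : R -> R) (x y z c d : R).

Lemma ae_impl mu (P Q : measurableTypeR R -> Prop) : (forall x, P x -> Q x) ->
  {ae mu, forall x, P x} -> {ae mu, forall x, Q x}.
Proof. by move=> PQ; apply: (@filterS _ _ (ae_filter_ringOfSetsType mu)). Qed.

Lemma ae_and mu (P Q : measurableTypeR R -> Prop) :
  {ae mu, forall x, P x} -> {ae mu, forall x, Q x} -> {ae mu, forall x, P x /\ Q x}.
Proof. exact: (@filterI _ _ (ae_filter_ringOfSetsType mu)). Qed.

Lemma locfin_leb : locfin (leb : {measure set (measurableTypeR R) -> \bar R}).
Proof.
by move=> x y; rewrite /= lebesgue_measure_itv /=; case: ifP => _; rewrite ?ltry -?EFinB ?ltry.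
Qed.

Definition oint_from mu c f x :=
  \int[mu]_(t in `[c, x[) f t - \int[mu]_(t in `[x, c[) f t.

Lemma oint_from_chasles mu c f x y : locint mu f -> x <= y ->
  oint_from mu c f y - oint_from mu c f x = \int[mu]_(t in `[x, y[) f t.
Proof.
move=> fi xy; rewrite /oint_from.
case: (leP c x) => cx.
  rewrite (locint_chasles fi cx xy) (int_itvco0 _ _ (le_trans cx xy)) (int_itvco0 _ _ cx); lra.
case: (leP c y) => cy.
  rewrite (locint_chasles fi (ltW cx) cy) (int_itvco0 _ _ cy) (int_itvco0 _ _ (ltW cx)); lra.
rewrite (locint_chasles fi xy (ltW cy)) (int_itvco0 _ _ (ltW cx)) (int_itvco0 _ _ (ltW cy)); lra.
Qed.

Lemma oint_fromxx mu c f : oint_from mu c f c = 0.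
Proof. by rewrite /oint_from subrr. Qed.

Lemma oint_from_itv mu c f x : c <= x ->
  oint_from mu c f x = \int[mu]_(t in `[c, x[) f t.
Proof. by move=> cx; rewrite /oint_from (int_itvco0 _ _ cx) subr0. Qed.

(** Being a primitive of a locally integrable function is the workable form of
    local absolute continuity. The density is a parameter, because several
    densities that agree almost everywhere occur for the same function. *)
Definition primitive f phi := locint leb phi /\
  forall x y, x <= y -> f y - f x = \int[leb]_(t in `[x, y[) phi t.

Lemma primitive_oint_from phi c : locint leb phi -> primitive (oint_from leb c phi) phi.
Proof. by move=> phii; split => // x y xy; exact: oint_from_chasles. Qed.

Lemma primitiveD f phi g psi : primitive f phi -> primitive g psi ->
  primitive (fun x => f x + g x) (fun x => phi x + psi x).
Proof.
move=> [pi fp] [qi gp]; split; first exact: locintD.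
move=> x y xy; rewrite RintegralD//.
by rewrite -fp// -gp//; lra.
Qed.

Lemma primitiveZ f phi k : primitive f phi ->
  primitive (fun x => k * f x) (fun x => k * phi x).
Proof.
move=> [pi fp]; split; first exact: locintZ.
by move=> x y xy; rewrite RintegralZl// -fp//; lra.
Qed.

Lemma primitiveB f phi g psi : primitive f phi -> primitive g psi ->
  primitive (fun x => f x - g x) (fun x => phi x - psi x).
Proof.
move=> [pi fp] [qi gp]; split; first exact: locintB.
move=> x y xy; rewrite RintegralB//.
by rewrite -fp// -gp//; lra.
Qed.

Lemma primitive_ae f phi psi : primitive f phi -> locint leb psi ->
  {ae (leb : {measure set (measurableTypeR R) -> \bar R}), forall x, phi x = psi x} ->
  primitive f psi.
Proof.
move=> [pi fp] qi e; split => // x y xy; rewrite fp//.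
congr fine; apply: ae_eq_integral => //.
- by have /integrableP[] := pi x y.
- by have /integrableP[] := qi x y.
- by apply: ae_impl e => t /= -> _.
Qed.

Lemma primitive_locbounded f phi : primitive f phi -> locbounded f.
Proof.
move=> [pi fp] x y; exists (`|f x| + \int[leb]_(t in `[x, y[) `|phi t|) => t /andP[xt ty].
rewrite -[f t](subrK (f x)) addrC fp//; apply: (le_trans (ler_normD _ _)); rewrite lerD2l.
apply: (le_trans (normr_int_le _ _ pi)); apply: int_mono => //; exact: locint_norm.
Qed.

(** Absolute continuity of the integral: it gives the continuity of primitives
    and their absolute continuity in the sense of finite interval families. *)
Lemma locint_small mu f x y e : locint mu f -> 0 < e ->
  exists2 d, 0 < d & forall A : set (measurableTypeR R), measurable A -> A `<=` `[x, y[ ->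
    (mu A < d%:E)%E -> \int[mu]_(t in A) `|f t| < e.
Proof.
move=> fi e0.
have mxy : measurable (`[x, y[%classic : set (measurableTypeR R)) by exact: measurable_itv.
have fi' : mu.-integrable setT (EFin \o (f \_ `[x, y[)).
  by rewrite -restrict_EFin; exact: ((integrable_mkcond _ mxy).1 (fi x y)).
have [d [d0 dP]] := integral_normr_continuous fi' e0.
exists d => // A mA Axy Ad.
rewrite (_ : \int[mu]_(t in A) _ = \int[mu]_(t in A) `|(f \_ `[x, y[) t|); first exact: dP.
by apply: eq_Rintegral => t; rewrite inE => /Axy txy; rewrite patchE mem_set.
Qed.

Lemma primitive_continuous f phi : primitive f phi -> continuous f.
Proof.
move=> [pi fp] x.
apply/cvgrPdist_lt => e e0.
have [d d0 dP] := locint_small (x - 1) (x + 1) pi e0.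
have key (u v : R) : x - 1 <= u -> u <= v -> v <= x + 1 -> v - u < d -> `|f v - f u| < e.
  move=> xu uv vx vud; rewrite fp//.
  apply: (le_lt_trans (normr_int_le _ _ pi)); apply: dP => //.
    exact: itvcoS.
  rewrite /= lebesgue_measure_itv /=; case: ifP => _; last by rewrite lte_fin.
  by rewrite -EFinB lte_fin.
near=> y.
have xy1 : `|x - y| < 1 by near: y; exact: (@cvgr_dist_lt _ _ _ _ _ id x (@cvg_id _ _)).
have xyd : `|x - y| < d by near: y; exact: (@cvgr_dist_lt _ _ _ _ _ id x (@cvg_id _ _)).
move: xy1 xyd => /ltr_normlP[h1 h2] /ltr_normlP[h3 h4].
case: (leP y x) => yx; first by apply: key => //; lra.
by rewrite distrC; apply: key => //; lra.
Unshelve. all: by end_near. Qed.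

Lemma primitive_measurable f phi : primitive f phi -> measurable_fun [set: measurableTypeR R] f.
Proof. by move=> fp; apply: continuous_measurable_fun; exact: primitive_continuous fp. Qed.

End Primitives.

(** * Integration by parts against a measure *)

Section ByParts.
Context {R : realType}.
Implicit Types (mu : {measure set (measurableTypeR R) -> \bar R}).
Implicit Types (f g phi psi : R -> R) (x y z c d : R).

Let mitv c d : measurable (`[c, d[%classic : set (measurableTypeR R)).
Proof. exact: measurable_itv. Qed.

Section Restriction.
Context (mu : {measure set (measurableTypeR R) -> \bar R}) (c d : R)
  (fincd : (mu `[c, d[%classic < +oo)%E).

Let nu := mfrestr (mitv c d) fincd.

(** Fubini's theorem applies to finite measures, so the locally finite ones
    are first cut down to a bounded interval. *)
Lemma integral_mfrestr_itv (k : R -> R) (c' d' : R) : c <= c' -> d' <= d ->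
  mu.-integrable `[c', d'[ (EFin \o k) ->
  (\int[nu]_t ((k \_ `[c', d'[) t)%:E = (\int[mu]_(t in `[c', d'[) k t)%:E)%E.
Proof.
move=> cc dd ki.
transitivity (\int[nu]_(t in `[c', d'[) (k t)%:E)%E.
  rewrite [RHS]integral_mkcond; apply: eq_integral => t _.
  by rewrite /= restrict_EFin.
rewrite (@eq_measure_integral _ _ _ _ mu).
  by rewrite /Rintegral fineK//; apply: integrable_fin_num.
move=> A mA Acd; rewrite /= /mfrestr /mrestr setIidl//.
by apply: (subset_trans Acd); exact: itvcoS.
Qed.

Lemma integrable_mfrestr_itv (k : R -> R) :
  mu.-integrable `[c, d[ (EFin \o k) ->
  nu.-integrable setT (EFin \o (k \_ `[c, d[)).
Proof.
move=> ki.
apply/integrableP; split.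
  apply/measurable_EFinP; apply/(measurable_restrictT _ _).1 => //.
  by have /integrableP[/measurable_EFinP] := ki.
have := integral_mfrestr_itv (k := fun t => `|k t|) (lexx c) (lexx d) (integrable_norm ki).
under eq_integral.
  move=> t _; rewrite (_ : (_ \_ _) t = `|(k \_ `[c, d[) t|); last first.
    by rewrite !patchE; case: ifP => // _; rewrite normr0.
  over.
by move=> /= ->; rewrite ltry.
Qed.

End Restriction.

Lemma tensor_integrable (d1 d2 : measure_display) (T1 : measurableType d1) (T2 : measurableType d2)
  (m1 : {finite_measure set T1 -> \bar R}) (m2 : {finite_measure set T2 -> \bar R})
  (f : T1 -> R) (g : T2 -> R) :
  m1.-integrable setT (EFin \o f) -> m2.-integrable setT (EFin \o g) ->
  (m1 \x m2)%E.-integrable setT (fun z : T1 * T2 => (f z.1 * g z.2)%:E).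
Proof.
move=> fi gi.
have mf : measurable_fun setT f by have /integrableP[/measurable_EFinP] := fi.
have mg : measurable_fun setT g by have /integrableP[/measurable_EFinP] := gi.
apply/integrable12ltyP.
  apply/measurable_EFinP; apply: measurable_funM.
    exact: (measurableT_comp mf measurable_fst).
  exact: (measurableT_comp mg measurable_snd).
have gfin : (\int[m2]_y `|(g y)%:E| < +oo)%E by have /integrableP[] := gi.
have g0 : (0 <= \int[m2]_y `|(g y)%:E|)%E by exact: integral_ge0.
have gE : (\int[m2]_y `|(g y)%:E| = (fine (\int[m2]_y `|(g y)%:E|))%:E)%E.
  by rewrite fineK// ge0_fin_numE.
have E (x : T1) : (\int[m2]_y `|(f x * g y)%:E| = `|(f x)%:E| * (fine (\int[m2]_y `|(g y)%:E|))%:E)%E.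
  rewrite -gE -ge0_integralZl//; last by apply: measurableT_comp => //; exact/measurable_EFinP.
  by apply: eq_integral => y _; rewrite EFinM abseM.
rewrite (eq_integral (fun x : T1 => `|(f x)%:E| * (fine (\int[m2]_y `|(g y)%:E|))%:E))%E; last first.
  by move=> x _; exact: E.
rewrite ge0_integralZr//; last 2 first.
- by apply: measurableT_comp => //; exact/measurable_EFinP.
- by rewrite lee_fin fine_ge0.
rewrite muleC.
by apply: lte_mul_pinfty => //; [rewrite lee_fin fine_ge0|have /integrableP[] := fi].
Qed.

(** Both sides are the integral of [phi s * g t] over the triangle
    [c <= t < s < d]: integrating in [s] first gives the left-hand side,
    integrating in [t] first the right-hand side. *)
Lemma triangle_fubini mu f phi g c d : locfin mu -> locint mu g -> primitive f phi ->
  \int[mu]_(t in `[c, d[) ((f d - f t) * g t) =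
  \int[leb]_(s in `[c, d[) (phi s * \int[mu]_(t in `[c, s[) g t).
Proof.
move=> lm gi /[dup] fp [phii fE].
have lleb := @locfin_leb R.
pose m1 := mfrestr (mitv c d) (lleb c d).
pose m2 := mfrestr (mitv c d) (lm c d).
pose pD : measurableTypeR R -> R := phi \_ `[c, d[.
pose gD : measurableTypeR R -> R := g \_ `[c, d[.
have pDi : m1.-integrable setT (EFin \o pD) := integrable_mfrestr_itv (lleb c d) (phii c d).
have gDi : m2.-integrable setT (EFin \o gD) := integrable_mfrestr_itv (lm c d) (gi c d).
have mpD : measurable_fun setT pD by have /integrableP[/measurable_EFinP] := pDi.
have mgD : measurable_fun setT gD by have /integrableP[/measurable_EFinP] := gDi.
pose A : set (measurableTypeR R * measurableTypeR R) := [set z | z.2 < z.1].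
have mA : measurable A.
  have := @measurable_fun_ltr _ _ R setT snd fst measurable_snd measurable_fst.
  by move=> /(_ measurableT [set true] I); rewrite setTI.
pose F (z : measurableTypeR R * measurableTypeR R) : \bar R := (pD z.1 * gD z.2 * \1_A z)%:E.
have Fi : (m1 \x m2)%E.-integrable setT F.
  apply: le_integrable (tensor_integrable pDi gDi) => //.
    apply/measurable_EFinP; apply: measurable_funM; last exact: measurable_indic.
    apply: measurable_funM.
      exact: (measurableT_comp mpD measurable_fst).
    exact: (measurableT_comp mgD measurable_snd).
  move=> z _; rewrite /F /= lee_fin normrM ler_piMr//.
  by rewrite indicE; case: (_ \in _); rewrite ?normr1 ?normr0.
have AE s t : ((s, t) \in A) = (t < s) by apply/idP/idP; rewrite inE.
have := Fubini Fi.
have E1 s : (\int[m2]_t F (s, t) = (((fun s => phi s * \int[mu]_(t in `[c, s[) g t) \_ `[c, d[) s)%:E)%E.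
  rewrite patchE; case: ifPn => sD; last first.
    under eq_integral.
      move=> t _; rewrite /F /pD /= patchE (negbTE sD) !mul0r.
      over.
    by rewrite integral0.
  move: (sD); rewrite inE /= in_itv /= => /andP[cs sd].
  rewrite -RintegralZl//.
  rewrite -(integral_mfrestr_itv (lm c d)) //; last first.
  - exact: (integrableZl _ (phi s) (gi c s)).
  - exact: ltW.
  apply: eq_integral => t _; congr EFin; rewrite /F /pD /gD /= !patchE sD indicE.
  rewrite AE !mem_setE !in_itv /=.
  by case: (leP c t) => ct; case: (ltP t s) => ts; case: (ltP t d) => td //=;
    rewrite ?(mulr0, mul0r, mulr1)//; move: (lt_trans ts sd); rewrite ltNge td.
have E2 t : (\int[m1]_s F (s, t) = (((fun t => (f d - f t) * g t) \_ `[c, d[) t)%:E)%E.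
  rewrite patchE; case: ifPn => tD; last first.
    under eq_integral.
      move=> s _; rewrite /F /gD /= [(g \_ _) t]patchE (negbTE tD) mulr0 mul0r.
      over.
    by rewrite integral0.
  move: (tD); rewrite inE /= in_itv /= => /andP[ct td].
  rewrite (fE _ _ (ltW td)) -RintegralZr//.
  rewrite -(integral_mfrestr_itv (lleb c d)) //; last first.
  - exact: (integrableZr _ (g t) (phii t d)).
  have mF : measurable_fun setT (fun s => F (s, t)).
    apply: (measurableT_comp _ (pair2_measurable t)).
    by have /integrableP[] := Fi.
  apply: ae_eq_integral => //.
    apply/measurable_EFinP; apply/(measurable_restrictT _ _).1 => //.
    by apply: measurable_funM => //; have /integrableP[/measurable_EFinP] := phii t d.
  (* The two integrands may differ on the diagonal, a Lebesgue null set. *)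
  exists [set t]; split; first exact: measurable_set1.
    apply/eqP; rewrite eq_le measure_ge0 andbT -(lebesgue_measure_set1 t).
    change (leb ([set t] `&` `[c, d[%classic) <= leb [set t])%E.
    apply: le_measure; last exact: subIsetl.
    - by rewrite inE; apply: measurableI; [exact: measurable_set1|exact: mitv].
    - by rewrite inE; exact: measurable_set1.
  move=> s /= /existsNP[_]; apply: contra_notP => st; congr EFin; rewrite /F /pD /gD /= !patchE tD indicE.
  rewrite AE !mem_setE !in_itv /=.
  case: (leP c s) => cs; case: (ltgtP t s) => ts; case: (ltP s d) => sd //=;
    rewrite ?(mulr0, mul0r, mulr1)//.
  - by case: st.
  - by move: (le_lt_trans ct ts); rewrite ltNge (ltW cs).
  - by case: st.
under eq_integral do rewrite E1.
under [X in _ = X -> _]eq_integral do rewrite E2.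
rewrite !integral_mfrestr_itv//.
- by move=> [].
- apply: (@locintM _ mu (fun t => f d - f t) g gi).
  + by apply: measurable_funB => //; exact: primitive_measurable fp.
  + exact: locboundedB (locbounded_cst _) (primitive_locbounded fp).
- exact: (locintMr phii (int_primitive_measurable c gi) (int_primitive_bounded c gi) c d).
Qed.

(** Integration by parts for a locally absolutely continuous function against
    a measure with density: it is Fubini on the triangle below the diagonal. *)
Lemma int_by_parts mu f phi g c d : locfin mu -> locint mu g -> primitive f phi ->
  \int[mu]_(t in `[c, d[) (f t * g t) =
  f d * \int[mu]_(t in `[c, d[) g t -
  \int[leb]_(s in `[c, d[) (phi s * \int[mu]_(t in `[c, s[) g t).
Proof.
move=> lm gi fp; rewrite -(triangle_fubini c d lm gi fp).
rewrite -RintegralZl// -RintegralB//.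
- by apply: eq_Rintegral => t _; lra.
- exact: (locintZ (f d) gi).
- apply: (@locintM _ mu (fun t => f d - f t) g gi).
  + by apply: measurable_funB => //; exact: primitive_measurable fp.
  + exact: locboundedB (locbounded_cst _) (primitive_locbounded fp).
Qed.

(** The product rule is the case of integration by parts in which the measure
    with density is Lebesgue measure. *)
Lemma primitiveM f phi g psi : primitive f phi -> primitive g psi ->
  primitive (fun x => f x * g x) (fun x => phi x * g x + f x * psi x).
Proof.
move=> fp gp; have [phii fE] := fp; have [psii gE] := gp.
have mf := primitive_measurable fp; have mg := primitive_measurable gp.
have bf := primitive_locbounded fp; have bg := primitive_locbounded gp.
have i1 : locint leb (fun x => phi x * g x).
  exact: locintMr.
have i2 : locint leb (fun x => f x * psi x) by exact: locintM.
split; first exact: locintD.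
move=> x y xy; rewrite RintegralD//.
rewrite (int_by_parts x y (@locfin_leb R) psii fp) -gE//.
have -> : \int[leb]_(s in `[x, y[) (phi s * \int[leb]_(t in `[x, s[) psi t) =
  \int[leb]_(s in `[x, y[) (phi s * g s - g x * phi s).
  apply: eq_Rintegral => s; rewrite inE /= in_itv /= => /andP[xs _].
  by rewrite -gE//; lra.
rewrite RintegralB//; last exact: (locintZ (g x) phii).
by rewrite RintegralZl// -fE//; lra.
Qed.

End ByParts.

(** * The source term of the equation *)

Section WeightedIntegral.
Context {R : realType} (om : loc_charge R).
Implicit Types (f g phi psi : R -> R) (x y z c d : R).

(** The integral against a charge may be computed with any decomposition into
    a difference of finite measures. The restrictions of a locally finite
    signed measure to different intervals come with unrelated Hahn
    decompositions; this lemma makes the resulting integrals comparable. *)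
Lemma charge_RintegralE (nu : {charge set (measurableTypeR R) -> \bar R})
  (m1 m2 : {finite_measure set (measurableTypeR R) -> \bar R}) x y g :
  (forall A, measurable A -> A `<=` `[x, y[ -> nu A = m1 A - m2 A)%E ->
  measurable_fun [set: measurableTypeR R] g -> locbounded g ->
  charge_Rintegral nu `[x, y[ g =
  \int[m1]_(t in `[x, y[) g t - \int[m2]_(t in `[x, y[) g t.
Proof.
move=> nuE mg bg; rewrite /charge_Rintegral.
set pos := jordan_pos _; set neg := jordan_neg _.
have fini (m : {finite_measure set (measurableTypeR R) -> \bar R}) :
    m.-integrable `[x, y[ (EFin \o g).
  apply: (locint_bounded (mu := m)) => // u v.
  by rewrite ltey_eq fin_num_measure//; exact: measurable_itv.
have mD : measurable (`[x, y[%classic : set (measurableTypeR R)) by exact: measurable_itv.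
have fin m := integrable_fin_num mD (fini m).
have E : (\int[measure_add pos m2]_(t in `[x, y[) (g t)%:E =
          \int[measure_add neg m1]_(t in `[x, y[) (g t)%:E)%E.
  apply: eq_measure_integral => A mA Axy.
  change (measure_add pos m2 A = measure_add neg m1 A).
  have e : (pos A - neg A = m1 A - m2 A)%E.
    by rewrite -nuE// [RHS](jordan_decomp (hahn_pairP nu) mA) /cadd /= cscaleN1.
  have h1 : pos A \is a fin_num by exact: fin_num_measure.
  have h2 : neg A \is a fin_num by exact: fin_num_measure.
  have h3 : m1 A \is a fin_num by exact: fin_num_measure.
  have h4 : m2 A \is a fin_num by exact: fin_num_measure.
  suff e' : (pos A + m2 A = neg A + m1 A)%E by rewrite !measure_addE.
  move: e h1 h2 h3 h4; move: (pos A) (neg A) (m1 A) (m2 A).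
  move=> [p| |] [n| |] [u| |] [v| |] //= [h] _ _ _ _.
  by rewrite -!EFinD; congr EFin; lra.
move: E; rewrite !integral_measure_add//.
rewrite /Rintegral -(fineK (fin pos)) -(fineK (fin neg)) -(fineK (fin m1)) -(fineK (fin m2)).
by rewrite -!EFinD => -[h]; rewrite /= in h *; lra.
- exact: (fini neg).
- exact: (fini m1).
- exact: (fini pos).
- exact: (fini m2).
Qed.

Definition wint x y g := charge_Rintegral (loc_charge_restr om x y) `[x, y[ g.

Lemma loc_charge_restr_sub A B x y (S : set (measurableTypeR R)) :
  A <= x -> y <= B -> S `<=` `[x, y[ ->
  loc_charge_restr om x y S = loc_charge_restr om A B S.
Proof.
move=> Ax yB Sxy; rewrite /loc_charge_restr !setIidl//.
by apply: subset_trans Sxy _; exact: itvcoS.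
Qed.

(** All subintervals of a bounded window can share the Hahn decomposition of the
    window, so additivity over intervals reduces to that of measures. *)
Lemma wint_window A B : exists m1 m2 : {finite_measure set (measurableTypeR R) -> \bar R},
  forall x y g, A <= x -> y <= B -> measurable_fun [set: measurableTypeR R] g -> locbounded g ->
  wint x y g = \int[m1]_(t in `[x, y[) g t - \int[m2]_(t in `[x, y[) g t.
Proof.
pose nu := loc_charge_restr om A B.
exists (jordan_pos (hahn_pairP nu)), (jordan_neg (hahn_pairP nu)) => x y g Ax yB mg bg.
apply: charge_RintegralE => // S mS Sxy.
transitivity (nu S); first exact: loc_charge_restr_sub.
by rewrite [LHS](jordan_decomp (hahn_pairP nu) mS) /cadd /= cscaleN1.
Qed.

Lemma locfin_finite (m : {finite_measure set (measurableTypeR R) -> \bar R}) : locfin m.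
Proof. by move=> x y; rewrite ltey_eq fin_num_measure//; exact: measurable_itv. Qed.

Context (up : {measure set (measurableTypeR R) -> \bar R}) (lup : locfin up).

Definition source x y g1 g2 : R := wint x y g1 + \int[up]_(t in `[x, y[) g2 t.

(** A locally bounded Borel function is integrable on bounded intervals against
    every locally finite signed measure, which makes the source meaningful. *)
Definition admissible g1 g2 :=
  [/\ measurable_fun [set: measurableTypeR R] g1, locbounded g1 & locint up g2].

Lemma source_window A B : exists m1 m2 : {finite_measure set (measurableTypeR R) -> \bar R},
  forall x y g1 g2, A <= x -> y <= B -> admissible g1 g2 ->
  [/\ locint m1 g1, locint m2 g1, locint up g2 &
  source x y g1 g2 =
   \int[m1]_(t in `[x, y[) g1 t - \int[m2]_(t in `[x, y[) g1 t + \int[up]_(t in `[x, y[) g2 t].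
Proof.
have [m1 [m2 mE]] := wint_window A B; exists m1, m2 => x y g1 g2 Ax yB [mg bg ig].
by split => //; [exact: (locint_bounded (locfin_finite m1))
  |exact: (locint_bounded (locfin_finite m2))|rewrite /source mE].
Qed.

Lemma source_nil x y g1 g2 : admissible g1 g2 -> y <= x -> source x y g1 g2 = 0.
Proof.
move=> ad yx; have [m1 [m2 mE]] := source_window x y.
have [_ _ _ ->] := mE x y _ _ (lexx _) (lexx _) ad.
by rewrite !int_itvco0//; lra.
Qed.

Lemma source_chasles x y z g1 g2 : admissible g1 g2 -> x <= y -> y <= z ->
  source x z g1 g2 = source x y g1 g2 + source y z g1 g2.
Proof.
move=> ad xy yz; have [m1 [m2 mE]] := source_window x z.
have [i1 i2 i3 ->] := mE x z _ _ (lexx _) (lexx _) ad.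
have [_ _ _ ->] := mE x y _ _ (lexx _) yz ad.
have [_ _ _ ->] := mE y z _ _ xy (lexx _) ad.
by rewrite (locint_chasles i1 xy yz) (locint_chasles i2 xy yz) (locint_chasles i3 xy yz); lra.
Qed.

Definition source_from c x g1 g2 := source c x g1 g2 - source x c g1 g2.

Lemma source_from_base A c x g1 g2 : admissible g1 g2 -> A <= c -> A <= x ->
  source_from c x g1 g2 = source A x g1 g2 - source A c g1 g2.
Proof.
move=> ad Ac Ax; rewrite /source_from; case: (leP c x) => cx.
  by rewrite (source_nil ad cx) (source_chasles ad Ac cx); lra.
by rewrite (source_nil ad (ltW cx)) (source_chasles ad Ax (ltW cx)); lra.
Qed.

Lemma source_from_chasles c x y g1 g2 : admissible g1 g2 -> x <= y ->
  source_from c y g1 g2 - source_from c x g1 g2 = source x y g1 g2.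
Proof.
move=> ad xy; pose A := Num.min c x.
have Ac : A <= c by rewrite ge_min lexx.
have Ax : A <= x by rewrite ge_min lexx orbT.
rewrite !(source_from_base ad Ac)//; last exact: le_trans xy.
by rewrite (source_chasles ad Ax xy); lra.
Qed.

(** On a bounded window the source is a combination of three genuine measures,
    so its primitive inherits what holds for each of them. *)
Lemma source_from_window c A B g1 g2 : admissible g1 g2 ->
  exists A' k, exists m1 m2 : {finite_measure set (measurableTypeR R) -> \bar R},
  [/\ A' < A, locint m1 g1, locint m2 g1 & forall x, A <= x <= B ->
  source_from c x g1 g2 = \int[m1]_(t in `[A', x[) g1 t - \int[m2]_(t in `[A', x[) g1 t +
     \int[up]_(t in `[A', x[) g2 t - k].
Proof.
move=> ad; pose A' := Num.min c A - 1.
have Ac : A' <= c by rewrite lerBlDr (le_trans (_ : _ <= c)) ?ge_min ?lexx// lerDl.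
have AA : A' < A by rewrite ltrBlDr (le_lt_trans (_ : _ <= A)) ?ge_min ?lexx ?orbT// ltrDl.
have [m1 [m2 mE]] := source_window A' B.
exists A', (source A' c g1 g2), m1, m2.
have [mg bg _] := ad; split => //.
- exact: (locint_bounded (locfin_finite m1)).
- exact: (locint_bounded (locfin_finite m2)).
move=> x /andP[Ax xB]; rewrite (source_from_base ad Ac); last exact: (le_trans (ltW AA) Ax).
by have [_ _ _ ->] := mE A' x _ _ (lexx _) xB ad.
Qed.

Lemma source_from_measurable c g1 g2 : admissible g1 g2 ->
  measurable_fun [set: measurableTypeR R] (fun x => source_from c x g1 g2).
Proof.
move=> ad; have [_ _ i3] := ad.
rewrite setT_bigcup_itvco; apply/measurable_fun_bigcup => // n.
have [A' [k [m1 [m2 [_ i1 i2 E]]]]] := source_from_window c (- n%:R) n%:R ad.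
apply: (eq_measurable_fun (fun x => \int[m1]_(t in `[A', x[) g1 t - \int[m2]_(t in `[A', x[) g1 t +
     \int[up]_(t in `[A', x[) g2 t - k)).
  by move=> x; rewrite inE /= in_itv /= => /andP[nx xn]; rewrite E// nx ltW.
apply: (@measurable_funS _ _ _ _ setT) => //.
apply: measurable_funB => //; apply: measurable_funD; last exact: int_primitive_measurable.
by apply: measurable_funB; exact: int_primitive_measurable.
Qed.

Lemma source_from_locbounded c g1 g2 : admissible g1 g2 ->
  locbounded (fun x => source_from c x g1 g2).
Proof.
move=> ad x y; have [_ _ i3] := ad.
have [A' [k [m1 [m2 [_ i1 i2 E]]]]] := source_from_window c x y ad.
have [M1 B1] := int_primitive_bounded A' i1 x y.
have [M2 B2] := int_primitive_bounded A' i2 x y.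
have [M3 B3] := int_primitive_bounded A' i3 x y.
exists (M1 + M2 + M3 + `|k|) => t txy; rewrite E//.
apply: (le_trans (ler_normB _ _)); rewrite lerD2r.
apply: (le_trans (ler_normD _ _)); rewrite lerD ?B3//.
by apply: (le_trans (ler_normB _ _)); rewrite lerD ?B1 ?B2.
Qed.

Lemma source_from_left_continuous c g1 g2 y : admissible g1 g2 ->
  source_from c x g1 g2 @[x --> y^'-] --> source_from c y g1 g2.
Proof.
move=> ad; have [_ _ i3] := ad.
have [A' [k [m1 [m2 [A'y i1 i2 E]]]]] := source_from_window c (y - 1) y ad.
have y1y : y - 1 < y by rewrite ltrBlDr ltrDl.
rewrite E ?lexx ?(ltW y1y)//.
pose F x := \int[m1]_(t in `[A', x[) g1 t - \int[m2]_(t in `[A', x[) g1 t +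
     \int[up]_(t in `[A', x[) g2 t - k.
have FE : {near y^'-, F =1 (fun x => source_from c x g1 g2)}.
  near=> x; rewrite E//; apply/andP; split.
    by near: x; apply: nbhs_left_ge.
  by near: x; apply: nbhs_left_le.
apply: (cvg_trans (near_eq_cvg FE)).
have A'y' := lt_trans A'y y1y.
apply: cvgB; last exact: cvg_cst.
apply: cvgD; last exact: int_left_continuous.
by apply: cvgB; apply: int_left_continuous => //; exact: locfin_finite.
Unshelve. all: by end_near. Qed.

(** Integration by parts holds for each of the three measures that make up the
    source on a bounded window, hence for the source. *)
Lemma source_by_parts f phi g1 g2 c d : primitive f phi -> admissible g1 g2 -> c <= d ->
  source c d (fun t => f t * g1 t) (fun t => f t * g2 t) =
  f d * source c d g1 g2 - \int[leb]_(s in `[c, d[) (phi s * source c s g1 g2).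
Proof.
move=> fp ad cd; have [mg bg ig] := ad.
have mf := primitive_measurable fp; have bf := primitive_locbounded fp.
have [phii _] := fp.
have ad' : admissible (fun t => f t * g1 t) (fun t => f t * g2 t).
  by split; [exact: measurable_funM|exact: locboundedM|exact: locintM].
have [m1 [m2 mE]] := source_window c d.
have [_ _ _ ->] := mE c d _ _ (lexx _) (lexx _) ad'.
have [i1 i2 i3 ->] := mE c d _ _ (lexx _) (lexx _) ad.
rewrite (int_by_parts c d (locfin_finite m1) i1 fp).
rewrite (int_by_parts c d (locfin_finite m2) i2 fp).
rewrite (int_by_parts c d lup i3 fp).
have -> : \int[leb]_(s in `[c, d[) (phi s * source c s g1 g2) =
  \int[leb]_(s in `[c, d[) (phi s * \int[m1]_(t in `[c, s[) g1 t -
     phi s * \int[m2]_(t in `[c, s[) g1 t + phi s * \int[up]_(t in `[c, s[) g2 t).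
  apply: eq_Rintegral => s; rewrite inE /= in_itv /= => /andP[cs sd].
  by have [_ _ _ ->] := mE c s _ _ (lexx _) (ltW sd) ad; ring.
have j mu g : locint mu g -> locint leb (fun s => phi s * \int[mu]_(t in `[c, s[) g t).
  by move=> ig'; apply: locintMr => //; [exact: int_primitive_measurable|exact: int_primitive_bounded].
have j1 := j _ _ i1; have j2 := j _ _ i2; have j3 := j _ _ i3.
rewrite RintegralD//; last exact: (locintB j1 j2).
by rewrite RintegralB//; ring.
Qed.

End WeightedIntegral.

(** * Regularity of primitives *)

Section AbsolutelyContinuousFunctions.
Context {R : realType}.
Implicit Types (f g phi psi : R -> R) (x y z c d : R).

Definition abs_cont_real x y f := forall e : R, 0 < e -> exists2 d : R, 0 < d &
  forall (n : nat) (s t : 'I_n -> R),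
    (forall i, x <= s i /\ s i <= t i /\ t i <= y) ->
    trivIset setT (fun i => `]s i, t i[%classic) ->
    \sum_i (t i - s i) < d -> \sum_i `|f (t i) - f (s i)| < e.

Lemma leb_itvoo x y : x <= y -> leb (`]x, y[%classic : set (measurableTypeR R)) = (y - x)%:E.
Proof.
move=> xy; rewrite /= lebesgue_measure_itv /= lte_fin; move: xy; rewrite le_eqVlt => /predU1P[->|xy].
  by rewrite ltxx subrr.
by rewrite xy EFinB.
Qed.

(** The union of a finite family of disjoint intervals of small total length
    has small measure, so the integral of [`|phi|] over it is small. *)
Lemma primitive_abs_cont f phi x y : primitive f phi -> abs_cont_real x y f.
Proof.
move=> [pi fp] e e0; have [d d0 dP] := locint_small x y pi e0.
exists d => // n s t st tr sd.
pose I (i : 'I_n) : set (measurableTypeR R) := `]s i, t i[%classic.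
pose U := \big[setU/set0]_(i < n) I i.
have mI i : measurable (I i) by exact: measurable_itv.
have mU : measurable U by apply: bigsetU_measurable => i _.
have Uxy : U `<=` `[x, y[.
  rewrite /U; apply: (big_ind (fun A => A `<=` `[x, y[)) => //.
    by move=> A B Axy Bxy r [/Axy|/Bxy].
  move=> i _ r; rewrite /I /= !in_itv /= => /andP[sr rt]; have [xs [_ ty]] := st i.
  by rewrite (le_trans xs (ltW sr)) (lt_le_trans rt ty).
have Ud : (leb U < d%:E)%E.
  rewrite /U measure_bigsetU_ord_cond//; last exact: sub_trivIset tr.
  rewrite (eq_bigr (fun i => (t i - s i)%:E)) => [|i _]; last first.
    by apply: leb_itvoo; have [_ []] := st i.
  by rewrite sumEFin lte_fin.
apply: le_lt_trans (dP _ mU Uxy Ud).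
have iI i : leb.-integrable (I i) (fun r => `|phi r|%:E).
  have := locint_norm pi (s i) (t i); apply: integrableS => //.
  exact: subset_itv_oo_co.
have -> : \int[leb]_(r in U) `|phi r| = \sum_i \int[leb]_(r in I i) `|phi r|.
  rewrite /Rintegral /U ge0_integral_bigsetU//=.
  - rewrite sum_fine// => i _.
    exact: (integrable_fin_num _ (iI i)).
  - exact: index_enum_uniq.
  - exact: sub_trivIset tr.
  - have := locint_measurable (locint_norm pi) => m; apply/measurable_EFinP.
    exact: measurable_funS m.
apply: ler_sum => i _; have [_ [sit _]] := st i.
rewrite fp//; apply: (le_trans (normr_int_le _ _ pi)).
by rewrite /I Rintegral_itv_obnd_cbnd//; exact: iI.
Qed.

(** The set of differentiability of a continuous function is a countable
    combination of closed sets, by the Cauchy criterion for its difference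
    quotients; this is what makes the totalised derivative Borel. *)
Lemma derive1_measurable f : continuous f ->
  measurable_fun [set: measurableTypeR R] (derive1 f).
Proof.
move=> cf.
pose q (h x : R) := h^-1 * (f (h + x) - f x).
have cq h : continuous (q h).
  move=> x; apply: cvgMr; apply: cvgB; last exact: cf.
  apply: (@continuous_comp _ _ _ (fun x => h + x) f); last exact: cf.
  by apply: cvgD; [exact: cvg_cst|exact: cvg_id].
(* [C k m]: all difference quotients with steps below [1 / m.+1] are within
   [1 / k.+1] of each other. *)
pose C (k m : nat) := [set x | forall h h', h != 0 -> h' != 0 ->
  `|h| < m.+1%:R^-1 -> `|h'| < m.+1%:R^-1 -> `|q h x - q h' x| <= k.+1%:R^-1].
have clC k m : closed (C k m).
  have -> : C k m = \bigcap_(p in [set p : R * R | [/\ p.1 != 0, p.2 != 0,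
     `|p.1| < m.+1%:R^-1 & `|p.2| < m.+1%:R^-1]])
     ((fun x => `|q p.1 x - q p.2 x|) @^-1` [set r | r <= k.+1%:R^-1]).
    apply/seteqP; split=> x /=; first by move=> h [u v] /= [? ? ? ?]; exact: h.
    by move=> H h h' ? ? ? ?; exact: (H (h, h')).
  apply: closed_bigI => p _; apply: preimage_closed; last exact: closed_le.
  by move=> x _; apply: (@cvg_norm _ _ _ _ _ (fun x => q p.1 x - q p.2 x)); apply: cvgB; exact: cq.
pose D := \bigcap_k \bigcup_m C k m.
have mD : measurable (D : set (measurableTypeR R)).
  apply: bigcap_measurable => // k _; apply: bigcup_measurable => m _.
  exact: closed_measurable.
have qE x : derive1 f x = lim (q h x @[h --> 0^']) by [].
have DP x : D x <-> cvg (q h x @[h --> 0^']).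
  split=> [Dx|cvx k _].
    apply/cauchy_cvgP; apply/cauchy_exP => e e0.
    have [k kP] := ltr_add_invr e0.
    have [m _ mP] := Dx k I.
    have m0 : 0 < m.+1%:R^-1 :> R by rewrite invr_gt0.
    have m20 : 0 < m.+1%:R^-1 / 2 :> R by rewrite divr_gt0.
    exists (q (m.+1%:R^-1 / 2) x).
    suff : \forall h \near (0 : R)^', `|q (m.+1%:R^-1 / 2) x - q h x| < e by [].
    near=> h; apply: le_lt_trans kP; rewrite add0r; apply: mP.
    - by rewrite gt_eqF.
    - by near: h; exact: nbhs_dnbhs_neq.
    - by rewrite gtr0_norm// gtr_pMr// invf_lt1// ltr1n.
    - by near: h; exact: dnbhs0_lt.
  have /cvgrPdist_lt/(_ (k.+1%:R^-1 / 2)) := cvx.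
  rewrite divr_gt0// => /(_ isT) [d /= d0 dP].
  have [m mP] := ltr_add_invr d0.
  exists m => // h h' h0 h'0 hm h'm.
  have key u : u != 0 -> `|u| < m.+1%:R^-1 -> `|lim (q h x @[h --> 0^']) - q u x| < k.+1%:R^-1 / 2.
    move=> u0 um; apply: dP => //=; rewrite sub0r normrN (lt_trans um)//.
    by move: mP; rewrite add0r.
  have := key _ h0 hm; have := key _ h'0 h'm.
  move: (lim _) (q h x) (q h' x) (k.+1%:R^-1) => l u v e.
  rewrite !ltr_norml ler_norml => /andP[h1 h2] /andP[h3 h4]; lra.
pose qn (n : nat) x := q (n.+1%:R^-1) x * \1_D x.
apply: (@measurable_fun_cvg _ _ _ _ qn).
  move=> n; apply: measurable_funM; last exact: measurable_indic.
  exact: continuous_measurable_fun.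
move=> x _; rewrite /qn indicE; case: (boolP (x \in D)) => xD; last first.
  rewrite qE dvgP; last by move=> /DP/mem_set; exact/negP.
  by under eq_fun do rewrite mulr0; exact: cvg_cst.
under eq_fun do rewrite mulr1.
have /DP cvx := set_mem xD.
rewrite qE.
have := (cvgr_dnbhsP (q^~ x) 0 _).1 cvx harmonic; apply; split; last exact: cvg_harmonic.
by move=> n; rewrite gt_eqF// harmonic_gt0.
Unshelve. all: by end_near. Qed.

Lemma derive1_near_shift f F k x : (\forall t \near x, f t = k + F t) ->
  derivable F x 1 -> derivable f x 1 /\ derive1 f x = derive1 F x.
Proof.
move=> fF dF.
have fF' : {near x, (cst k + F) =1 f} by apply: filterS fF => t ->.
have dk : derivable (cst k) x 1 := @derivable_cst R R R k x 1.
have dkF : derivable (cst k + F) x 1 := derivableD dk dF.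
split; first exact: (@near_eq_derivable R R R _ _ x 1 fF' dkF).
have e1 : 'D_1 (cst k + F) x = 'D_1 f x := @near_eq_derive R R R _ _ x 1 fF'.
have e2 : 'D_1 (cst k + F) x = 'D_1 (cst k) x + 'D_1 F x := deriveD dk dF.
have e3 : 'D_1 (cst k) x = 0 := @derive_cst R R R k x 1.
by rewrite !derive1E -e1 e2 e3 add0r.
Qed.

(** Lebesgue's differentiation theorem, applied on each of the intervals from
    [- n] to [n]. *)
Lemma primitive_derive f phi : primitive f phi ->
  {ae (leb : {measure set (measurableTypeR R) -> \bar R}),
    forall x, derivable f x 1 /\ derive1 f x = phi x}.
Proof.
move=> [pi fp].
have loc c d : locally_integrable [set: R] (phi \_ `[c, d]).
  apply: integrable_locally => //.
  have := pi c (d + 1); apply: integrableS => //.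
  by move=> t /=; rewrite !in_itv /= => /andP[-> /=]; lra.
have key (n : nat) : {ae (leb : {measure set (measurableTypeR R) -> \bar R}),
   forall x, - n%:R < x < n%:R -> derivable f x 1 /\ derive1 f x = phi x}.
  pose psi := phi \_ `[- n%:R, n%:R].
  have ip y : leb.-integrable [set` Interval (BLeft (- n%:R)) (BRight y)] (EFin \o psi).
    have := pi (- n%:R) (n%:R + 1) => pin.
    have pin' : leb.-integrable `[- n%:R, n%:R] (EFin \o phi).
      apply: integrableS pin => // t /=; rewrite !in_itv /= => /andP[-> /=]; lra.
    apply: (@integrableS _ _ _ _ setT) => //.
    have mI : measurable (`[- n%:R, n%:R]%classic : set (measurableTypeR R)) by exact: measurable_itv.
    by rewrite -restrict_EFin; exact: ((integrable_mkcond _ mI).1 pin').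
  have := FTC1 ip (loc _ _); apply: ae_impl => x /= + /andP[nx xn].
  rewrite lte_fin nx => /(_ isT) [dF FE].
  set F := (fun y => _) in dF FE.
  have nF : \forall t \near x, f t = f (- n%:R) + F t.
    near=> t.
    have nt : - n%:R < t by near: t; exact: lt_nbhsr.
    have tn : t < n%:R by near: t; exact: lt_nbhsl.
    rewrite -[LHS](subrK (f (- n%:R))) addrC; congr (_ + _); rewrite (fp _ _ (ltW nt)) /F.
    rewrite Rintegral_itv_bndo_bndc//.
    apply: eq_Rintegral => r; rewrite inE /= in_itv /= => /andP[nr rt].
    by rewrite /psi patchE mem_set//= in_itv /= nr (le_trans rt (ltW tn)).
  have [d1 d2] := derive1_near_shift nF dF; split => //.
  by rewrite d2 FE /psi patchE mem_set//= in_itv /= !ltW.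
have := ae_foralln key; apply: ae_impl => x h.
have := truncnS_gt `|x|; rewrite ltr_norml; exact: h.
Unshelve. all: by end_near. Qed.
End AbsolutelyContinuousFunctions.

(** * Total variation of absolutely continuous functions *)

Section TotalVariationOfAbsolutelyContinuous.
Context {R : realType}.
Implicit Types (f : R -> R) (x y z c d a b : R) (L : seq (R * R)) (l : seq R).

(** Families of intervals as lists of end points: refining a family is then
    list concatenation. *)
Definition disjoint_itvs L := pairwise (fun u v : R * R => (u.2 <= v.1) || (v.2 <= u.1)) L.

Definition itvs_within x y L := all (fun u : R * R => [&& x <= u.1, u.1 <= u.2 & u.2 <= y]) L.

Definition total_length L := \sum_(u <- L) (u.2 - u.1).

Definition increments f L := \sum_(u <- L) `|f u.2 - f u.1|.

Lemma abs_cont_real_itvs x y f : abs_cont_real x y f -> forall e, 0 < e -> exists2 d, 0 < d &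
  forall L, itvs_within x y L -> disjoint_itvs L -> total_length L < d -> increments f L < e.
Proof.
move=> acf e e0; have [d d0 dP] := acf e e0; exists d => // L Lxy Ldis.
rewrite /total_length /increments !(big_nth (0, 0)) !big_mkord => Ld.
apply: (dP _ (fun i : 'I_(size L) => (nth (0, 0) L i).1) (fun i => (nth (0, 0) L i).2)) => //.
  by move=> i; have /and3P[] := all_nthP (0, 0) Lxy i (ltn_ord i).
have key (i j : 'I_(size L)) : (i < j)%N ->
   `](nth (0, 0) L i).1, (nth (0, 0) L i).2[ `&` `](nth (0, 0) L j).1, (nth (0, 0) L j).2[ = set0 :> set R.
  move=> ij; apply/seteqP; split => // t [] /=; rewrite !in_itv /= => /andP[h1 h2] /andP[h3 h4].
  have := pairwiseP (0, 0) Ldis; move=> /(_ i j (ltn_ord i) (ltn_ord j) ij) /orP[] h.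
    by move: (lt_trans (lt_le_trans h2 h) h3); rewrite ltxx.
  by move: (lt_trans (lt_le_trans h4 h) h1); rewrite ltxx.
apply/trivIsetP => i j _ _; rewrite neq_ltn => /orP[] ij; first exact: key.
by rewrite setIC; exact: key.
Qed.

Fixpoint pieces a l := if l is b :: l' then (a, b) :: pieces b l' else [::].

Lemma pieces_within a l : path <%R a l -> itvs_within a (last a l) (pieces a l).
Proof.
elim: l a => //= b l ih a /andP[ab pl]; have bl := itv_partition_le (conj pl (eqxx (last b l))).
rewrite lexx (ltW ab) bl /=; apply: sub_all (ih _ pl) => u /and3P[h1 -> ->].
by rewrite (le_trans (ltW ab) h1).
Qed.

Lemma pieces_disjoint a l : path <%R a l -> disjoint_itvs (pieces a l).
Proof.
elim: l a => //= b l ih a /andP[ab pl]; apply/andP; split; last exact: ih.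
by apply: sub_all (pieces_within pl) => u /and3P[h1 _ _]; rewrite /= h1.
Qed.

Lemma pieces_length a l : total_length (pieces a l) = last a l - a.
Proof.
elim: l a => [|b l ih] a; first by rewrite /total_length big_nil subrr.
by rewrite /total_length /= big_cons -/(total_length _) ih /=; lra.
Qed.

Lemma variation_pieces a b f l : itv_partition a b l ->
  variation a b f l = increments f (pieces a l).
Proof.
move=> abl; rewrite variation_zip//; rewrite /increments.
have -> : pieces a l = [seq (p.2, p.1) | p <- zip l (a :: l)].
  by elim: l a {abl} => //= c l ih a; rewrite ih.
by rewrite big_map.
Qed.

(** Absolute continuity controls the sum of the variations, not only of the
    increments: replace the intervals one by one by the pieces of a fine
    partition, which keeps the family disjoint and its total length
    unchanged. *)
Lemma sum_total_variation x y f (d e : R) :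
  (forall L, itvs_within x y L -> disjoint_itvs L -> total_length L < d -> increments f L < e) ->
  forall L1 L2, itvs_within x y (L1 ++ L2) -> disjoint_itvs (L1 ++ L2) ->
  total_length (L1 ++ L2) < d ->
  (\sum_(u <- L1) total_variation u.1 u.2 f + (increments f L2)%:E <= e%:E)%E.
Proof.
move=> H; elim=> [|u L1 ih] L2 /=.
  move=> wL dL lL; rewrite big_nil add0e lee_fin ltW//; exact: H.
move=> /andP[/and3P[xu uu uy] wL] /andP[du dL] lL.
have lL' : (u.2 - u.1) + total_length (L1 ++ L2) < d.
  by move: lL; rewrite /total_length /= big_cons.
rewrite big_cons -addeA.
have TV0 : (0 <= \sum_(u <- L1) total_variation u.1 u.2 f)%E.
  rewrite big_seq; apply: sume_ge0 => v vL1; apply: total_variation_ge0.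
  by have /allP/(_ v) := wL; rewrite mem_cat vL1 => /(_ isT) /and3P[].
have inc0 : 0 <= increments f L2 by apply: sumr_ge0.
have rest : (\sum_(u <- L1) total_variation u.1 u.2 f + (increments f L2)%:E <= e%:E)%E.
  by apply: ih => //; lra.
have restf : (\sum_(u <- L1) total_variation u.1 u.2 f + (increments f L2)%:E)%E \is a fin_num.
  rewrite ge0_fin_numE; first exact: le_lt_trans rest (ltry _).
  by rewrite adde_ge0// lee_fin.
rewrite -leeBrDr//; apply: ge_ereal_sup => _ [_ [l ul <-] <-].
rewrite leeBrDr// (variation_pieces f ul) addeCA.
have [pl /eqP ll] := ul.
have -> : ((increments f (pieces u.1 l))%:E + (increments f L2)%:E =
  (increments f (pieces u.1 l ++ L2))%:E)%E.
  by rewrite -EFinD /increments big_cat.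
have pw := pieces_within pl; rewrite ll in pw.
have pd := pieces_disjoint pl.
have pln := pieces_length u.1 l; rewrite ll in pln.
move: wL dL du; rewrite /itvs_within /disjoint_itvs all_cat !pairwise_cat !all_cat.
move=> /andP[w1 w2] /and3P[d12 d1 d2] /andP[du1 du2].
have far (w v : R * R) : [&& u.1 <= w.1, w.1 <= w.2 & w.2 <= u.2] ->
   (u.2 <= v.1) || (v.2 <= u.1) -> (w.2 <= v.1) || (v.2 <= w.1).
  by move=> /and3P[h1 h2 h3] /orP[] h; apply/orP; [left|right]; lra.
apply: ih.
- rewrite /itvs_within !all_cat w1 w2 andbT /=.
  by apply: sub_all pw => w /and3P[h1 h2 h3]; apply/and3P; split => //; lra.
- rewrite /disjoint_itvs in pd *; rewrite !pairwise_cat d1 d2 pd /= andbT allrel_catr d12 andbT.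
  apply/andP; split; apply/allrelP => v w vL wL.
    by rewrite orbC; apply: far; [exact: (allP pw)|exact: (allP du1)].
  by apply: far; [exact: (allP pw)|exact: (allP du2)].
- move: lL'; rewrite /total_length !big_cat /= -/(total_length (pieces u.1 l)) pln; lra.
Qed.

Section Variation.
Context (x y : R) (f : R -> R) (xy : x <= y) (acf : abs_cont_real x y f).

Lemma abs_cont_total_variation e : 0 < e -> exists2 d, 0 < d &
  forall L, itvs_within x y L -> disjoint_itvs L -> total_length L < d ->
  (\sum_(u <- L) total_variation u.1 u.2 f <= e%:E)%E.
Proof.
move=> e0; have [d d0 dP] := abs_cont_real_itvs acf e0; exists d => // L wL dL lL.
have := @sum_total_variation x y f d e dP L [::].
by rewrite cats0 /increments big_nil adde0; exact.
Qed.

(** An interval of length below [d] carries variation at most 1, and finitely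
    many such intervals cover [`[x, y]]. *)
Lemma abs_cont_bounded_variation : total_variation x y f \is a fin_num.
Proof.
have [d d0 dP] := abs_cont_total_variation ltr01.
have key (n : nat) t : x <= t -> t <= y -> t <= x + n%:R * (d / 2) -> (total_variation x t f <= n%:R%:E)%E.
  elim: n t => [|n ih] t xt ty tn.
    have -> : t = x by apply/le_anti; rewrite xt; move: tn; rewrite mul0r addr0 => ->.
    by rewrite total_variationxx.
  pose s := Num.max x (t - d / 2).
  have xs : x <= s by rewrite le_max lexx.
  have st : s <= t by rewrite ge_max xt; lra.
  rewrite (total_variationD f xs st) -natr1 EFinD; apply: leeD.
    apply: ih => //; first exact: le_trans ty.
    rewrite /s ge_max lerDl mulr_ge0//=; last by lra.
    by move: tn; rewrite -natr1; lra.
  have := dP [:: (s, t)]; rewrite /itvs_within /disjoint_itvs /total_length !big_seq1 /= xs st ty.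
  apply => //; have : t - d / 2 <= s by rewrite le_max lexx orbT.
  lra.
rewrite ge0_fin_numE ?total_variation_ge0//.
apply: le_lt_trans (ltry (Num.truncn ((y - x) / (d / 2))).+1%:R).
apply: key => //; rewrite -lerBlDl -ler_pdivrMr; last by lra.
exact/ltW/truncnS_gt.
Qed.

Lemma variation_increment s t : x <= s -> s <= t -> t <= y ->
  [/\ total_variation s t f \is a fin_num, `|f t - f s| <= fine (total_variation s t f) &
  fine (total_variation x t f) - fine (total_variation x s f) = fine (total_variation s t f)].
Proof.
move=> xs st ty; have xt := le_trans xs st.
have := abs_cont_bounded_variation.
rewrite (total_variationD f xt ty) (total_variationD f xs st) !fin_numD.
move=> /andP[/andP[h1 h2] _]; split => //; last by rewrite fineD//; lra.
by rewrite -lee_fin fineK//; exact: total_variation_ge.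
Qed.

End Variation.
End TotalVariationOfAbsolutelyContinuous.

(** * Absolutely continuous functions are primitives *)

Section AbsolutelyContinuousDensity.
Context {R : realType}.
Implicit Types (f : R -> R) (x y z c d a b : R) (L : seq (R * R)).

(** The components of an open set are intervals given only by convexity; the
    absolute continuity condition needs their end points. *)
Lemma interval_hull (I : set (measurableTypeR R)) : is_interval I -> (leb I < +oo)%E ->
  exists a b, [/\ a <= b, leb I = (b - a)%:E, `]a, b[ `<=` I & I `<=` `[a, b]].
Proof.
move=> iI Ioo; have [->|/set0P[t It]] := eqVneq I set0.
  exists 0, 0; rewrite subrr measure0 lexx; split => //.
  by move=> t /=; rewrite in_itv /= => /andP[h1 h2]; move: (lt_trans h1 h2); rewrite ltxx.
have mI : measurable I by exact: is_interval_measurable.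
have large u v : u <= v -> `[u, v[%classic `<=` I -> (v - u <= fine (leb I)).
  move=> uv uvI; rewrite -lee_fin fineK ?ge0_fin_numE//.
  rewrite (_ : (v - u)%:E = leb (`[u, v[%classic : set (measurableTypeR R))); first by apply: le_measure; rewrite ?inE.
  rewrite /= lebesgue_measure_itv /= lte_fin; move: uv; rewrite le_eqVlt => /predU1P[->|uv].
    by rewrite ltxx subrr.
  by rewrite uv EFinB.
have ubI : has_ubound I.
  exists (t + fine (leb I)) => r Ir; rewrite leNgt; apply/negP => h.
  have tr : t <= r.
    by apply: (le_trans _ (ltW h)); rewrite lerDl fine_ge0.
  have sub : `[t, r[%classic `<=` I.
    by move=> w /=; rewrite in_itv /= => /andP[tw wr]; apply: (iI t r) => //; rewrite tw ltW.
  by have := large t r tr sub; rewrite lerBlDl leNgt h.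
have lbI : has_lbound I.
  exists (t - fine (leb I)) => r Ir; rewrite leNgt; apply/negP => h.
  have rt : r <= t.
    by apply: (le_trans (ltW h)); rewrite lerBlDr lerDl fine_ge0.
  have sub : `[r, t[%classic `<=` I.
    by move=> w /=; rewrite in_itv /= => /andP[tw wr]; apply: (iI r t) => //; rewrite tw ltW.
  by have := large r t rt sub; rewrite lerBlDl -lerBlDr leNgt h.
have hi : has_inf I by split; [exists t|].
have hs : has_sup I by split; [exists t|].
have ab : inf I <= sup I by apply: (le_trans (ge_inf lbI It)); exact: ub_le_sup.
have sub1 : `]inf I, sup I[%classic `<=` I.
  move=> r /=; rewrite in_itv /= => /andP[ar rb].
  have [u Iu ur] := inf_lt hi.1 ar.
  have [v Iv rv] := sup_gt hs.1 rb.
  by apply: (iI u v) => //; rewrite !ltW.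
have sub2 : I `<=` `[inf I, sup I]%classic.
  by move=> r Ir; rewrite /= in_itv /= ge_inf//= ub_le_sup.
exists (inf I), (sup I); split => //.
apply/eqP; rewrite eq_le; apply/andP; split.
  have -> : (sup I - inf I)%:E = leb (`[inf I, sup I]%classic : set (measurableTypeR R)).
    rewrite /= lebesgue_measure_itv /= lte_fin; move: ab; rewrite le_eqVlt => /predU1P[->|ab].
      by rewrite ltxx subrr.
    by rewrite ab EFinB.
  by apply: le_measure; rewrite ?inE.
rewrite -leb_itvoo//.
by apply: le_measure; rewrite ?inE.
Qed.

Lemma stieltjes_itv (F : cumulative R R) s t : s <= t ->
  lebesgue_stieltjes_measure F `]s, t]%classic = (F t - F s)%:E.
Proof.
move=> st; rewrite /lebesgue_stieltjes_measure /measure_extension measurable_mu_extE/=; last exact: is_ocitv.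
by rewrite wlength_itv_bnd.
Qed.

Lemma overlapping_itvoo a b c d : a < b -> c < d -> c < b -> a < d ->
  exists r, (a < r < b) && (c < r < d).
Proof.
move=> ab cd cb ad; case: (leP a c) => ac; case: (leP b d) => bd.
- by exists ((c + b) / 2); apply/andP; split; apply/andP; split; lra.
- by exists ((c + d) / 2); apply/andP; split; apply/andP; split; lra.
- by exists ((a + b) / 2); apply/andP; split; apply/andP; split; lra.
- by exists ((a + d) / 2); apply/andP; split; apply/andP; split; lra.
Qed.

Section Monotone.
Context (x y : R) (G : R -> R) (xy : x <= y)
  (ndG : forall s t, x <= s -> s <= t -> t <= y -> G s <= G t)
  (acG : forall e, 0 < e -> exists2 d, 0 < d &
    forall L, itvs_within x y L -> disjoint_itvs L -> total_length L < d ->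
    \sum_(u <- L) (G u.2 - G u.1) <= e).

(* Extending [G] by constants on both sides gives a monotone function on the
   line, the distribution function of a Stieltjes measure. *)
Let clamp t := Num.max x (Num.min t y).

Let clamp_itv t : x <= clamp t <= y.
Proof. by rewrite /clamp le_max lexx /= ge_max xy ge_min lexx orbT. Qed.

Let clamp_le s t : s <= t -> clamp s <= clamp t.
Proof.
move=> st; rewrite /clamp; case: (leP s y); case: (leP t y) => *; rewrite ge_max !le_max lexx /= ?orbT //; lra.
Qed.

Let clamp_contract s t : s <= t -> clamp t - clamp s <= t - s.
Proof.
move=> st; rewrite /clamp; case: (leP s y) => ?; case: (leP t y) => ?; rewrite ?(max_r xy); rewrite /Order.max /=; repeat (case: ifP; rewrite ?ltNge => /negP); lra.
Qed.

Let clamp_id t : x <= t -> t <= y -> clamp t = t.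
Proof.  by move=> xt ty; rewrite /clamp min_l// max_r. Qed.

Let F t := G (clamp t).

Let ndF : nondecreasing F.
Proof.
move=> s t st; apply: ndG; last by have /andP[] := clamp_itv t.
  by have /andP[] := clamp_itv s.
exact: clamp_le.
Qed.

Let contF e : 0 < e -> exists2 d, 0 < d & forall s t, s <= t -> t - s < d -> F t - F s <= e.
Proof.
move=> e0; have [d d0 dP] := acG e0; exists d => // s t st sd.
have := dP [:: (clamp s, clamp t)].
rewrite /itvs_within /disjoint_itvs /total_length !big_seq1 /= clamp_le//.
have /andP[-> _] := clamp_itv s; have /andP[_ ->] := clamp_itv t.
by apply => //; apply: le_lt_trans sd; exact: clamp_contract.
Qed.

Let rcF : forall r : R, F @ r^'+ --> F r.
Proof.
move=> r; apply/cvgrPdist_le => e e0; have [d d0 dP] := contF e0.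
near=> t.
have rt : r <= t by near: t; exact: nbhs_right_ge.
rewrite distrC ger0_norm ?subr_ge0; last exact: ndF.
apply: dP => //; rewrite ltrBlDr addrC.
by near: t; apply: nbhs_right_lt; rewrite ltrDl.
Unshelve. all: by end_near. Qed.

Let Fc : cumulative R R := HB.pack F (isCumulative.Build R _ R F ndF rcF).

Let LS : {measure set (measurableTypeR R) -> \bar R} := lebesgue_stieltjes_measure Fc.

Let LS_itv s t : s <= t -> LS `]s, t]%classic = (F t - F s)%:E.
Proof. exact: stieltjes_itv. Qed.

Let LS_itvcc s t : s <= t -> (LS `[s, t]%classic <= (F t - F s)%:E)%E.
Proof.
move=> st; apply/lee_addgt0Pr => e e0; have [d d0 dP] := contF e0.
have d2 : 0 < d / 2 by rewrite divr_gt0.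
apply: (@le_trans _ _ (LS `]s - d / 2, t]%classic)).
  apply: le_measure; rewrite ?inE; [exact: measurable_itv|exact: measurable_itv|].
  by move=> r /=; rewrite !in_itv /= => /andP[sr ->]; rewrite andbT; lra.
rewrite LS_itv; last by lra.
rewrite -EFinD lee_fin; have := dP (s - d / 2) s; lra.
Qed.

(* An open set is a countable union of disjoint intervals, and the absolute
   continuity of [G] bounds the Stieltjes measure of finitely many of them at
   a time. *)
Let LS_open e : 0 < e -> exists2 d, 0 < d & forall U : set R, open U ->
  (leb U < d%:E)%E -> (LS U <= e%:E)%E.
Proof.
move=> e0; have [d d0 dP] := acG e0; exists d => // U oU Ud.
pose J := open_disjoint_itv oU.
have mI n : measurable (J n : set (measurableTypeR R)).
  by apply: open_measurable; exact: open_disjoint_itv_open.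
have mU : measurable (U : set (measurableTypeR R)) by exact: open_measurable.
have IU n : J n `<=` U by rewrite (open_disjoint_itv_bigcup oU); exact: bigcup_sup.
have leI (m : {measure set (measurableTypeR R) -> \bar R}) n : (m (J n) <= m U)%E.
  by apply: le_measure; rewrite ?inE.
have hull n : exists ab : R * R, [/\ ab.1 <= ab.2, leb (J n) = (ab.2 - ab.1)%:E,
    `]ab.1, ab.2[ `<=` J n & J n `<=` `[ab.1, ab.2]].
  have [] := @interval_hull (J n).
  - exact: open_disjoint_itv_is_interval.
  - apply: le_lt_trans (leI _ n) _; exact: (lt_trans Ud (ltry _)).
  - by move=> a [b h]; exists (a, b).
pose ab n := projT1 (cid (hull n)).
have abP n : [/\ (ab n).1 <= (ab n).2, leb (J n) = ((ab n).2 - (ab n).1)%:E,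
    `](ab n).1, (ab n).2[ `<=` J n & J n `<=` `[(ab n).1, (ab n).2]].
  exact: (projT2 (cid (hull n))).
have trI := open_disjoint_itv_trivIset (oU := oU).
have cvJ : (fun n => (\sum_(0 <= i < n) LS (J i))%E) @ \oo --> LS U.
  rewrite [in X in _ --> X](open_disjoint_itv_bigcup oU).
  apply: measure_semi_sigma_additive => //.
  by rewrite -(open_disjoint_itv_bigcup oU).
apply: (cvge_le _ cvJ).
near=> n.
have bound (m : {measure set (measurableTypeR R) -> \bar R}) : (\sum_(0 <= i < n) m (J i) <= m U)%E.
  rewrite big_mkord -measure_bigsetU//; apply: le_measure; rewrite ?inE//.
    by apply: bigsetU_measurable.
  by rewrite [X in _ `<=` X](open_disjoint_itv_bigcup oU); exact: bigsetU_bigcup.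
apply: (@le_trans _ _ (\sum_(0 <= i < n) (F (ab i).2 - F (ab i).1)%:E)%E).
  apply: lee_sum => i _; have [h1 _ _ h4] := abP i.
  apply: le_trans (LS_itvcc h1).
  by apply: le_measure; rewrite ?inE//; exact: measurable_itv.
rewrite sumEFin lee_fin.
pose L := [seq (clamp (ab i).1, clamp (ab i).2) | i <- iota 0 n & (ab i).1 < (ab i).2].
have -> : \sum_(0 <= i < n) (F (ab i).2 - F (ab i).1) = \sum_(u <- L) (G u.2 - G u.1).
  rewrite /L big_map big_filter [RHS]big_mkcond /= /index_iota subn0.
  apply: eq_bigr => i _; case: ifPn => //; rewrite -leNgt => h.
  have [h1 _ _ _] := abP i.
  have -> : (ab i).1 = (ab i).2 by apply/le_anti; rewrite h1.
  by rewrite subrr.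
apply: dP.
- rewrite /itvs_within all_map; apply/allP => i _ /=; have [h1 _ _ _] := abP i.
  have /andP[-> _] := clamp_itv (ab i).1; have /andP[_ ->] := clamp_itv (ab i).2.
  by rewrite clamp_le.
- rewrite /disjoint_itvs /L pairwise_map.
  apply: (@sub_in_pairwise _ (fun i => (ab i).1 < (ab i).2) ltn); last 2 first.
  + exact: filter_all.
  + apply: pairwise_filter; rewrite -sorted_pairwise; [exact: iota_ltn_sorted|exact: ltn_trans].
  move=> i j; rewrite -!topredE /= => hi hj ij.
  have [_ _ ai _] := abP i; have [_ _ aj _] := abP j.
  suff : ((ab i).2 <= (ab j).1) || ((ab j).2 <= (ab i).1).
    by move=> /orP[] h; apply/orP; [left|right]; exact: clamp_le.
  rewrite -implyNb; apply/implyP; rewrite -ltNge => h1; rewrite leNgt; apply/negP => h2.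
  have [r rij] := overlapping_itvoo hi hj h1 h2.
  have Jr : (J i `&` J j) r.
    by have /andP[/andP[r1 r2] /andP[r3 r4]] := rij; split; [apply: ai|apply: aj];
      rewrite /= in_itv /=; apply/andP.
  have eij := trI i j I I (ex_intro _ r Jr).
  by move: ij; rewrite eij /= ltnn.
- have := le_lt_trans (bound leb) Ud.
  rewrite (eq_bigr (fun i => ((ab i).2 - (ab i).1)%:E)) => [|i _]; last by have [] := abP i.
  rewrite sumEFin lte_fin; apply: le_lt_trans.
  rewrite /total_length /L big_map big_filter [X in X <= _]big_mkcond /= /index_iota subn0.
  apply: ler_sum => i _; have [h1 _ _ _] := abP i.
  case: ifPn => _; last by rewrite subr_ge0.
  exact: clamp_contract.
Unshelve. all: by end_near. Qed.

Let LS_finite : (LS `]x, y]%classic < +oo)%E.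
Proof. by rewrite LS_itv// ltry. Qed.

Let mxy : measurable (`]x, y]%classic : set (measurableTypeR R)).
Proof. exact: measurable_itv. Qed.

Let nu := mfrestr mxy LS_finite.

(* By outer regularity a Lebesgue null set is contained in open sets of small
   Lebesgue measure, which have small Stieltjes measure. *)
Let nu_dominated : nu `<< (leb : {measure set (measurableTypeR R) -> \bar R}).
Proof.
apply/null_content_dominatesP => N mN N0.
suff N0' : (LS N = 0)%E.
  apply/eqP; rewrite eq_le measure_ge0 andbT -N0'.
  rewrite /= /mfrestr /mrestr; apply: le_measure; rewrite ?inE//; exact: measurableI.
apply/eqP; rewrite eq_le measure_ge0 andbT; apply/lee_addgt0Pr => e e0; rewrite add0e.
have [d d0 dP] := LS_open e0.
have [U [oU NU UN]] : exists U : set R, [/\ open U, N `<=` U & (leb (U `\` N) < d%:E)%E].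
  by apply: lebesgue_regularity_outer => //; rewrite N0 ltry.
have mU : measurable (U : set (measurableTypeR R)) by exact: open_measurable.
have Ud : (leb U < d%:E)%E.
  rewrite -(setDUK NU) measureU//.
  - by rewrite N0 add0e.
  - exact: measurableD.
  - by rewrite setDE setICA setICr setI0.
apply: (le_trans _ (dP U oU Ud)).
by apply: le_measure; rewrite ?inE.
Qed.

(** The Stieltjes measure of a monotone absolutely continuous function is
    absolutely continuous with respect to Lebesgue measure; its
    Radon-Nikodym density is the density sought. *)
Lemma monotone_abs_cont_density : exists phi : R -> R,
  leb.-integrable [set: measurableTypeR R] (EFin \o phi) /\
  forall u v, x <= u -> u <= v -> v <= y -> G v - G u = \int[leb]_(t in `[u, v[) phi t.
Proof.
have [g [g0 gfin gi gE]] := radon_nikodym_sigma_finite nu_dominated.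
have gE' : EFin \o (fine \o g) = g by apply/funext => t /=; rewrite fineK.
exists (fine \o g); rewrite gE'; split => // u v xu uv vy.
have iS (A : set (measurableTypeR R)) : measurable A -> leb.-integrable A (EFin \o (fine \o g)).
  by move=> mA; rewrite gE'; exact: (integrableS measurableT).
have := gE (`]u, v]%classic) (measurable_itv _).
rewrite /= /mfrestr /mrestr setIidl; last first.
  by move=> t /=; rewrite !in_itv /= => /andP[h1 h2]; rewrite (le_lt_trans xu h1) (le_trans h2 vy).
move=> h; have : (F v - F u)%:E = (\int[leb]_(t in `]u, v]) g t)%E by rewrite -h -LS_itv.
rewrite /F !clamp_id//; [|exact: le_trans vy|exact: le_trans uv].
move=> /(congr1 fine) /= ->.
rewrite Rintegral_itv_bndo_bndc; last exact: iS.
rewrite -Rintegral_itv_obnd_cbnd; last exact: iS.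
by rewrite /Rintegral; congr fine; apply: eq_integral => t _; rewrite /= fineK.
Qed.

End Monotone.

(** Jordan decomposition: [f] is the difference of its variation function and
    of a second monotone function, and both inherit absolute continuity. *)
Lemma abs_cont_primitive x y f : x <= y -> abs_cont_real x y f ->
  exists F phi, primitive F phi /\ forall t, x <= t -> t <= y -> F t = f t.
Proof.
move=> xy acf.
pose V t := fine (total_variation x t f).
have VE s t : x <= s -> s <= t -> t <= y -> [/\ total_variation s t f \is a fin_num,
    `|f t - f s| <= fine (total_variation s t f) & V t - V s = fine (total_variation s t f)].
  exact: variation_increment.
(* The factor 2 covers [W], whose increments are at most twice the variation. *)
have acG (G : R -> R) : (forall s t, x <= s -> s <= t -> t <= y ->
    G t - G s <= 2 * fine (total_variation s t f)) ->
  forall e, 0 < e -> exists2 d, 0 < d & forall L, itvs_within x y L -> disjoint_itvs L ->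
    total_length L < d -> \sum_(u <- L) (G u.2 - G u.1) <= e.
  move=> GV e e0; have e20 : 0 < e / 2 by rewrite divr_gt0.
  have [d d0 dP] := abs_cont_total_variation acf e20.
  exists d => // L wL dL lL; have := dP L wL dL lL.
  rewrite (_ : (\sum_(u <- L) total_variation u.1 u.2 f)%E =
     (\sum_(u <- L) fine (total_variation u.1 u.2 f))%:E); last first.
    rewrite -sumEFin; rewrite big_seq [RHS]big_seq; apply: eq_bigr => u uL.
    have /allP/(_ u uL)/and3P[h1 h2 h3] := wL.
    by have [h _ _] := VE _ _ h1 h2 h3; rewrite fineK.
  rewrite lee_fin => h; apply: (@le_trans _ _ (2 * \sum_(u <- L) fine (total_variation u.1 u.2 f))); last by lra.
  rewrite mulr_sumr big_seq [leRHS]big_seq; apply: ler_sum => u uL.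
  by have /allP/(_ u uL)/and3P[h1 h2 h3] := wL; exact: GV.
pose W t := V t - f t.
have nV s t : x <= s -> s <= t -> t <= y -> V s <= V t.
  by move=> xs st ty; have [_ h1 h2] := VE s t xs st ty; have := normr_ge0 (f t - f s); lra.
have nW s t : x <= s -> s <= t -> t <= y -> W s <= W t.
  move=> xs st ty; have [_ h1 h2] := VE s t xs st ty; rewrite /W.
  by have := ler_norm (f t - f s); lra.
have aV s t : x <= s -> s <= t -> t <= y -> V t - V s <= 2 * fine (total_variation s t f).
  by move=> xs st ty; have [_ h1 ->] := VE s t xs st ty; have := normr_ge0 (f t - f s); lra.
have aW s t : x <= s -> s <= t -> t <= y -> W t - W s <= 2 * fine (total_variation s t f).
  move=> xs st ty; have [_ h1 h2] := VE s t xs st ty; rewrite /W.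
  by have := ler_norm (- (f t - f s)); rewrite normrN; lra.
have [phi1 [i1 E1]] := monotone_abs_cont_density xy nV (acG V aV).
have [phi2 [i2 E2]] := monotone_abs_cont_density xy nW (acG W aW).
have l1 : locint leb phi1 by move=> u v; exact: (integrableS measurableT).
have l2 : locint leb phi2 by move=> u v; exact: (integrableS measurableT).
have l12 := locintB l1 l2.
exists (fun t => f x + oint_from leb x (fun r => phi1 r - phi2 r) t), (fun r => phi1 r - phi2 r).
split.
  have [q1 q2] := primitive_oint_from x l12; split => // u v uv; rewrite -q2//; lra.
move=> t xt ty; rewrite oint_from_itv// RintegralB//.
by rewrite -E1// -E2// /W; lra.
Qed.
End AbsolutelyContinuousDensity.

(** * Square integrable functions and Sobolev functions *)

Section SquareIntegrable.
Context {R : realType}.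
Implicit Types (mu : {measure set (measurableTypeR R) -> \bar R}).
Implicit Types (f g phi psi : R -> R) (x y z a b c d : R).

Definition L2on mu (D : set (measurableTypeR R)) f := measurable_fun D f /\
  (\int[mu]_(x in D) ((f x) ^+ 2)%:E < +oo)%E.

Definition L2loc mu f := forall x y, L2on mu `[x, y[ f.

Lemma L2on_sqr_integrable mu (D : set (measurableTypeR R)) f : measurable D -> L2on mu D f ->
  mu.-integrable D (fun x => ((f x) ^+ 2)%:E).
Proof.
move=> mD [mf foo]; apply/integrableP; split.
  by apply/measurable_EFinP; exact: measurable_funX.
by under eq_integral do rewrite gee0_abs ?lee_fin ?sqr_ge0//.
Qed.

Lemma L2onP mu (D : set (measurableTypeR R)) f : measurable D -> measurable_fun D f ->
  mu.-integrable D (fun x => ((f x) ^+ 2)%:E) -> L2on mu D f.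
Proof.
move=> mD mf /integrableP[_ foo]; split => //; move: foo.
by under eq_integral do rewrite gee0_abs ?lee_fin ?sqr_ge0//.
Qed.

Lemma L2on_integrableM mu (D : set (measurableTypeR R)) f g : measurable D ->
  L2on mu D f -> L2on mu D g -> mu.-integrable D (fun x => (f x * g x)%:E).
Proof.
move=> mD fL gL; have [mf _] := fL; have [mg _] := gL.
have := integrableD mD (L2on_sqr_integrable mD fL) (L2on_sqr_integrable mD gL).
apply: le_integrable => //.
  by apply/measurable_EFinP; exact: measurable_funM.
move=> x _; rewrite -EFinD !abse_EFin lee_fin.
rewrite [leRHS]ger0_norm ?addr_ge0 ?sqr_ge0//.
have h1 := sqr_ge0 (f x + g x); have h2 := sqr_ge0 (f x - g x).
have h3 := sqr_ge0 (f x); have h4 := sqr_ge0 (g x).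
by rewrite ler_norml; apply/andP; split; nra.
Qed.

Lemma L2on_integrable mu (D : set (measurableTypeR R)) f : measurable D -> (mu D < +oo)%E ->
  L2on mu D f -> mu.-integrable D (EFin \o f).
Proof.
move=> mD Dfin fL.
have oneL : L2on mu D (cst 1).
  split; first exact: measurable_cst.
  by rewrite /= expr1n integral_cst// mul1e.
have := L2on_integrableM mD fL oneL.
by apply: eq_integrable => // x _; rewrite /= mulr1.
Qed.

Lemma L2onS mu (D E : set (measurableTypeR R)) f : measurable D -> measurable E -> E `<=` D ->
  L2on mu D f -> L2on mu E f.
Proof.
move=> mD mE ED fL; apply: L2onP => //; first by have [mf _] := fL; exact: measurable_funS mf.
exact: integrableS (L2on_sqr_integrable mD fL).
Qed.

Lemma L2onD mu (D : set (measurableTypeR R)) f g : measurable D -> L2on mu D f -> L2on mu D g ->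
  L2on mu D (fun x => f x + g x).
Proof.
move=> mD fL gL; have [mf _] := fL; have [mg _] := gL.
apply: L2onP => //; first exact: measurable_funD.
have := integrableD mD (L2on_sqr_integrable mD fL) (integrableD mD
  (integrableZl mD 2 (L2on_integrableM mD fL gL)) (L2on_sqr_integrable mD gL)).
apply: eq_integrable => // x _ /=.
by rewrite -EFinM -!EFinD; congr EFin; ring.
Qed.

Lemma L2onZ mu (D : set (measurableTypeR R)) f k : measurable D -> L2on mu D f ->
  L2on mu D (fun x => k * f x).
Proof.
move=> mD fL; have [mf _] := fL.
apply: L2onP => //; first exact: measurable_funM.
have := integrableZl mD (k ^+ 2) (L2on_sqr_integrable mD fL).
by apply: eq_integrable => // x _ /=; rewrite -EFinM exprMn.
Qed.

Lemma L2onB mu (D : set (measurableTypeR R)) f g : measurable D -> L2on mu D f -> L2on mu D g ->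
  L2on mu D (fun x => f x - g x).
Proof.
move=> mD fL gL; have := L2onD mD fL (L2onZ (-1) mD gL).
by rewrite (_ : (fun x => _) = (fun x => f x - g x))//; apply/funext => x; rewrite mulN1r.
Qed.

Lemma L2on_ext mu (D : set (measurableTypeR R)) f g : L2on mu D f -> (forall x, D x -> f x = g x) ->
  L2on mu D g.
Proof.
move=> [mf foo] fg; split.
  by apply: eq_measurable_fun mf => x; rewrite inE; exact: fg.
suff -> : (\int[mu]_(x in D) ((g x) ^+ 2)%:E = \int[mu]_(x in D) ((f x) ^+ 2)%:E)%E by [].
by apply: eq_integral => x; rewrite inE => /fg ->.
Qed.

Lemma L2on_ae mu (D : set (measurableTypeR R)) f g : measurable D -> L2on mu D f -> measurable_fun D g ->
  {ae mu, forall x, D x -> f x = g x} -> L2on mu D g.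
Proof.
move=> mD [mu_ uoo] mv uv; split => //.
suff -> : (\int[mu]_(t in D) ((g t) ^+ 2)%:E = \int[mu]_(t in D) ((f t) ^+ 2)%:E)%E by [].
apply: ae_eq_integral => //.
- by apply/measurable_EFinP; exact: measurable_funX.
- by apply/measurable_EFinP; exact: measurable_funX.
- by apply: ae_impl uv => t h Dt; rewrite (h Dt).
Qed.

Lemma L2loc_bounded mu f : locfin mu -> measurable_fun [set: measurableTypeR R] f -> locbounded f ->
  L2loc mu f.
Proof.
move=> lm mf bf x y; apply: L2onP => //; first exact: measurable_funS mf.
have h : locint mu (fun t => f t * f t) by apply: locintM => //; exact: locint_bounded.
by apply: eq_integrable (h x y).
Qed.

Lemma L2loc_locint mu f : locfin mu -> L2loc mu f -> locint mu f.
Proof. by move=> lm fL x y; apply: L2on_integrable => //; exact: lm. Qed.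

Lemma L2loc_restrict mu f a b : L2on mu `[a, b[ f -> L2loc mu (f \_ `[a, b[).
Proof.
move=> fL x y.
have mab : measurable (`[a, b[%classic : set (measurableTypeR R)) by exact: measurable_itv.
suff: L2on mu [set: measurableTypeR R] (f \_ `[a, b[) by apply: L2onS.
have [mf _] := fL; apply: L2onP => //.
  exact: ((measurable_restrictT _ mab).1 mf).
have := (integrable_mkcond _ mab).1 (L2on_sqr_integrable mab fL).
apply: eq_integrable => // t _; rewrite !patchE; case: ifP => // _.
by rewrite /point /= expr0n.
Qed.

End SquareIntegrable.

Section SobolevFunctions.
Context {R : realType}.
Implicit Types (f g phi psi : R -> R) (x y z a b c d : R).

(** The fundamental theorem of calculus for absolutely continuous functions,
    with the totalised derivative as density: [f] agrees with a primitive on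
    the interval, and both have the same derivative inside. *)
Lemma abs_cont_int_derive1 x y f : x <= y -> abs_cont_real x y f ->
  leb.-integrable `[x, y[ (EFin \o derive1 f : measurableTypeR R -> \bar R) ->
  f y - f x = \int[leb]_(t in `[x, y[) derive1 f t.
Proof.
move=> xy acf fi; have [F [phi [Fp Ff]]] := abs_cont_primitive xy acf.
rewrite -!Ff// (Fp.2 _ _ xy); congr fine; apply: ae_eq_integral => //.
- by have /integrableP[] := Fp.1 x y.
- by have /integrableP[] := fi.
have nx : {ae (leb : {measure set (measurableTypeR R) -> \bar R}), forall t : R, t <> x}.
  exists [set x]; split; [exact: measurable_set1|exact: lebesgue_measure_set1|].
  by move=> t /= /contrapT.
apply: ae_impl (ae_and nx (primitive_derive Fp)) => t /= [tx [_ <-]].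
rewrite in_itv /= => /andP[xt ty]; congr EFin.
have xt' : x < t by rewrite lt_neqAle xt andbT; apply/eqP => e; apply: tx.
rewrite !derive1E; apply: (@near_eq_derive R R R); near=> r; apply: Ff; apply: ltW.
  by near: r; exact: lt_nbhsr.
by near: r; exact: lt_nbhsl.
Unshelve. all: by end_near. Qed.

Lemma loc_abs_cont_primitive f : (forall x y, x <= y -> abs_cont_real x y f) ->
  locint leb (derive1 f) -> primitive f (derive1 f).
Proof. by move=> acf fi; split => // x y xy; apply: abs_cont_int_derive1 => //; exact: acf. Qed.

(** A function on [`[a, b[] with integrable derivative extends to the line:
    integrate its derivative extended by zero. *)
Lemma abs_cont_extension a b f : a < b -> (forall y, a <= y -> y < b -> abs_cont_real a y f) ->
  leb.-integrable `[a, b[ (EFin \o derive1 f : measurableTypeR R -> \bar R) ->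
  exists F, primitive F (derive1 f \_ `[a, b[) /\ forall t, a <= t -> t < b -> F t = f t.
Proof.
move=> ab acf fi; set phi := _ \_ _.
have mab : measurable (`[a, b[%classic : set (measurableTypeR R)) by exact: measurable_itv.
have phii : locint leb phi.
  move=> x y; apply: (@integrableS _ _ _ _ setT) => //.
  by rewrite -restrict_EFin; exact: ((integrable_mkcond _ mab).1 fi).
exists (fun t => f a + oint_from leb a phi t); split.
  have [q1 q2] := primitive_oint_from a phii; split => // u v uv; rewrite -q2//; lra.
move=> t at_ tb; rewrite oint_from_itv//.
have -> : \int[leb]_(r in `[a, t[) phi r = \int[leb]_(r in `[a, t[) derive1 f r.
  apply: eq_Rintegral => r; rewrite inE /= in_itv /= => /andP[ar rt].
  by rewrite /phi patchE mem_set//= in_itv /= ar (lt_trans rt tb).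
rewrite -abs_cont_int_derive1//; [lra|exact: acf|].
by apply: integrableS fi => //; apply: itvcoS => //; exact: ltW.
Qed.

End SobolevFunctions.

(** * Complex-valued functions by real and imaginary parts *)

(** These parts are real-valued, whereas ['Re] and ['Im] stay in the complex
    field. *)
Notation rep f := (fun x => complex.Re (f x)).
Notation imp f := (fun x => complex.Im (f x)).

Section ComplexFunctions.
Context {R : realType}.
Implicit Types (mu : {measure set (measurableTypeR R) -> \bar R}).
Implicit Types (f g : R -> R[i]) (u v phi psi : R -> R) (x y a b : R).

Lemma normc_sqr (z : R[i]) : Normc.normc z ^+ 2 = complex.Re z ^+ 2 + complex.Im z ^+ 2.
Proof. by case: z => a b /=; rewrite sqr_sqrtr// addr_ge0 ?sqr_ge0. Qed.

Lemma normc_ge (z : R[i]) : `|complex.Re z| <= Normc.normc z /\ `|complex.Im z| <= Normc.normc z.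
Proof.
have h := normc_sqr z; have n0 : 0 <= Normc.normc z by case: z {h} => a b /=; exact: sqrtr_ge0.
split; rewrite -(ler_pXn2r (n := 2)) ?nnegrE// h real_normK ?num_real//;
  by rewrite ?lerDl ?lerDr sqr_ge0.
Qed.

Lemma normc_le (z : R[i]) : Normc.normc z <= `|complex.Re z| + `|complex.Im z|.
Proof.
have h := normc_sqr z; have n0 : 0 <= Normc.normc z by case: z {h} => a b /=; exact: sqrtr_ge0.
rewrite -(ler_pXn2r (n := 2)) ?nnegrE ?addr_ge0// h sqrrD !real_normK ?num_real//.
by rewrite addrAC lerDl mulrn_wge0// mulr_ge0.
Qed.

(** The norm of a complex number and the sum of the absolute values of its
    parts bound each other up to a constant. *)
Lemma abs_contP x y f : abs_cont x y f <-> abs_cont_real x y (rep f) /\ abs_cont_real x y (imp f).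
Proof.
split=> [acf|[acr aci] e e0].
  have key (P : R[i] -> R) : (forall z w, P z - P w = P (z - w)) ->
      (forall z, `|P z| <= Normc.normc z) -> abs_cont_real x y (P \o f).
    move=> PB Pn e e0; have [d d0 dP] := acf e e0; exists d => // n s t st tr sd.
    apply: le_lt_trans (dP n s t st tr sd); apply: ler_sum => i _.
    by rewrite /= PB; exact: Pn.
  split; apply: key => [[? ?] [? ?]|z] //=; by have [] := normc_ge z.
have e20 : 0 < e / 2 by rewrite divr_gt0.
have [d1 d10 dP1] := acr _ e20; have [d2 d20 dP2] := aci _ e20.
exists (Num.min d1 d2); first by rewrite lt_min d10.
move=> n s t st tr; rewrite lt_min => /andP[sd1 sd2].
have h1 := dP1 n s t st tr sd1; have h2 := dP2 n s t st tr sd2.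
apply: le_lt_trans (_ : _ <= \sum_i (`|complex.Re (f (t i)) - complex.Re (f (s i))| +
   `|complex.Im (f (t i)) - complex.Im (f (s i))|)) _; last by rewrite big_split /=; lra.
apply: ler_sum => i _; apply: (le_trans (normc_le _)).
by case: (f (t i)) => ? ?; case: (f (s i)) => ? ?.
Qed.

Lemma L2P mu (D : set (measurableTypeR R)) f : measurable D ->
  L2 mu D f <-> L2on mu D (rep f) /\ L2on mu D (imp f).
Proof.
move=> mD.
have E : measurable_fun D (rep f) -> measurable_fun D (imp f) ->
  (\int[mu]_(x in D) ((Normc.normc (f x)) ^+ 2)%:E =
   \int[mu]_(x in D) ((complex.Re (f x)) ^+ 2)%:E + \int[mu]_(x in D) ((complex.Im (f x)) ^+ 2)%:E)%E.
  move=> mr mi; rewrite -ge0_integralD//.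
  - by apply: eq_integral => x _; rewrite normc_sqr.
  - by move=> x _; rewrite lee_fin sqr_ge0.
  - by apply/measurable_EFinP; exact: measurable_funX.
  - by move=> x _; rewrite lee_fin sqr_ge0.
  - by apply/measurable_EFinP; exact: measurable_funX.
have p0 (h : R -> R) : (0 <= \int[mu]_(x in D) ((h x) ^+ 2)%:E)%E.
  by apply: integral_ge0 => x _; rewrite lee_fin sqr_ge0.
split=> [[mr mi]|[[mr fr] [mi fi]]].
  rewrite E// => foo; split; split => //; apply: le_lt_trans foo.
    by rewrite leeDl.
  by rewrite leeDr.
by split => //; rewrite E// lte_add_pinfty.
Qed.

Lemma rep_cderiv f : rep (cderiv f) = derive1 (rep f).
Proof. by apply/funext => x; rewrite /cderiv. Qed.

Lemma imp_cderiv f : imp (cderiv f) = derive1 (imp f).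
Proof. by apply/funext => x; rewrite /cderiv. Qed.

Lemma L2_cderivP mu (D : set (measurableTypeR R)) f : measurable D ->
  L2 mu D (cderiv f) <-> L2on mu D (derive1 (rep f)) /\ L2on mu D (derive1 (imp f)).
Proof. by move=> mD; rewrite -rep_cderiv -imp_cderiv; exact: L2P. Qed.

(** The real counterpart of the space H1loc; as for [primitive], the density is
    a parameter. *)
Definition sobolev u phi := primitive u phi /\ L2loc leb phi.

Lemma L2loc_ae mu u v : L2loc mu u -> measurable_fun [set: measurableTypeR R] v ->
  {ae mu, forall x, u x = v x} -> L2loc mu v.
Proof.
move=> uL mv uv x y; apply: L2on_ae (uL x y) _ _; first exact: measurable_itv.
  exact: measurable_funS mv.
by apply: ae_impl uv => t ->.
Qed.

(** Any density may be replaced by the derivative, which is Borel and agrees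
    with it almost everywhere. *)
Lemma sobolev_derive1 u phi : sobolev u phi -> sobolev u (derive1 u) /\
  {ae (leb : {measure set (measurableTypeR R) -> \bar R}), forall x, phi x = derive1 u x}.
Proof.
move=> [up phiL].
have e : {ae (leb : {measure set (measurableTypeR R) -> \bar R}), forall x, phi x = derive1 u x}.
  by apply: ae_impl (primitive_derive up) => t [].
have dL : L2loc leb (derive1 u).
  apply: L2loc_ae e => //.
  by apply: derive1_measurable; exact: primitive_continuous up.
split => //; split => //; apply: primitive_ae e => //.
by apply: L2loc_locint => //; exact: locfin_leb.
Qed.

Lemma sobolevB u v phi psi : sobolev u phi -> sobolev v psi ->
  sobolev (fun x => u x - v x) (fun x => phi x - psi x).
Proof. by move=> [? ?] [? ?]; split; [exact: primitiveB|move=> ? ?; exact: L2onB]. Qed.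

Lemma H1locP f : H1loc f <->
  sobolev (rep f) (derive1 (rep f)) /\ sobolev (imp f) (derive1 (imp f)).
Proof.
split=> [[acf dL]|[[up phiL] [vp psiL]]].
  have ac x y : x <= y -> abs_cont x y f by move=> xy; exact: acf.
  have dL' x y := (L2_cderivP _ _ (measurable_itv _)).1 (dL x y).
  have l1 : L2loc leb (derive1 (rep f)) := fun x y => (dL' x y).1.
  have l2 : L2loc leb (derive1 (imp f)) := fun x y => (dL' x y).2.
  have key u : (forall x y, x <= y -> abs_cont_real x y u) -> L2loc leb (derive1 u) ->
      sobolev u (derive1 u).
    move=> acu uL; split; last exact: uL.
    by apply: loc_abs_cont_primitive acu _; exact: (L2loc_locint (@locfin_leb R) uL).
  exact: (conj (key _ (fun x y xy => ((abs_contP x y f).1 (ac x y xy)).1) l1)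
    (key _ (fun x y xy => ((abs_contP x y f).1 (ac x y xy)).2) l2)).
split.
  move=> x y xy _; apply/abs_contP.
  exact: (conj (primitive_abs_cont x y up) (primitive_abs_cont x y vp)).
by move=> x y; apply/L2_cderivP => //; exact: (conj (phiL x y) (psiL x y)).
Qed.

Lemma sobolev_H1loc u v phi psi : sobolev u phi -> sobolev v psi ->
  H1loc (fun x => (u x +i* v x)%C).
Proof.
move=> /sobolev_derive1[su _] /sobolev_derive1[sv _].
exact: ((H1locP (fun x => (u x +i* v x)%C)).2 (conj su sv)).
Qed.

Lemma H1loc_H1 a b f : H1loc f -> H1 a b f.
Proof.
move=> Hf; have [[up _] [vp _]] := (H1locP f).1 Hf; have [acf dL] := Hf; split.
- by move=> x y xy _; exact: acf.
- apply/L2P => //; split; apply: L2loc_bounded.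
  + exact: locfin_leb.
  + exact: primitive_measurable up.
  + exact: primitive_locbounded up.
  + exact: locfin_leb.
  + exact: primitive_measurable vp.
  + exact: primitive_locbounded vp.
- exact: dL.
Qed.

(** Elements of H1([a, b)) are restrictions of elements of the local space, so
    all computations can be done on the line. *)
Lemma H1_extension a b f : a < b -> H1 a b f ->
  exists2 F, H1loc F & forall x, a <= x -> x < b -> F x = f x.
Proof.
move=> ab [acf _ dL].
have ac y : a <= y -> y < b -> abs_cont a y f.
  move=> ay yb; apply: acf => // t /=; rewrite !in_itv /= => /andP[-> ty]; exact: le_lt_trans yb.
have [lr li] := (L2_cderivP _ _ (measurable_itv _)).1 dL.
have i1 := L2on_integrable (measurable_itv _) (locfin_leb a b) lr.
have i2 := L2on_integrable (measurable_itv _) (locfin_leb a b) li.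
have ar y : a <= y -> y < b -> abs_cont_real a y (rep f).
  by move=> ay yb; have [] := (abs_contP a y f).1 (ac y ay yb).
have ai y : a <= y -> y < b -> abs_cont_real a y (imp f).
  by move=> ay yb; have [] := (abs_contP a y f).1 (ac y ay yb).
have [F1 [p1 E1]] := abs_cont_extension ab ar i1.
have [F2 [p2 E2]] := abs_cont_extension ab ai i2.
exists (fun x => (F1 x +i* F2 x)%C).
  exact: (sobolev_H1loc (conj p1 (L2loc_restrict lr)) (conj p2 (L2loc_restrict li))).
by move=> x ax xb; rewrite E1// E2//; case: (f x).
Qed.

End ComplexFunctions.

(** * The integrated equation, Lagrange's identity and Green's formula *)

Section StrongSolutions.
Context {R : realType} (om : loc_charge R)
  (up : {measure set (measurableTypeR R) -> \bar R}) (lup : locfin up).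
Implicit Types (f g p l lam h : R -> R) (x y a b c d : R).

Notation src := (source om up).

(** The equation integrated once, with [p] in the role of the left-continuous
    derivative of [f]. It is kept separate from [primitive f p] because
    [p] is first built from [f] before it is known to be a density of it. *)
Definition balance f p g1 g2 := forall x y, x <= y ->
  p x - p y + 4^-1 * \int[leb]_(t in `[x, y[) f t = src x y g1 g2.

Definition solution f p g1 g2 := primitive f p /\ balance f p g1 g2.

Lemma balance_pE f p g1 g2 c x : admissible up g1 g2 -> balance f p g1 g2 ->
  p x = p c + 4^-1 * oint_from leb c f x - source_from om up c x g1 g2.
Proof.
move=> ad pE; rewrite /oint_from /source_from.
case: (leP c x) => cx.
  by rewrite (int_itvco0 _ _ cx) (source_nil om ad cx) -pE//; lra.
by rewrite (int_itvco0 _ _ (ltW cx)) (source_nil om ad (ltW cx)) -(pE _ _ (ltW cx)); lra.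
Qed.

Lemma oint_from_measurable f c : locint leb f ->
  measurable_fun [set: measurableTypeR R] (oint_from leb c f).
Proof. by move=> fi; exact: primitive_measurable (primitive_oint_from c fi). Qed.

Lemma oint_from_locbounded f c : locint leb f -> locbounded (oint_from leb c f).
Proof. by move=> fi; exact: primitive_locbounded (primitive_oint_from c fi). Qed.

Lemma primitive_locint f p : primitive f p -> locint leb f.
Proof.
move=> fp; apply: locint_bounded; [exact: locfin_leb|exact: primitive_measurable fp|].
exact: primitive_locbounded fp.
Qed.

Lemma balance_regular f p g1 g2 : admissible up g1 g2 -> locint leb f -> balance f p g1 g2 ->
  measurable_fun [set: measurableTypeR R] p /\ locbounded p.
Proof.
move=> ad fi pE.
have -> : p = (fun x => p 0 + 4^-1 * oint_from leb 0 f x - source_from om up 0 x g1 g2).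
  by apply/funext => x; exact: balance_pE.
split.
  apply: measurable_funB; last exact: source_from_measurable.
  by apply: measurable_funD => //; apply: measurable_funM => //; exact: oint_from_measurable.
apply: locboundedB; last exact: source_from_locbounded.
apply: locboundedD; first exact: locbounded_cst.
by apply: locboundedM; [exact: locbounded_cst|exact: oint_from_locbounded].
Qed.

(** Lagrange's identity, tested against a locally absolutely continuous
    function: integrate by parts against the source and against Lebesgue
    measure, and eliminate the source through the equation. *)
Lemma lagrange_identity f p g1 g2 l lam a b : admissible up g1 g2 -> locint leb f ->
  balance f p g1 g2 -> primitive l lam -> a <= b ->
  src a b (fun t => l t * g1 t) (fun t => l t * g2 t) =
  p a * l a - p b * l b + \int[leb]_(t in `[a, b[) (lam t * p t) +
    4^-1 * \int[leb]_(t in `[a, b[) (l t * f t).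
Proof.
move=> ad fi pE lp ab; have [mp bp] := balance_regular ad fi pE.
have [lami lE] := lp.
rewrite (source_by_parts om lup lp ad ab) (int_by_parts a b (@locfin_leb R) fi lp).
have -> : \int[leb]_(s in `[a, b[) (lam s * src a s g1 g2) =
  \int[leb]_(s in `[a, b[) (p a * lam s - lam s * p s + 4^-1 * (lam s * \int[leb]_(t in `[a, s[) f t)).
  by apply: eq_Rintegral => s; rewrite inE /= in_itv /= => /andP[as_ sb]; rewrite -pE//; ring.
have i1 : locint leb (fun s => lam s * p s) by exact: locintMr.
have i2 : locint leb (fun s => lam s * \int[leb]_(t in `[a, s[) f t).
  by apply: locintMr => //; [exact: int_primitive_measurable|exact: int_primitive_bounded].
have i3 := locintZ (p a) lami; have i4 := locintZ 4^-1 i2.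
rewrite RintegralD//; last exact: (locintB i3 i1).
rewrite RintegralB// RintegralZl// RintegralZl//.
by rewrite -pE// -lE//; ring.
Qed.

(** Lagrange's identity with a test function that vanishes to first order at
    both ends, followed by one more integration by parts. The functions
    [u] and [f] are separate so that a weak solution [f] can be compared with
    the function [u] obtained by integrating the equation twice. *)
Lemma balance_weak u f p g1 g2 h h1 h2 c d : admissible up g1 g2 -> locint leb f ->
  balance f p g1 g2 -> primitive u p -> primitive h h1 -> primitive h1 h2 -> h c = 0 -> h d = 0 -> h1 c = 0 -> h1 d = 0 -> c <= d ->
  - (\int[leb]_(t in `[c, d[) (u t * h2 t)) + 4^-1 * \int[leb]_(t in `[c, d[) (f t * h t) =
  src c d (fun t => g1 t * h t) (fun t => g2 t * h t).
Proof.
move=> ad fi pE fp hp h1p hc hd h1c h1d cd.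
have [pi uE] := fp; have [h2i h1E] := h1p.
have mf := primitive_measurable fp; have bf := primitive_locbounded fp.
have -> : (fun t => g1 t * h t) = (fun t => h t * g1 t) by apply/funext => t; rewrite mulrC.
have -> : (fun t => g2 t * h t) = (fun t => h t * g2 t) by apply/funext => t; rewrite mulrC.
rewrite (lagrange_identity ad fi pE hp cd) hc hd !mulr0 subrr add0r.
congr (_ + 4^-1 * _); last by apply: eq_Rintegral => t _; rewrite mulrC.
rewrite (int_by_parts c d (@locfin_leb R) pi h1p) h1d mul0r sub0r; congr (- _).
have -> : \int[leb]_(s in `[c, d[) (h2 s * \int[leb]_(t in `[c, s[) p t) =
  \int[leb]_(s in `[c, d[) (u s * h2 s - u c * h2 s).
  by apply: eq_Rintegral => s; rewrite inE /= in_itv /= => /andP[cs _]; rewrite -uE//; ring.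
rewrite RintegralB//; last first.
- exact: (locintZ (u c) h2i).
- exact: (locintM h2i mf bf).
by rewrite RintegralZl// -h1E// h1c h1d subrr mulr0 subr0.
Qed.

(** The densities are explicit arguments because Green's formula produces the
    momenta [p] and [q], which agree with the derivatives only almost
    everywhere. *)
Definition pairing a b (f lamf f2 g lamg g2 : R -> R) : R :=
  4^-1 * \int[leb]_(t in `[a, b[) (f t * g t) +
  \int[leb]_(t in `[a, b[) (lamf t * lamg t) +
  \int[up]_(t in `[a, b[) (f2 t * g2 t).

(** Lagrange's identity twice, with the roles of the two solutions exchanged:
    the two signed source terms agree and cancel. *)
Lemma green_formula a b f p g1 g2 k q l1 l2 gam lam f2 k2 : a <= b ->
  admissible up g1 g2 -> admissible up l1 l2 ->
  solution f p g1 g2 -> solution k q l1 l2 ->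
  primitive g1 gam -> primitive l1 lam ->
  locint up (fun t => g1 t * l2 t) -> locint up (fun t => l1 t * g2 t) ->
  \int[up]_(t in `[a, b[) (f2 t * l2 t) = \int[up]_(t in `[a, b[) (g1 t * l2 t) ->
  \int[up]_(t in `[a, b[) (g2 t * k2 t) = \int[up]_(t in `[a, b[) (l1 t * g2 t) ->
  pairing a b f p f2 l1 lam l2 - pairing a b g1 gam g2 k q k2 =
  p b * l1 b - p a * l1 a - (q b * g1 b - q a * g1 a).
Proof.
move=> ab adg adl solf solk g1p l1p ul ug ef ek.
have E1 := lagrange_identity adg (primitive_locint solf.1) solf.2 l1p ab.
have E2 := lagrange_identity adl (primitive_locint solk.1) solk.2 g1p ab.
rewrite /pairing ef ek.
have -> : \int[leb]_(t in `[a, b[) (f t * l1 t) = \int[leb]_(t in `[a, b[) (l1 t * f t).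
  by apply: eq_Rintegral => t _; rewrite mulrC.
have -> : \int[leb]_(t in `[a, b[) (p t * lam t) = \int[leb]_(t in `[a, b[) (lam t * p t).
  by apply: eq_Rintegral => t _; rewrite mulrC.
have e0 : wint om a b (fun t => l1 t * g1 t) = wint om a b (fun t => g1 t * l1 t).
  by congr (wint om a b _); apply/funext => t; rewrite mulrC.
move: E1 E2; rewrite /source e0; lra.
Qed.

End StrongSolutions.

(** * Smooth functions and mollifiers *)

Section SmoothFunctions.
Context {R : realType}.
Implicit Types (f g h : R -> R) (x y a b c d k : R) (n m : nat).

(** Induction on the order of differentiability with the derivative taken
    first suits products and affine substitutions. *)
Fixpoint Ck m f : Prop :=
  if m is m'.+1 then (forall x, derivable f x 1) /\ Ck m' (derive1 f) else True.

Lemma Ck_smooth f : (forall m, Ck m f) -> smooth f.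
Proof.
move=> Cf n; have {Cf} := Cf n.+1; rewrite /derive1n.
elim: n f => [|n ih] f /=; first by case.
by move=> [df Cf] x; rewrite -iterS iterSr; apply: ih.
Qed.

Lemma smooth_Ck f : smooth f -> forall m, Ck m f.
Proof.
move=> sf m; elim: m f sf => //= m ih f sf; split; first by move=> x; exact: (sf 0%N x).
by apply: ih => n x; have := sf n.+1 x; rewrite /derive1n iterSr.
Qed.

Lemma CkW m f : Ck m.+1 f -> Ck m f.
Proof. by elim: m f => //= m ih f [df Cf]; split => //; exact: ih. Qed.

Lemma derive1D f g : (forall x, derivable f x 1) -> (forall x, derivable g x 1) ->
  derive1 (fun x => f x + g x) = (fun x => derive1 f x + derive1 g x).
Proof. by move=> df dg; apply/funext => x; rewrite !derive1E (deriveD (df x) (dg x)). Qed.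

Lemma derive1M f g : (forall x, derivable f x 1) -> (forall x, derivable g x 1) ->
  derive1 (fun x => f x * g x) = (fun x => derive1 f x * g x + f x * derive1 g x).
Proof.
move=> df dg; apply/funext => x; rewrite !derive1E (deriveM (df x) (dg x)).
by rewrite addrC /GRing.scale /= mulrC.
Qed.

Lemma CkD m f g : Ck m f -> Ck m g -> Ck m (fun x => f x + g x).
Proof.
elim: m f g => //= m ih f g [df Cf] [dg Cg]; split.
  by move=> x; apply: derivableD.
by rewrite derive1D//; exact: ih.
Qed.

Lemma CkM m f g : Ck m f -> Ck m g -> Ck m (fun x => f x * g x).
Proof.
elim: m f g => //= m ih f g [df Cf] [dg Cg]; split.
  by move=> x; apply: derivableM.
rewrite derive1M//; apply: CkD; first by apply: ih => //; apply: CkW.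
by apply: ih => //; apply: CkW.
Qed.

Lemma Ck_cst m k : Ck m (fun _ : R => k).
Proof.
elim: m k => //= m ih k; split; first by move=> x; exact: derivable_cst.
rewrite (_ : derive1 _ = (fun=> 0)); first exact: ih.
by apply/funext => x; rewrite derive1E derive_cst.
Qed.

Lemma is_derive1_affine f k c x : derivable f (k * x + c) 1 ->
  is_derive x 1 (fun t => f (k * t + c)) (k * derive1 f (k * x + c)).
Proof.
move=> df; rewrite derive1E.
have h1 : is_derive x (1:R) (fun t => k * t + c) k.
  by apply: is_derive_eq; rewrite addr0 /GRing.scale /= mulr1.
have h2 : is_derive (k * x + c) 1 f ('D_1 f (k * x + c)) by exact: derivableP.
by have := @is_derive1_comp _ f (fun t => k * t + c) x _ _ h2 h1; rewrite mulrC.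
Qed.

Lemma Ck_affine m f k c : Ck m f -> Ck m (fun t => f (k * t + c)).
Proof.
elim: m f => //= m ih f [df Cf]; split; first by move=> x; have [] := is_derive1_affine (df (k * x + c)).
rewrite (_ : derive1 _ = (fun t => k * derive1 f (k * t + c))).
  by apply: CkM; [exact: Ck_cst|exact: ih].
by apply/funext => x; rewrite derive1E; have [_ ->] := is_derive1_affine (df (k * x + c)).
Qed.

(** The functions [x^(-n) * exp (-1/x)] on the half-line: their linear span is
    closed under differentiation, which makes them smooth by induction. *)
Definition flat n x : R := if 0 < x then x^-1 ^+ n * expR (- x^-1) else 0.

Lemma flat_ge0 n x : 0 <= flat n x.
Proof.
rewrite /flat; case: ifPn => // x0.
by rewrite mulr_ge0 ?expR_ge0// exprn_ge0// invr_ge0 ltW.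
Qed.

(** The exponential dominates every power: take the [n]-th power of
    [y / n <= exp (y / n)]. *)
Lemma expr_le_expR n y : 0 <= y -> y ^+ n <= n%:R ^+ n * expR y.
Proof.
move=> y0; case: n => [|n].
  by rewrite !expr0 mul1r; have := @expR_ge1Dx R y; lra.
have n0 : 0 < n.+1%:R :> R by rewrite ltr0n.
have -> : expR y = expR (y / n.+1%:R) ^+ n.+1.
  by rewrite -expRM_natl; congr expR; rewrite mulrC divfK ?gt_eqF.
rewrite -exprMn; apply: lerXn2r; [by rewrite nnegrE| |].
  by rewrite nnegrE mulr_ge0 ?expR_ge0// ler0n.
rewrite -ler_pdivrMl// mulrC; apply: (le_trans _ (expR_ge1Dx _)).
by rewrite lerDr.
Qed.

(** Quadratic decay at the origin gives both differentiability there and the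
    value 0 of the derivative. *)
Lemma flat_le n x : flat n x <= n.+2%:R ^+ n.+2 * x ^+ 2.
Proof.
rewrite /flat; case: ifPn => x0; last by rewrite mulr_ge0 ?sqr_ge0.
have y0 : 0 <= x^-1 by rewrite invr_ge0 ltW.
have := expr_le_expR n.+2 y0; rewrite expRN => h.
rewrite ler_pdivrMr ?expR_gt0//.
apply: (@le_trans _ _ (x^-1 ^+ n.+2 * x ^+ 2)).
  rewrite -addn2 exprD -mulrA -exprMn [x^-1 * x]mulVf ?gt_eqF//.
  by rewrite expr1n mulr1.
by rewrite [leRHS]mulrAC; apply: ler_wpM2r; rewrite ?sqr_ge0.
Qed.

Lemma flat_derive n x : is_derive x 1 (flat n) (- n%:R * flat n.+1 x + flat n.+2 x).
Proof.
have [x0|x0|->] := ltgtP x 0.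
- rewrite /flat ltNge (ltW x0) /= mulr0 addr0.
  have e : {near x, (cst 0) =1 flat n}.
    near=> t; rewrite /flat ltNge.
    have -> // : t <= 0 by apply: ltW; near: t; exact: lt_nbhsl.
  apply: DeriveDef; first exact: (@near_eq_derivable R R R _ _ x 1 e (@derivable_cst R R R 0 x 1)).
  by rewrite -(@near_eq_derive R R R _ _ x 1 e) derive_cst.
- rewrite /flat x0.
  pose v t := t^-1 ^+ n * expR (- t^-1) : R.
  have e : {near x, v =1 flat n}.
    near=> t; rewrite /flat ifT//.
    by near: t; exact: lt_nbhsr.
  have dv : is_derive x 1 v (- n%:R * (x^-1 ^+ n.+1 * expR (- x^-1)) + x^-1 ^+ n.+2 * expR (- x^-1)).
    have xn0 : id x != 0 :> R by rewrite /= gt_eqF.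
    have hV : is_derive x (1:R) (fun t : R => t^-1) (- x ^- 2 *: (1 : R)).
      exact: (is_deriveV xn0 (is_derive_id x 1)).
    have hX := is_deriveX n hV.
    have hE : is_derive x (1:R) (expR \o (fun t : R => - t^-1)) (expR (- x^-1) * - (- x ^- 2 *: (1 : R))).
      have hN : is_derive x (1:R) (fun t : R => - t^-1) (- (- x ^- 2 *: (1 : R))) := is_deriveN hV.
      exact: (@is_derive1_comp R expR (fun t : R => - t^-1) x _ _ (is_derive_expR (- x^-1)) hN).
    have := is_deriveM hX hE.
    rewrite (_ : (fun t : R => t^-1) ^+ n * _ = v); last first.
      by apply/funext => t; rewrite /v /GRing.mul /= exprfctE.
    move=> /is_derive_eq; apply.
    rewrite exprfctE /GRing.scale /= !mulr1 -!exprVn.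
    case: (n) => [|n']; first by rewrite /= !mul0r mulr0 addr0 expr0; ring.
    by rewrite /= !exprS; ring.
  have [dv1 dv2] := dv.
  apply: DeriveDef; first exact: (@near_eq_derivable R R R _ _ x 1 e dv1).
  by rewrite -(@near_eq_derive R R R _ _ x 1 e).
- rewrite {2 3}/flat ltxx mulr0 addr0.
  have cv : h^-1 *: ((flat n \o shift 0) (h *: 1) - flat n 0) @[h --> (0:R)^'] --> (0 : R).
    apply: (@cvg_to_0_linear _ _ (n.+2%:R ^+ n.+2) 1) => // r /andP[r0 _].
    rewrite {2}/flat ltxx subr0 /= addr0 /GRing.scale /= mulr1 normrM normfV.
    rewrite ler_pdivrMl// (ger0_norm (flat_ge0 n r)); apply: (le_trans (flat_le n r)).
    by rewrite -[r ^+ 2]real_normK ?num_real// expr2 mulrCA.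
  by apply: DeriveDef; [apply/cvg_ex; exists 0|exact/cvg_lim].
Unshelve. all: by end_near. Qed.

Lemma Ck_flat m n : Ck m (flat n).
Proof.
elim: m n => //= m ih n; split; first by move=> x; have [] := flat_derive n x.
rewrite (_ : derive1 _ = (fun x => - n%:R * flat n.+1 x + flat n.+2 x)).
  by apply: CkD => //; apply: CkM => //; exact: Ck_cst.
by apply/funext => x; rewrite derive1E; have [_ ->] := flat_derive n x.
Qed.

Lemma derivable_continuous f : (forall x, derivable f x 1) -> continuous f.
Proof. by move=> df x; apply: differentiable_continuous; apply/derivable1_diffP. Qed.

(** A primitive of a continuous function is continuously differentiable
    everywhere, not only almost everywhere. *)
Lemma primitive_C1 f phi : primitive f phi -> continuous phi ->
  forall x, derivable f x 1 /\ derive1 f x = phi x.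
Proof.
move=> [pi fp] cp x.
have i1 : leb.-integrable `[x - 1, x + 1] (EFin \o phi).
  have := pi (x - 1) (x + 2); apply: integrableS => // t /=.
  by rewrite !in_itv /= => /andP[-> ?] /=; lra.
have x1 : x < x + 1 by lra.
have x2 : x - 1 < x by lra.
have [dF FE] := @continuous_FTC1_closed R phi (x - 1) x (x + 1) x1 i1 x2 (cp x).
set F := (fun y => _) in dF FE.
have nF : \forall t \near x, f t = f (x - 1) + F t.
  near=> t.
  have xt : x - 1 <= t by apply: ltW; near: t; apply: lt_nbhsr; lra.
  have tx : t < x + 1 by near: t; apply: lt_nbhsl; lra.
  rewrite -[LHS](subrK (f (x - 1))) addrC; congr (_ + _); rewrite (fp _ _ xt) /F.
  by rewrite Rintegral_itv_bndo_bndc.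
by have [d1 d2] := derive1_near_shift nF dF; split => //; rewrite d2 FE.
Unshelve. all: by end_near. Qed.

Lemma continuous_locint f : continuous f -> locint leb f.
Proof.
move=> cf x y.
have h : leb.-integrable (`[x, y]%classic : set (measurableTypeR R)) (EFin \o f).
  apply: continuous_compact_integrable; first exact: segment_compact.
  exact: continuous_subspaceT.
by apply: integrableS h => //; exact: subset_itv_co_cc.
Qed.

Lemma int_constant f k x y : x <= y -> (forall t, x <= t -> t < y -> f t = k) ->
  \int[leb]_(t in `[x, y[) f t = k * (y - x).
Proof.
move=> xy fk; rewrite (_ : \int[leb]_(t in `[x, y[) f t = \int[leb]_(t in `[x, y[) k).
  rewrite Rintegral_cst//= lebesgue_measure_itv /= lte_fin.
  by move: xy; rewrite le_eqVlt => /predU1P[->|->]; rewrite ?ltxx ?subrr ?mulr0.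
by apply: eq_Rintegral => t; rewrite inE /= in_itv /= => /andP[xt ty]; exact: fk.
Qed.

(** The function and the integral of its continuous derivative differ by a
    function of zero derivative, hence by a constant. *)
Lemma C1_primitive f : (forall x, derivable f x 1) -> continuous (derive1 f) ->
  primitive f (derive1 f).
Proof.
move=> df cf.
have fi := continuous_locint cf.
have pF := primitive_oint_from 0 fi.
have dF := primitive_C1 pF cf.
set F := oint_from leb 0 (derive1 f) in pF dF *.
have FE x y : f x - F x = f y - F y.
  apply: (@is_derive_0_is_cst R (fun t => f t - F t)) => t.
  have [d1 d2] := dF t.
  apply: DeriveDef; first exact: derivableB.
  by rewrite (deriveB (df t) d1) -!derive1E d2 subrr.
split => // x y xy; rewrite -(pF.2 _ _ xy).
by have := FE x y; lra.
Qed.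

Definition mollifier x : R := flat 0 x * flat 0 (1 - x).

Lemma Ck_mollifier m : Ck m mollifier.
Proof.
apply: CkM; first exact: Ck_flat.
rewrite (_ : (fun x => flat 0 (1 - x)) = (fun x => flat 0 (-1 * x + 1))).
  by apply: Ck_affine; exact: Ck_flat.
by apply/funext => x; rewrite mulN1r addrC.
Qed.

Lemma mollifier_ge0 x : 0 <= mollifier x.
Proof. by rewrite mulr_ge0// flat_ge0. Qed.

Lemma mollifier_out x : x <= 0 \/ 1 <= x -> mollifier x = 0.
Proof.
by rewrite /mollifier /flat => -[h|h]; rewrite [in LHS]ltNge ?h ?mul0r// subr_gt0 ltNge h mulr0.
Qed.

Lemma mollifier_half_gt0 : 0 < mollifier 2^-1.
Proof.
rewrite /mollifier /flat; have -> : 1 - 2^-1 = 2^-1 :> R by lra.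
by rewrite invr_gt0 ltr0n expr0 mul1r mulr_gt0// expR_gt0.
Qed.

Lemma mollifier_continuous : continuous mollifier.
Proof. by apply: derivable_continuous; have [] := Ck_mollifier 1. Qed.

Lemma mollifier_locint : locint leb mollifier.
Proof. exact: continuous_locint mollifier_continuous. Qed.

(** The first and second antiderivatives of the mollifier: a smooth step, and
    a smooth ramp that vanishes on the left and is affine on the right. *)
Definition step x : R := oint_from leb 0 mollifier x.

Definition ramp x : R := oint_from leb 0 step x.

Lemma step_primitive : primitive step mollifier.
Proof. exact: primitive_oint_from mollifier_locint. Qed.

Lemma ramp_primitive : primitive ramp step.
Proof. by apply: primitive_oint_from; exact: primitive_locint step_primitive. Qed.

Lemma step_derive x : derivable step x 1 /\ derive1 step x = mollifier x.
Proof. exact: primitive_C1 step_primitive mollifier_continuous x. Qed.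

Lemma ramp_derive x : derivable ramp x 1 /\ derive1 ramp x = step x.
Proof. exact: primitive_C1 ramp_primitive (primitive_continuous step_primitive) x. Qed.

Lemma Ck_step m : Ck m step.
Proof.
apply: CkW; split; first by move=> x; exact: (step_derive x).1.
have -> : derive1 step = mollifier by apply/funext => x; exact: (step_derive x).2.
exact: Ck_mollifier.
Qed.

Lemma Ck_ramp m : Ck m ramp.
Proof.
apply: CkW; split; first by move=> x; exact: (ramp_derive x).1.
have -> : derive1 ramp = step by apply/funext => x; exact: (ramp_derive x).2.
exact: Ck_step.
Qed.

Lemma int_mollifier0 x y : x <= y -> y <= 0 \/ 1 <= x -> \int[leb]_(t in `[x, y[) mollifier t = 0.
Proof.
move=> xy h; rewrite (int_constant (k := 0)) ?mul0r// => t xt ty; apply: mollifier_out.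
by case: h => h; [left; lra|right; lra].
Qed.

Lemma step_left x : x <= 0 -> step x = 0.
Proof.
move=> x0; have := step_primitive.2 x 0 x0; rewrite int_mollifier0//; last by left.
by rewrite /step oint_fromxx; lra.
Qed.

Lemma step_right x : 1 <= x -> step x = step 1.
Proof.
move=> x1; have := step_primitive.2 1 x x1; rewrite int_mollifier0//; last by right.
by lra.
Qed.

Lemma ramp_left x : x <= 0 -> ramp x = 0.
Proof.
move=> x0; have := ramp_primitive.2 x 0 x0; rewrite (int_constant (k := 0))//.
  by rewrite mul0r /ramp oint_fromxx; lra.
by move=> t _ t0; apply: step_left; exact: ltW.
Qed.

Lemma ramp_right x : 1 <= x -> ramp x = ramp 1 + step 1 * (x - 1).
Proof.
move=> x1; have := ramp_primitive.2 1 x x1; rewrite (int_constant (k := step 1))//.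
  by lra.
by move=> t t1 _; exact: step_right.
Qed.

Lemma step_nondecreasing x y : x <= y -> step x <= step y.
Proof.
move=> xy; rewrite -subr_ge0 (step_primitive.2 _ _ xy).
by apply: Rintegral_ge0 => t _; exact: mollifier_ge0.
Qed.

Lemma step1_gt0 : 0 < step 1.
Proof.
rewrite lt_neqAle -{2}(step_left (lexx 0)) step_nondecreasing// andbT.
apply/eqP => e.
have s0 t : t < 1 -> step t = 0.
  move=> t1; apply/le_anti; case: (leP t 0) => t0; first by rewrite step_left// lexx.
  have h1 := step_nondecreasing (ltW t1); have h2 := step_nondecreasing (ltW t0).
  by rewrite -e in h1; rewrite (step_left (lexx 0)) in h2; rewrite h1.
have [d1 d2] := step_derive 2^-1.
have := mollifier_half_gt0; rewrite -d2.
have e0 : {near (2^-1 : R), (cst 0) =1 step}.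
  by near=> t; rewrite s0//; near: t; apply: lt_nbhsl; lra.
by rewrite derive1E -(@near_eq_derive R R R _ _ 2^-1 1 e0) derive_cst ltxx.
Unshelve. all: by end_near. Qed.

End SmoothFunctions.

(** * The du Bois-Reymond lemma *)

Section DuBoisReymond.
Context {R : realType}.
Implicit Types (f g h u : R -> R) (x y z a b c d k e : R).

Lemma rescale_derive f x e : 0 < e -> (forall t, derivable f t 1) ->
  (forall t, derivable (fun r => f ((r - x) / e)) t 1) /\
  derive1 (fun r => f ((r - x) / e)) = (fun t => e^-1 * derive1 f ((t - x) / e)).
Proof.
move=> e0 df.
have E t : (t - x) / e = e^-1 * t + (- x / e) by rewrite mulrBl mulrC mulNr.
have -> : (fun r => f ((r - x) / e)) = (fun r => f (e^-1 * r + (- x / e))).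
  by apply/funext => r; rewrite E.
split=> [t|]; first by have [] := is_derive1_affine (df (e^-1 * t + (- x / e))).
apply/funext => t; rewrite E derive1E.
by have [_ ->] := is_derive1_affine (df (e^-1 * t + (- x / e))).
Qed.

Lemma Ck_rescale m f x e : Ck m f -> Ck m (fun r => f ((r - x) / e)).
Proof.
move=> Cf; have -> : (fun r => f ((r - x) / e)) = (fun r => f (e^-1 * r + (- x / e))).
  by apply/funext => r; rewrite mulrBl mulrC mulNr.
exact: Ck_affine.
Qed.

Lemma derive1Z k f : (forall x, derivable f x 1) ->
  derive1 (fun x => k * f x) = (fun x => k * derive1 f x).
Proof.
move=> df; rewrite (derive1M (fun x => derivable_cst k x 1) df).
by apply/funext => x; rewrite [X in X * _]derive1E derive_cst mul0r add0r.
Qed.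

Lemma derive1_combination3 f g h a b c : (forall x, derivable f x 1) ->
  (forall x, derivable g x 1) -> (forall x, derivable h x 1) ->
  derive1 (fun x => a * f x + b * g x + c * h x) =
  (fun x => a * derive1 f x + b * derive1 g x + c * derive1 h x).
Proof.
move=> df dg dh.
have Z k w : (forall x, derivable w x 1) -> forall x, derivable (fun x => k * w x) x 1.
  by move=> dw x; apply: derivableM; [exact: derivable_cst|exact: dw].
have fg x : derivable (fun x => a * f x + b * g x) x 1.
  by apply: derivableD; [exact: Z|exact: Z].
rewrite (derive1D fg (Z c _ dh)) (derive1D (Z a _ df) (Z b _ dg)).
by rewrite (derive1Z a df) (derive1Z b dg) (derive1Z c dh).
Qed.

Lemma derive1n2_combination3 f g h a b c : Ck 2 f -> Ck 2 g -> Ck 2 h ->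
  derive1n 2 (fun x => a * f x + b * g x + c * h x) =
  (fun x => a * derive1n 2 f x + b * derive1n 2 g x + c * derive1n 2 h x).
Proof.
move=> [df [d2f _]] [dg [d2g _]] [dh [d2h _]].
transitivity (derive1 (fun x => a * derive1 f x + b * derive1 g x + c * derive1 h x)).
  by congr derive1; exact: derive1_combination3.
exact: derive1_combination3.
Qed.

Lemma mollifier_rescaled_primitive e x : 0 < e ->
  primitive (fun t => e * step ((t - x) / e)) (fun t => mollifier ((t - x) / e)).
Proof.
move=> e0.
have ds t : derivable (@step R) t 1 by have [] := step_derive t.
have dsE : derive1 (@step R) = (@mollifier R) by apply/funext => t; have [] := step_derive t.
have [d1 d2] := rescale_derive x e0 ds.
have -> : (fun t => mollifier ((t - x) / e)) = derive1 (fun t => e * step ((t - x) / e)).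
  by rewrite (derive1Z e d1) d2 dsE; apply/funext => t; rewrite mulrA divff ?gt_eqF// mul1r.
apply: C1_primitive; first by move=> t; apply: derivableM => //; exact: derivable_cst.
have Ce : Ck 2 (fun t => e * step ((t - x) / e)).
  by apply: CkM; [exact: Ck_cst|exact: (Ck_rescale x e (Ck_step 2))].
apply: derivable_continuous; exact: Ce.2.1.
Qed.

(** The rescaled mollifier has integral [e * step 1] and is concentrated between
    [x] and [x + e], where [u] is close to [u x]. *)
Lemma mollified_close u x (eta : R) : continuous u -> 0 < eta -> exists2 delta, 0 < delta &
  forall e c d, 0 < e -> e < delta -> c <= x -> x + e <= d ->
  `|\int[leb]_(t in `[c, d[) (u t * mollifier ((t - x) / e)) - u x * (e * step 1)| <=
     eta * (e * step 1).
Proof.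
move=> cu eta0.
have /cvgrPdist_lt/(_ _ eta0) [dl /= dl0 dP] := cu x.
exists dl => // e c d ep ed cx xd.
have cd : c <= d by lra.
have [bi bE] := mollifier_rescaled_primitive x ep.
have I1 : \int[leb]_(t in `[c, d[) mollifier ((t - x) / e) = e * step 1.
  rewrite -bE// (step_left (x := (c - x) / e)); last first.
    by rewrite pmulr_lle0 ?invr_gt0//; lra.
  rewrite (step_right (x := (d - x) / e)); last by rewrite ler_pdivlMr//; lra.
  by rewrite mulr0 subr0.
have cm : continuous (fun t => mollifier ((t - x) / e)).
  by apply: derivable_continuous; exact: (Ck_rescale x e (Ck_mollifier 1)).1.
have i1 : locint leb (fun t => u t * mollifier ((t - x) / e)).
  by apply: continuous_locint => t; apply: cvgM; [exact: cu|exact: cm].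
have i2 := locintB i1 (locintZ (u x) bi).
have i3 := locintZ eta bi.
rewrite -I1 -RintegralZl// -RintegralB//; last exact: (locintZ (u x) bi).
rewrite -RintegralZl//; apply: (le_trans (normr_int_le _ _ i2)).
apply: le_Rintegral => //; first exact: (locint_norm i2).
move=> t _; rewrite -mulrBl normrM (ger0_norm (mollifier_ge0 _)).
have [t1|t1] := leP (t - x) 0.
  by rewrite mollifier_out ?mulr0//; left; rewrite pmulr_lle0// invr_gt0.
have [t2|t2] := leP e (t - x).
  by rewrite mollifier_out ?mulr0//; right; rewrite ler_pdivlMr// mul1r.
rewrite ler_wpM2r ?mollifier_ge0// distrC; apply/ltW/dP => /=.
by rewrite distrC ger0_norm; lra.
Qed.

Lemma ramp_rescale_derive2 x e : 0 < e ->
  derive1n 2 (fun t => ramp ((t - x) / e)) = (fun t => e^-1 ^+ 2 * mollifier ((t - x) / e)).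
Proof.
move=> e0; rewrite /derive1n /=.
have dr t : derivable (@ramp R) t 1 by have [] := ramp_derive t.
have rE : derive1 (@ramp R) = (@step R) by apply/funext => t; have [] := ramp_derive t.
have ds t : derivable (@step R) t 1 by have [] := step_derive t.
have dsE : derive1 (@step R) = (@mollifier R) by apply/funext => t; have [] := step_derive t.
have [d1 d2] := rescale_derive x e0 dr.
have [d3 d4] := rescale_derive x e0 ds.
rewrite d2 rE (derive1Z e^-1 d3) d4 dsE; apply/funext => t; lra.
Qed.

(** The du Bois-Reymond lemma for second derivatives. The test function is a
    combination of three ramps with kinks at [x], at the barycentre of [x] and
    [z], and at [z]. It has compact support, and its second derivative is a
    combination of mollifiers concentrated near the three kinks, so in the
    limit the hypothesis becomes a relation between three values of [u]. *)
Lemma weak_affine u : continuous u ->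
  (forall h c d, smooth h -> (forall t, t \notin `[c, d[ -> h t = 0) ->
     \int[leb]_(t in `[c, d[) (u t * derive1n 2 h t) = 0) ->
  forall x z k, x < z -> 0 <= k -> k <= 1 ->
    u (k * x + (1 - k) * z) = k * u x + (1 - k) * u z.
Proof.
move=> cu H x z k xz k0 k1; set y := k * x + (1 - k) * z.
have xy : x <= y by rewrite /y; nra.
have yz : y <= z by rewrite /y; nra.
apply/eqP; rewrite -subr_eq0 -normr_le0; apply/ler_addgt0Pr => eta eta0; rewrite add0r.
have eta2 : 0 < eta / 2 by lra.
have [d1 d10 P1] := mollified_close x cu eta2.
have [d2 d20 P2] := mollified_close y cu eta2.
have [d3 d30 P3] := mollified_close z cu eta2.
pose e := Num.min d1 (Num.min d2 d3) / 2.
have m0 : 0 < Num.min d1 (Num.min d2 d3) by rewrite !lt_min d10 d20 d30.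
have e0 : 0 < e by rewrite /e; lra.
have [e1 e2 e3] : [/\ e < d1, e < d2 & e < d3].
  have : e < Num.min d1 (Num.min d2 d3) by rewrite /e; lra.
  by rewrite !lt_min => /and3P[].
have {e1}P1 := P1 e x (z + e) e0 e1 (lexx _) ltac:(lra).
have {e2}P2 := P2 e x (z + e) e0 e2 xy ltac:(lra).
have {e3}P3 := P3 e x (z + e) e0 e3 (ltW xz) (lexx _).
(* The coefficients make the three ramps cancel to the right of [z + e]:
   they sum to zero, and so do their first moments. *)
pose r (w t : R) : R := ramp ((t - w) / e).
have Cr (w : R) m : Ck m (r w) by exact: (Ck_rescale w e (Ck_ramp m)).
pose h (t : R) : R := k * r x t + (-1) * r y t + (1 - k) * r z t.
have sh : smooth h.
  apply: Ck_smooth => m; apply: CkD; first apply: CkD.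
  - by apply: CkM; [exact: Ck_cst|exact: Cr].
  - by apply: CkM; [exact: Ck_cst|exact: Cr].
  - by apply: CkM; [exact: Ck_cst|exact: Cr].
have h0 t : t \notin `[x, z + e[ -> h t = 0.
  rewrite in_itv /= negb_and -ltNge -leNgt => /orP[t1|t1].
    have rl w : x <= w -> r w t = 0.
      by move=> xw; rewrite /r ramp_left// pmulr_lle0 ?invr_gt0//; lra.
    by rewrite /h !rl//; [lra|exact: ltW].
  have rr w : w <= z -> r w t = ramp 1 + step 1 * ((t - w) / e - 1).
    by move=> wz; rewrite /r ramp_right// ler_pdivlMr//; lra.
  by rewrite /h !rr//; [rewrite /y; lra|exact: ltW].
pose m (w t : R) : R := mollifier ((t - w) / e).
have cm (w : R) : continuous (m w).
  by apply: derivable_continuous; exact: (Ck_rescale w e (Ck_mollifier 1)).1.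
have hE : derive1n 2 h = (fun t => e^-1 ^+ 2 * (k * m x t + (-1) * m y t + (1 - k) * m z t)).
  rewrite /h (derive1n2_combination3 _ _ _ (Cr x 2) (Cr y 2) (Cr z 2)).
  by apply/funext => t; rewrite /r !(ramp_rescale_derive2 _ e0) /m; ring.
have um (w : R) : locint leb (fun t => u t * m w t).
  by apply: continuous_locint => t; apply: cvgM; [exact: cu|exact: cm].
have := H h x (z + e) sh h0.
set I1 := \int[leb]_(t in _) _ in P1.
set I2 := \int[leb]_(t in _) _ in P2.
set I3 := \int[leb]_(t in _) _ in P3.
have i1 := locintZ k (um x); have i2 := locintZ (-1) (um y); have i3 := locintZ (1 - k) (um z).
have -> : \int[leb]_(t in `[x, z + e[) (u t * derive1n 2 h t) =
    e^-1 ^+ 2 * (k * I1 + (-1) * I2 + (1 - k) * I3).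
  rewrite /I1 /I2 /I3 -!RintegralZl//; try exact: um.
  rewrite -(RintegralD _ (i1 _ _) (i2 _ _))//.
  rewrite -(RintegralD _ (locintD i1 i2 _ _) (i3 _ _))// -RintegralZl//; last first.
    exact: (locintD (locintD i1 i2) i3).
  by apply: eq_Rintegral => t _; rewrite hE /m; lra.
move/eqP; rewrite mulf_eq0 expf_eq0/= invr_eq0 gt_eqF//= => /eqP I0.
have s0 : 0 < e * step 1 :> R by rewrite mulr_gt0// step1_gt0.
rewrite -(ler_pM2r s0); set s := e * step 1 in P1 P2 P3 s0 *.
rewrite -[s in X in X <= _](ger0_norm (ltW s0)) -normrM.
move: P1 P2 P3; rewrite !ler_distl => /andP[a1 a2] /andP[a3 a4] /andP[a5 a6].
rewrite ler_norml; apply/andP; split; nra.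
Qed.

Lemma weak_affine_line u : continuous u ->
  (forall h c d, smooth h -> (forall t, t \notin `[c, d[ -> h t = 0) ->
     \int[leb]_(t in `[c, d[) (u t * derive1n 2 h t) = 0) ->
  exists s, forall t, u t = u 0 + s * t.
Proof.
move=> cu H; have W := weak_affine cu H; exists (u 1 - u 0) => t.
have [t0|t0|->] := ltgtP t 0; last by rewrite mulr0 addr0.
- have := W t 1 ((1 - t)^-1) ltac:(lra) ltac:(rewrite invr_ge0; lra)
    ltac:(rewrite invf_le1; lra).
  have n0 : 1 - t != 0 by rewrite gt_eqF//; lra.
  have -> : (1 - t)^-1 * t + (1 - (1 - t)^-1) * 1 = 0 by field.
  by move=> ->; field.
- have [t1|t1] := leP t 1.
    have := W 0 1 (1 - t) ltr01 ltac:(lra) ltac:(lra).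
    have -> : (1 - t) * 0 + (1 - (1 - t)) * 1 = t by ring.
    by move=> ->; ring.
  have n0 : t != 0 by rewrite gt_eqF.
  have := W 0 t (1 - t^-1) t0 ltac:(rewrite subr_ge0 invf_le1; lra)
    ltac:(rewrite gerBl invr_ge0; lra).
  have -> : (1 - t^-1) * 0 + (1 - (1 - t^-1)) * t = 1 by field.
  by move=> ->; field.
Qed.

End DuBoisReymond.

(** * Weak solutions are strong solutions *)

Section TestFunctions.
Context {R : realType}.
Implicit Types (f g h u : R -> R) (x y z a b c d k e : R).

Lemma continuous_zero_left g c : continuous g -> (forall x, x < c -> g x = 0) -> g c = 0.
Proof.
move=> cg g0; apply: (@cvg_unique _ _ (g x @[x --> c^'-])) => //.
  by apply: cvg_at_left_filter; exact: cg.
apply: cvg_near_cst; near=> x; rewrite g0//; near: x; exact: nbhs_left_lt.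
Unshelve. all: by end_near. Qed.

Lemma continuous_zero_right g c : continuous g -> (forall x, c < x -> g x = 0) -> g c = 0.
Proof.
move=> cg g0; apply: (@cvg_unique _ _ (g x @[x --> c^'+])) => //.
  by apply: cvg_at_right_filter; exact: cg.
apply: cvg_near_cst; near=> x; rewrite g0//; near: x; exact: nbhs_right_gt.
Unshelve. all: by end_near. Qed.

Lemma derive1_locally0 h x : (\forall t \near x, h t = 0) -> derive1 h x = 0.
Proof.
move=> h0; have e0 : {near x, (cst 0) =1 h} by near=> t; rewrite (near h0 t).
by rewrite derive1E -(@near_eq_derive R R R _ _ x 1 e0) derive_cst.
Unshelve. all: by end_near. Qed.

(** A smooth function that vanishes outside [`[c, d[] vanishes together with
    its derivative at both ends, by continuity. *)
Lemma test_function h c d : smooth h -> (forall t, t \notin `[c, d[ -> h t = 0) ->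
  [/\ primitive h (derive1 h), primitive (derive1 h) (derive1n 2 h), h c = 0 /\ h d = 0 &
      derive1 h c = 0 /\ derive1 h d = 0].
Proof.
move=> sh h0; have [dh [dh1 [dh2 _]]] := smooth_Ck sh 3.
have c0 := derivable_continuous dh; have c1 := derivable_continuous dh1.
have c2 := derivable_continuous dh2.
have hl x : x < c -> h x = 0 by move=> xc; apply: h0; rewrite in_itv /= leNgt xc.
have hr x : d < x -> h x = 0.
  by move=> xc; apply: h0; rewrite in_itv /= [x < d]ltNge (ltW xc) andbF.
split; [exact: C1_primitive|exact: C1_primitive| |]; split.
- exact: continuous_zero_left.
- exact: continuous_zero_right.
- apply: continuous_zero_left => // x xc; apply: derive1_locally0.
  by near=> t; apply: hl; near: t; exact: lt_nbhsl.
- apply: continuous_zero_right => // x xc; apply: derive1_locally0.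
  by near=> t; apply: hr; near: t; exact: lt_nbhsr.
Unshelve. all: by end_near. Qed.

End TestFunctions.

Section WeakAndStrong.
Context {R : realType} (om : loc_charge R)
  (up : {measure set (measurableTypeR R) -> \bar R}) (lup : locfin up).
Implicit Types (f g p u : R -> R) (x y a b c d k : R).

Lemma wint_nil x y g : y <= x -> wint om x y g = 0.
Proof. by move=> yx; rewrite /wint /charge_Rintegral !int_itvco0// subrr. Qed.

Lemma balance_exists f g1 g2 c k : admissible up g1 g2 -> locint leb f ->
  balance om up f (fun x => k + (4^-1 * oint_from leb c f x - source_from om up c x g1 g2)) g1 g2.
Proof.
move=> ad fi x y xy.
by rewrite -(source_from_chasles om c ad xy) -(oint_from_chasles c fi xy); ring.
Qed.

Lemma primitive_affine_shift u p k s f : primitive u p -> (forall x, f x = u x + k + s * x) ->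
  primitive f (fun x => p x + s).
Proof.
move=> [pi uE] fE; have si : locint leb (fun _ : R => s).
  by apply: continuous_locint => x; exact: cvg_cst.
split; first exact: locintD.
move=> x y xy; rewrite RintegralD// -uE// (int_constant (k := s))// !fE; ring.
Qed.

(** Integrating the equation twice produces
    a function with the same weak second derivative, so by the du
    Bois-Reymond lemma it differs from the given one by an affine function. *)
Lemma weak_solution f phi g1 g2 : admissible up g1 g2 -> primitive f phi ->
  (forall h c d, smooth h -> (forall t, t \notin `[c, d[ -> h t = 0) ->
     - (\int[leb]_(t in `[c, d[) (f t * derive1n 2 h t)) +
       4^-1 * \int[leb]_(t in `[c, d[) (f t * h t) =
     source om up c d (fun t => g1 t * h t) (fun t => g2 t * h t)) ->
  exists p, solution om up f p g1 g2.
Proof.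
move=> ad fp W; have fi := primitive_locint fp.
have bal := balance_exists 0 0 ad fi.
set p := (X in balance _ _ _ X _ _) in bal.
have [mp bp] := balance_regular ad fi bal.
have pi : locint leb p by apply: locint_bounded => //; exact: locfin_leb.
have u_p := primitive_oint_from 0 pi; set u := oint_from leb 0 p in u_p.
have cu := primitive_continuous u_p; have cf := primitive_continuous fp.
have cfu : continuous (fun t => f t - u t) by move=> t; apply: cvgB; [exact: cf|exact: cu].
have [s sE] : exists s, forall t, f t - u t = f 0 - u 0 + s * t.
  apply: (weak_affine_line cfu) => h c d sh h0.
  have [cd|dc] := leP c d; last by rewrite int_itvco0// ltW.
  have [hp h1p [hc hd] [h1c h1d]] := test_function sh h0.
  have := W h c d sh h0.
  rewrite -(balance_weak lup ad fi bal u_p hp h1p hc hd h1c h1d cd) => /addIr/oppr_inj E.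
  have h2i := h1p.1.
  have i1 := locintM h2i (primitive_measurable fp) (primitive_locbounded fp).
  have i2 := locintM h2i (primitive_measurable u_p) (primitive_locbounded u_p).
  have -> : \int[leb]_(t in `[c, d[) ((f t - u t) * derive1n 2 h t) =
     \int[leb]_(t in `[c, d[) (f t * derive1n 2 h t - u t * derive1n 2 h t).
    by apply: eq_Rintegral => t _; rewrite mulrBl.
  by rewrite (RintegralB _ (i1 c d) (i2 c d))// E subrr.
exists (fun x => p x + s); split.
  by apply: (primitive_affine_shift u_p (k := f 0 - u 0)) => x; have := sE x; lra.
by move=> x y xy; rewrite -(bal _ _ xy); ring.
Qed.

Lemma strong_weak f p g1 g2 h c d : admissible up g1 g2 -> solution om up f p g1 g2 ->
  smooth h -> (forall t, t \notin `[c, d[ -> h t = 0) ->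
  - (\int[leb]_(t in `[c, d[) (f t * derive1n 2 h t)) +
    4^-1 * \int[leb]_(t in `[c, d[) (f t * h t) =
  source om up c d (fun t => g1 t * h t) (fun t => g2 t * h t).
Proof.
move=> ad [fp fE] sh h0; have [cd|dc] := leP c d; last first.
  by rewrite /source wint_nil ?int_itvco0 ?ltW//; ring.
have [hp h1p [hc hd] [h1c h1d]] := test_function sh h0.
exact: (balance_weak lup ad (primitive_locint fp) fE fp hp h1p hc hd h1c h1d cd).
Qed.

Lemma balance_left_continuous f p g1 g2 y : admissible up g1 g2 -> locint leb f ->
  balance om up f p g1 g2 -> p x @[x --> y^'-] --> p y.
Proof.
move=> ad fi bal.
have -> : p = (fun x => p 0 + 4^-1 * oint_from leb 0 f x - source_from om up 0 x g1 g2).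
  by apply/funext => x; exact: balance_pE.
apply: cvgB; last exact: source_from_left_continuous.
apply: cvgD; first exact: cvg_cst.
apply: cvgM; first exact: cvg_cst.
apply: cvg_at_left_filter; exact: (primitive_continuous (primitive_oint_from 0 fi)).
Qed.

End WeakAndStrong.

(** * The relation on the line *)

Section RelationsOnTheLine.
Context {R : realType} (om : loc_charge R)
  (up : {measure set (measurableTypeR R) -> \bar R}) (lup : locfin up).
Implicit Types (F G : elt R * elt R) (f g : elt R) (p q : R -> R[i]) (x y a b c d : R).

Lemma Re_realM (z : R[i]) (w : R) : complex.Re (z * (w%:C)%C) = complex.Re z * w.
Proof. by case: z => x y /=; ring. Qed.

Lemma Im_realM (z : R[i]) (w : R) : complex.Im (z * (w%:C)%C) = complex.Im z * w.
Proof. by case: z => x y /=; ring. Qed.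

Lemma complex4V : 4^-1 = ((4^-1 : R)%:C)%C :> R[i].
Proof. by rewrite fmorphV rmorph_nat. Qed.

Lemma Re_4V (z : R[i]) : complex.Re (4^-1 * z) = 4^-1 * complex.Re z.
Proof. by rewrite complex4V mulrC Re_realM mulrC. Qed.

Lemma Im_4V (z : R[i]) : complex.Im (4^-1 * z) = 4^-1 * complex.Im z.
Proof. by rewrite complex4V mulrC Im_realM mulrC. Qed.

Lemma complex_eqP (z w : R[i]) : z = w <->
  complex.Re z = complex.Re w /\ complex.Im z = complex.Im w.
Proof. by split=> [->//|]; case: z => a b; case: w => c d /= [-> ->]. Qed.

Lemma Re_add (z w : R[i]) : complex.Re (z + w) = complex.Re z + complex.Re w.
Proof. by case: z => ? ?; case: w. Qed.

Lemma Im_add (z w : R[i]) : complex.Im (z + w) = complex.Im z + complex.Im w.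
Proof. by case: z => ? ?; case: w. Qed.

Lemma Re_opp (z : R[i]) : complex.Re (- z) = - complex.Re z.
Proof. by case: z. Qed.

Lemma Im_opp (z : R[i]) : complex.Im (- z) = - complex.Im z.
Proof. by case: z. Qed.

Lemma weak_equation_parts (f u v : R -> R[i]) (h h2 : R -> R) c d :
  (- cintegral leb `[c, d[ (fun x => f x * ((h2 x)%:C)%C) +
     4^-1 * cintegral leb `[c, d[ (fun x => f x * ((h x)%:C)%C) =
   loc_charge_cintegral om c d (fun x => u x * ((h x)%:C)%C) +
     cintegral up `[c, d[ (fun x => v x * ((h x)%:C)%C)) <->
  - (\int[leb]_(t in `[c, d[) (rep f t * h2 t)) + 4^-1 * \int[leb]_(t in `[c, d[) (rep f t * h t) =
    source om up c d (fun t => rep u t * h t) (fun t => rep v t * h t) /\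
  - (\int[leb]_(t in `[c, d[) (imp f t * h2 t)) + 4^-1 * \int[leb]_(t in `[c, d[) (imp f t * h t) =
    source om up c d (fun t => imp u t * h t) (fun t => imp v t * h t).
Proof.
rewrite complex_eqP !Re_add !Im_add Re_opp Im_opp Re_4V Im_4V /=.
have Er (w : R -> R[i]) (k : R -> R) : rep (fun x => w x * ((k x)%:C)%C) = (fun t => rep w t * k t).
  by apply/funext => t; rewrite Re_realM.
have Ei (w : R -> R[i]) (k : R -> R) : imp (fun x => w x * ((k x)%:C)%C) = (fun t => imp w t * k t).
  by apply/funext => t; rewrite Im_realM.
by rewrite !Er !Ei.
Qed.

Lemma L2loc_parts (mu : {measure set (measurableTypeR R) -> \bar R}) (u : R -> R[i]) :
  (forall x y, L2 mu `[x, y[ u) <-> L2loc mu (rep u) /\ L2loc mu (imp u).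
Proof.
split=> [uL|[ur ui] x y].
  by split=> x y; have [] := (L2P _ _ (measurable_itv _)).1 (uL x y).
exact: (L2P _ _ (measurable_itv _)).2 (conj (ur x y) (ui x y)).
Qed.

Lemma sobolev_L2_admissible u phi v : sobolev u phi -> L2loc up v -> admissible up u v.
Proof.
move=> [up' _] vL; split; [exact: primitive_measurable up'|exact: primitive_locbounded up'|].
exact: L2loc_locint.
Qed.

Lemma Hloc_admissible g : Hloc up g ->
  admissible up (rep g.1) (rep g.2) /\ admissible up (imp g.1) (imp g.2).
Proof.
move=> [/H1locP[su sv] /L2loc_parts[ur ui]].
exact: (conj (sobolev_L2_admissible su ur) (sobolev_L2_admissible sv ui)).
Qed.

(** The relation with the left-continuous derivative [p] as a witness, and the
    equation in its strong form for the real and imaginary parts. *)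
Definition Tloc_with p F := [/\ Hloc up F.1, Hloc up F.2,
  solution om up (rep F.1.1) (rep p) (rep F.2.1) (rep F.2.2) /\
  solution om up (imp F.1.1) (imp p) (imp F.2.1) (imp F.2.2) &
  {ae up, forall x, F.1.2 x = F.2.1 x}].

(** From weak to strong by the du Bois-Reymond lemma, and back by integrating by
    parts twice against the test function. *)
Lemma TlocP F : Tloc om up F <-> exists p, Tloc_with p F.
Proof.
split=> [[HF1 HF2 W e]|[p [HF1 HF2 [sr si] e]]]; have [adr adi] := Hloc_admissible HF2.
  have [[fr _] [fi _]] := (H1locP F.1.1).1 HF1.1.
  have [pr sr] := weak_solution lup adr fr (fun h c d sh h0 =>
    ((weak_equation_parts _ _ _ _ _ _ _).1 (W h c d sh h0)).1).
  have [pi si] := weak_solution lup adi fi (fun h c d sh h0 =>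
    ((weak_equation_parts _ _ _ _ _ _ _).1 (W h c d sh h0)).2).
  by exists (fun x => (pr x +i* pi x)%C).
split => // h c d sh h0; apply/weak_equation_parts.
exact: (conj (strong_weak lup adr sr sh h0) (strong_weak lup adi si sh h0)).
Qed.

Lemma oriented_parts (I : R -> R -> R[i]) x y : x < y ->
  oriented I x y = I x y /\ oriented I y x = - I x y.
Proof. by move=> xy; rewrite /oriented xy ltNge (ltW xy). Qed.

Lemma balance_parts (f p u v : R -> R[i]) :
  (forall x y, - p y + p x + 4^-1 * oint leb f x y = oint_charge om u x y + oint up v x y) <->
  balance om up (rep f) (rep p) (rep u) (rep v) /\ balance om up (imp f) (imp p) (imp u) (imp v).
Proof.
have key x y : x < y ->
  (- p y + p x + 4^-1 * oint leb f x y = oint_charge om u x y + oint up v x y) <->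
  rep p x - rep p y + 4^-1 * \int[leb]_(t in `[x, y[) rep f t = source om up x y (rep u) (rep v) /\
  imp p x - imp p y + 4^-1 * \int[leb]_(t in `[x, y[) imp f t = source om up x y (imp u) (imp v).
  move=> xy; rewrite /oint /oint_charge !(oriented_parts _ xy).1.
  rewrite complex_eqP !Re_add !Im_add Re_opp Im_opp Re_4V Im_4V /=.
  by rewrite [- _ + _]addrC [- complex.Im _ + _]addrC.
split=> [B|[Br Bi] x y].
  split=> x y; rewrite le_eqVlt => /predU1P[->|xy].
  - by rewrite /source (wint_nil _ _ (lexx _)) !int_itvco0//; ring.
  - by have [] := (key x y xy).1 (B x y).
  - by rewrite /source (wint_nil _ _ (lexx _)) !int_itvco0//; ring.
  - by have [] := (key x y xy).1 (B x y).
have [xy|yx|->] := ltgtP x y.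
- by apply/(key x y xy); split; [exact/Br/ltW|exact/Bi/ltW].
- have : - p x + p y + 4^-1 * oint leb f y x = oint_charge om u y x + oint up v y x.
    by apply/(key y x yx); split; [exact/Br/ltW|exact/Bi/ltW].
  rewrite /oint /oint_charge !(oriented_parts _ yx).1 !(oriented_parts _ yx).2 => E.
  by rewrite -opprD -E; ring.
- by rewrite /oint /oint_charge /oriented ltxx; ring.
Qed.

(** The three conditions on [p] amount to the strong equation: a function that
    satisfies the integrated equation and agrees with the derivative almost
    everywhere is a density of the first component, and conversely the
    integrated equation makes it left-continuous. *)
Lemma left_derivP F p : Hloc up F.1 -> Hloc up F.2 -> {ae up, forall x, F.1.2 x = F.2.1 x} ->
  left_deriv om up F p <-> Tloc_with p F.
Proof.
move=> HF1 HF2 e; have [adr adi] := Hloc_admissible HF2.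
have [[fr _] [fi _]] := (H1locP F.1.1).1 HF1.1.
have lr := primitive_locint fr; have li := primitive_locint fi.
split=> [[pe _ /balance_parts[br bi]]|[_ _ [[pr br] [pi bi]] _]].
  split => //; split; split => //.
    have [mp bp] := balance_regular adr lr br.
    apply: primitive_ae fr _ _; first by apply: locint_bounded => //; exact: locfin_leb.
    by apply: ae_impl pe => t ->.
  have [mp bp] := balance_regular adi li bi.
  apply: primitive_ae fi _ _; first by apply: locint_bounded => //; exact: locfin_leb.
  by apply: ae_impl pe => t ->.
split; last exact/balance_parts.
  have := ae_and (primitive_derive pr) (primitive_derive pi).
  by apply: ae_impl => t [[_ h1] [_ h2]]; apply/complex_eqP; rewrite /cderiv /= h1 h2.
move=> x; have cr := balance_left_continuous lup (y := x) adr lr br.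
have ci := balance_left_continuous lup (y := x) adi li bi.
have c0 : `|rep p t - rep p x| + `|imp p t - imp p x| @[t --> x^'-] --> (0 : R).
  rewrite -[0]addr0; apply: cvgD; apply/norm_cvg0P => //.
    by rewrite -[0](subrr (rep p x)); apply: cvgB => //; exact: cvg_cst.
  by rewrite -[0](subrr (imp p x)); apply: cvgB => //; exact: cvg_cst.
apply: squeeze_cvgr (cvg_cst 0) c0.
near=> t; apply/andP; split; first by case: (p t - p x) => ? ? /=; exact: sqrtr_ge0.
by apply: (le_trans (normc_le _)); rewrite !Re_add !Im_add !Re_opp !Im_opp.
Unshelve. all: by end_near. Qed.

Lemma Tloc_with_left_deriv F p : Tloc_with p F -> Tloc om up F /\ left_deriv om up F p.
Proof.
move=> FT; split; first by apply/TlocP; exists p.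
by have [HF1 HF2 _ e] := FT; apply/left_derivP.
Qed.

Lemma left_deriv_Tloc_with F p : Tloc om up F -> left_deriv om up F p -> Tloc_with p F.
Proof. by move=> [HF1 HF2 _ e] L; apply/left_derivP. Qed.

End RelationsOnTheLine.

(** * Boundary value problems *)

Section BoundaryValueProblems.
Context {R : realType} (om : loc_charge R)
  (up : {measure set (measurableTypeR R) -> \bar R}) (lup : locfin up).
Implicit Types (f g p w : R -> R) (x y a b c d k : R).

Lemma expR_primitive k : primitive (fun x => expR (k * x)) (fun x => k * expR (k * x)).
Proof.
have d (x : R) : is_derive x (1:R) (fun t => expR (k * t + 0)) (k * derive1 expR (k * x + 0)).
  exact: is_derive1_affine.
have e : (fun t => expR (k * t + 0)) = (fun t => expR (k * t)).
  by apply/funext => t; rewrite addr0.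
have dE : derive1 (fun t => expR (k * t)) = (fun x => k * expR (k * x)).
  apply/funext => x; rewrite -e derive1E; have [_ ->] := d x.
  by rewrite derive1E derive_val addr0.
rewrite -dE; apply: C1_primitive; first by move=> x; rewrite -e; have [] := d x.
rewrite dE => x; apply: cvgM; first exact: cvg_cst.
apply: continuous_comp; last exact: continuous_expR.
by apply: cvgM; [exact: cvg_cst|exact: cvg_id].
Qed.

Lemma primitive_eq f g p w : primitive f p -> (forall x, f x = g x) -> (forall x, p x = w x) ->
  primitive g w.
Proof. by move=> fp /funext <- /funext <-. Qed.

Lemma homogeneous_solution al be :
  primitive (fun x => al * expR (2^-1 * x) + be * expR (- 2^-1 * x))
    (fun x => 2^-1 * (al * expR (2^-1 * x) - be * expR (- 2^-1 * x))) /\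
  primitive (fun x => 2^-1 * (al * expR (2^-1 * x) - be * expR (- 2^-1 * x)))
    (fun x => 4^-1 * (al * expR (2^-1 * x) + be * expR (- 2^-1 * x))).
Proof.
have h1 := primitiveZ al (expR_primitive 2^-1).
have h2 := primitiveZ be (expR_primitive (- 2^-1)).
split.
  by apply: (primitive_eq (primitiveD h1 h2)) => x //=; lra.
by apply: (primitive_eq (primitiveZ 2^-1 (primitiveB h1 h2))) => x //=; lra.
Qed.

(** Variation of constants. Writing [p] as [w] minus the accumulated source
    turns the equation into a first-order system with locally absolutely
    continuous unknowns [f] and [w], which the combinations [w + f / 2] and
    [w - f / 2] diagonalize. *)
Lemma particular_solution g1 g2 : admissible up g1 g2 -> exists f p, solution om up f p g1 g2.
Proof.
move=> ad; pose P x := - source_from om up 0 x g1 g2.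
have mP : measurable_fun [set: measurableTypeR R] P.
  by apply: measurableT_comp => //; exact: source_from_measurable.
have bP : locbounded P.
  move=> x y; have [M hM] := source_from_locbounded om 0 ad x y.
  by exists M => t /hM; rewrite normrN.
have iP : locint leb P by apply: locint_bounded => //; exact: locfin_leb.
have ep := expR_primitive 2^-1; have em := expR_primitive (- 2^-1).
have iA : locint leb (fun x => expR (- 2^-1 * x) * P x).
  by apply: locintM => //; [exact: primitive_measurable em|exact: primitive_locbounded em].
have iB : locint leb (fun x => expR (2^-1 * x) * P x).
  by apply: locintM => //; [exact: primitive_measurable ep|exact: primitive_locbounded ep].
have pA := primitive_oint_from 0 iA; have pB := primitive_oint_from 0 iB.
set A := oint_from _ _ _ in pA; set B := oint_from _ _ _ in pB.
have EE x : expR (2^-1 * x) * expR (- 2^-1 * x) = 1 by rewrite -expRD mulNr subrr expR0.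
pose up_ x := expR (2^-1 * x) * A x; pose um x := expR (- 2^-1 * x) * B x.
have pu := primitiveM ep pA; have pm := primitiveM em pB.
pose w x := 4^-1 * (up_ x - um x); pose f x := 2^-1 * (up_ x + um x).
have fp : primitive f (fun x => P x + w x).
  apply: (primitive_eq (primitiveZ 2^-1 (primitiveD pu pm))) => x //=.
  by rewrite /w /up_ /um !mulrA EE [expR (- _ * x) * expR _]mulrC EE; lra.
have wp : primitive w (fun x => 4^-1 * f x).
  apply: (primitive_eq (primitiveZ 4^-1 (primitiveB pu pm))) => x //=.
  by rewrite /f /up_ /um !mulrA EE [expR (- _ * x) * expR _]mulrC EE; lra.
exists f, (fun x => P x + w x); split => // x y xy.
have fi := primitive_locint fp.
by rewrite -RintegralZl// -(wp.2 _ _ xy) /P -(source_from_chasles om 0 ad xy); ring.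
Qed.

(** The solutions [exp (x/2)] and [exp (-x/2)] of the homogeneous equation are
    linearly independent on the two end points, because the exponential is
    strictly increasing. *)
Lemma exponential_interpolation a b (r0 r1 : R) : a < b -> exists al be,
  al * expR (2^-1 * a) + be * expR (- 2^-1 * a) = r0 /\
  al * expR (2^-1 * b) + be * expR (- 2^-1 * b) = r1.
Proof.
move=> ab; rewrite !mulNr !expRN.
have : expR (2^-1 * a) < expR (2^-1 * b) by rewrite ltr_expR; lra.
have := expR_gt0 (2^-1 * a); have := expR_gt0 (2^-1 * b).
move: (expR (2^-1 * a)) (expR (2^-1 * b)) => u v v0 u0 uv.
have d0 : u ^+ 2 - v ^+ 2 != 0 by rewrite lt_eqF//; nra.
have un : u != 0 by rewrite gt_eqF.
have vn : v != 0 by rewrite gt_eqF.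
exists ((r0 * u - r1 * v) / (u ^+ 2 - v ^+ 2)).
exists (u * (r0 - (r0 * u - r1 * v) / (u ^+ 2 - v ^+ 2) * u)).
by split; field; rewrite ?un ?vn ?d0.
Qed.

Lemma solution_add_homogeneous f p g1 g2 w q : solution om up f p g1 g2 ->
  primitive w q -> primitive q (fun x => 4^-1 * w x) ->
  solution om up (fun x => f x + w x) (fun x => p x + q x) g1 g2.
Proof.
move=> [fp bal] wk kw.
split; first exact: primitiveD.
move=> x y xy; have wi := primitive_locint wk; have fi := primitive_locint fp.
rewrite (RintegralD _ (fi x y) (wi x y))// -(bal _ _ xy) mulrDr.
have := kw.2 _ _ xy; rewrite RintegralZl// => <-; ring.
Qed.

Lemma dirichlet_problem a b (r0 r1 : R) g1 g2 : a < b -> admissible up g1 g2 ->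
  exists f p, solution om up f p g1 g2 /\ f a = r0 /\ f b = r1.
Proof.
move=> ab ad; have [f [p sol]] := particular_solution ad.
have [al [be [e0 e1]]] := exponential_interpolation (r0 - f a) (r1 - f b) ab.
have [h1 h2] := homogeneous_solution al be.
exists (fun x => f x + (al * expR (2^-1 * x) + be * expR (- 2^-1 * x))).
exists (fun x => p x + 2^-1 * (al * expR (2^-1 * x) - be * expR (- 2^-1 * x))).
by split; [exact: (solution_add_homogeneous sol h1 h2)|rewrite e0 e1; split; lra].
Qed.

(** The derivatives of the homogeneous solutions are, up to the factor one half
    and a sign, the same exponentials, so the same interpolation applies. *)
Lemma neumann_problem a b (r0 r1 : R) g1 g2 : a < b -> admissible up g1 g2 ->
  exists f p, solution om up f p g1 g2 /\ p a = r0 /\ p b = r1.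
Proof.
move=> ab ad; have [f [p sol]] := particular_solution ad.
have [al [be [e0 e1]]] := exponential_interpolation (2 * (r0 - p a)) (2 * (r1 - p b)) ab.
have [h1 h2] := homogeneous_solution al (- be).
exists (fun x => f x + (al * expR (2^-1 * x) + - be * expR (- 2^-1 * x))).
exists (fun x => p x + 2^-1 * (al * expR (2^-1 * x) - - be * expR (- 2^-1 * x))).
split; first exact: (solution_add_homogeneous sol h1 h2).
have {e0}e0 : al * expR (2^-1 * a) - - be * expR (- 2^-1 * a) = 2 * (r0 - p a) by lra.
have {e1}e1 : al * expR (2^-1 * b) - - be * expR (- 2^-1 * b) = 2 * (r1 - p b) by lra.
by rewrite e0 e1; split; lra.
Qed.

Lemma solution_sobolev f p g1 g2 : admissible up g1 g2 -> solution om up f p g1 g2 -> sobolev f p.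
Proof.
move=> ad [fp bal]; split => //.
have [mp bp] := balance_regular ad (primitive_locint fp) bal.
by apply: L2loc_bounded => //; exact: locfin_leb.
Qed.

End BoundaryValueProblems.

(** * The energy form on real functions *)

Section RealEnergy.
Context {R : realType} (om : loc_charge R)
  (up : {measure set (measurableTypeR R) -> \bar R}) (lup : locfin up).
Implicit Types (mu : {measure set (measurableTypeR R) -> \bar R}).
Implicit Types (u v w f p : R -> R) (x y a b c d : R).

Lemma ae_Rintegral mu (D : set (measurableTypeR R)) u v : measurable D ->
  measurable_fun D u -> measurable_fun D v -> {ae mu, forall x, D x -> u x = v x} ->
  \int[mu]_(x in D) u x = \int[mu]_(x in D) v x.
Proof.
move=> mD mu_ mv uv; congr fine; apply: ae_eq_integral => //; try exact/measurable_EFinP.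
by apply: ae_impl uv => x + Dx; move=> ->.
Qed.

(** This is what makes the energy definite: a nonnegative function of zero
    integral vanishes almost everywhere. *)
Lemma L2on_sqr_int0 mu (D : set (measurableTypeR R)) u : measurable D -> L2on mu D u ->
  \int[mu]_(x in D) (u x * u x) = 0 -> {ae mu, forall x, D x -> u x = 0}.
Proof.
move=> mD uL u0; have iu := L2on_integrableM mD uL uL; have [mu_ _] := uL.
have mu2 : measurable_fun D (fun x => (u x * u x)%:E).
  by apply/measurable_EFinP; exact: measurable_funM.
have : (\int[mu]_(x in D) `|(u x * u x)%:E| = 0)%E.
  have -> : (\int[mu]_(x in D) `|(u x * u x)%:E| = \int[mu]_(x in D) (u x * u x)%:E)%E.
    by apply: eq_integral => x _; rewrite gee0_abs// lee_fin -expr2 sqr_ge0.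
  by rewrite -[LHS]fineK ?integrable_fin_num// -[fine _]/(\int[mu]_(x in D) (u x * u x)) u0.
move/(ae_eq_integral_abs mu mD mu2); apply: ae_impl => x h Dx.
by have [] := h Dx => /eqP; rewrite mulf_eq0 orbb => /eqP.
Qed.

(** Young's inequality: integrate the square of [u + s * v / c] with [s = 1] and
    with [s = -1]. *)
Lemma L2on_young mu (D : set (measurableTypeR R)) u v c : measurable D -> L2on mu D u ->
  L2on mu D v -> 0 < c ->
  `|\int[mu]_(x in D) (u x * v x)| <=
    2^-1 * (c * \int[mu]_(x in D) (u x * u x) + c^-1 * \int[mu]_(x in D) (v x * v x)).
Proof.
move=> mD uL vL c0.
have iuu := L2on_integrableM mD uL uL; have ivv := L2on_integrableM mD vL vL.
have iuv := L2on_integrableM mD uL vL.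
have key (s : R) : s * s = 1 ->
    0 <= 2^-1 * (c * \int[mu]_(x in D) (u x * u x) + c^-1 * \int[mu]_(x in D) (v x * v x)) +
      s * \int[mu]_(x in D) (u x * v x).
  move=> ss.
  have i1 : mu.-integrable D (EFin \o (fun x => c * (u x * u x))) by exact: (integrableZl mD c iuu).
  have i2 : mu.-integrable D (EFin \o (fun x => c^-1 * (v x * v x))) by exact: (integrableZl mD c^-1 ivv).
  have i3 : mu.-integrable D (EFin \o (fun x => s * (u x * v x))) by exact: (integrableZl mD s iuv).
  have i12 : mu.-integrable D (EFin \o (fun x => c * (u x * u x) + c^-1 * (v x * v x))).
    exact: (integrableD mD i1 i2).
  have i4 : mu.-integrable D (EFin \o (fun x => 2^-1 * (c * (u x * u x) + c^-1 * (v x * v x)))).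
    exact: (integrableZl mD 2^-1 i12).
  rewrite -(RintegralZl _ mD iuu) -(RintegralZl _ mD ivv) -(RintegralZl _ mD iuv).
  rewrite -(RintegralD mD i1 i2) -(RintegralZl _ mD i12) -(RintegralD mD i4 i3).
  apply: Rintegral_ge0 => x _.
  suff -> : 2^-1 * (c * (u x * u x) + c^-1 * (v x * v x)) + s * (u x * v x) =
      2^-1 * c * (u x + s * (c^-1 * v x)) ^+ 2.
    by rewrite mulr_ge0 ?sqr_ge0// mulr_ge0 ?ltW.
  have cn : c != 0 by rewrite gt_eqF.
  rewrite expr2 mulrDl !mulrDr.
  have -> : s * (c^-1 * v x) * (s * (c^-1 * v x)) = (s * s) * (c^-1 * v x * (c^-1 * v x)) by ring.
  by rewrite ss; field.
have := key 1 (mulr1 _); have := key (-1) ltac:(lra).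
by rewrite ler_norml; lra.
Qed.

Lemma int_mulBl mu (D : set (measurableTypeR R)) u v w : measurable D -> L2on mu D u ->
  L2on mu D v -> L2on mu D w ->
  \int[mu]_(x in D) ((u x - v x) * w x) =
  \int[mu]_(x in D) (u x * w x) - \int[mu]_(x in D) (v x * w x).
Proof.
move=> mD uL vL wL; have i1 := L2on_integrableM mD uL wL; have i2 := L2on_integrableM mD vL wL.
rewrite -(RintegralB mD i1 i2).
by have -> : (fun x => (u x - v x) * w x) = (fun x => u x * w x - v x * w x)
  by apply/funext => x; rewrite mulrBl.
Qed.

Definition energy a b u1 u2 v1 v2 := pairing up a b u1 (derive1 u1) u2 v1 (derive1 v1) v2.

Definition square_integrable a b u1 u2 :=
  [/\ L2on leb `[a, b[ u1, L2on leb `[a, b[ (derive1 u1) & L2on up `[a, b[ u2].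

Definition local_element u1 u2 := sobolev u1 (derive1 u1) /\ L2loc up u2.

Lemma local_element_square_integrable a b u1 u2 : local_element u1 u2 ->
  square_integrable a b u1 u2.
Proof.
move=> [[up1 uL] u2L]; split; [|exact: uL|exact: u2L].
apply: L2loc_bounded; [exact: locfin_leb|exact: primitive_measurable up1|].
exact: primitive_locbounded up1.
Qed.

Lemma local_elementB u1 u2 v1 v2 : local_element u1 u2 -> local_element v1 v2 ->
  local_element (fun x => u1 x - v1 x) (fun x => u2 x - v2 x).
Proof.
move=> [su uL] [sv vL]; split; last by move=> x y; apply: L2onB; [exact: measurable_itv|exact: uL|exact: vL].
by have [] := sobolev_derive1 (sobolevB su sv).
Qed.

Let weighted_young (c d x1 x2 x3 y1 y2 y3 z1 z2 z3 : R) :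
  `|x1| <= 2^-1 * (c * y1 + d * z1) -> `|x2| <= 2^-1 * (c * y2 + d * z2) ->
  `|x3| <= 2^-1 * (c * y3 + d * z3) ->
  `|4^-1 * x1 + x2 + x3| <= 2^-1 * (c * (4^-1 * y1 + y2 + y3) + d * (4^-1 * z1 + z2 + z3)).
Proof.
rewrite !ler_norml => /andP[? ?] /andP[? ?] /andP[? ?].
by apply/andP; split; lra.
Qed.

Lemma energy_young a b u1 u2 v1 v2 c : square_integrable a b u1 u2 ->
  square_integrable a b v1 v2 -> 0 < c ->
  `|energy a b u1 u2 v1 v2| <=
    2^-1 * (c * energy a b u1 u2 u1 u2 + c^-1 * energy a b v1 v2 v1 v2).
Proof.
move=> [u1L du1L u2L] [v1L dv1L v2L] c0; have mD := measurable_itv `[a, b[%R.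
have h1 := L2on_young mD u1L v1L c0; have h2 := L2on_young mD du1L dv1L c0.
have h3 := L2on_young mD u2L v2L c0; rewrite /energy /pairing.
exact: (weighted_young h1 h2 h3).
Qed.

Lemma energy_ge0 a b u1 u2 : 0 <= energy a b u1 u2 u1 u2.
Proof.
by rewrite /energy /pairing !addr_ge0// ?mulr_ge0// ?invr_ge0//;
  apply: Rintegral_ge0 => x _; rewrite -expr2 sqr_ge0.
Qed.

Lemma energyB a b u1 u2 v1 v2 w1 w2 : local_element u1 u2 -> local_element v1 v2 ->
  local_element w1 w2 ->
  energy a b (fun x => u1 x - v1 x) (fun x => u2 x - v2 x) w1 w2 =
  energy a b u1 u2 w1 w2 - energy a b v1 v2 w1 w2.
Proof.
move=> U V W; have mD := measurable_itv `[a, b[%R.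
have [u1L du1L u2L] := local_element_square_integrable a b U.
have [v1L dv1L v2L] := local_element_square_integrable a b V.
have [w1L dw1L w2L] := local_element_square_integrable a b W.
have [_ dL _] := local_element_square_integrable a b (local_elementB U V).
have e := (sobolev_derive1 (sobolevB U.1 V.1)).2.
rewrite /energy /pairing (int_mulBl mD u1L v1L w1L) (int_mulBl mD u2L v2L w2L).
have -> : \int[leb]_(t in `[a, b[) (derive1 (fun x => u1 x - v1 x) t * derive1 w1 t) =
   \int[leb]_(t in `[a, b[) ((derive1 u1 t - derive1 v1 t) * derive1 w1 t).
  apply: ae_Rintegral => //.
  - by apply: measurable_funM; [exact: dL.1|exact: dw1L.1].
  - apply: measurable_funM; last exact: dw1L.1.
    by apply: measurable_funB; [exact: du1L.1|exact: dv1L.1].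
  - by apply: ae_impl e => x /= -> _.
rewrite (int_mulBl mD du1L dv1L dw1L).
have aux (x1 x2 x3 y1 y2 y3 : R) : 4^-1 * (x1 - y1) + (x2 - y2) + (x3 - y3) =
    4^-1 * x1 + x2 + x3 - (4^-1 * y1 + y2 + y3) by ring.
exact: aux.
Qed.

(** The derivative vanishes almost everywhere, so the first component is
    constant, and its value at the left end point is zero. *)
Lemma energy_eq0 a b u1 u2 : local_element u1 u2 -> u1 a = 0 -> energy a b u1 u2 u1 u2 = 0 ->
  (forall x, a <= x -> x < b -> u1 x = 0) /\ {ae up, forall x, `[a, b[%classic x -> u2 x = 0}.
Proof.
move=> U ua; have mD := measurable_itv `[a, b[%R.
have [u1L du1L u2L] := local_element_square_integrable a b U.
have p0 mu (w : R -> R) : 0 <= \int[mu]_(t in `[a, b[) (w t * w t).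
  by apply: Rintegral_ge0 => x _; rewrite -expr2 sqr_ge0.
have aux (x1 x2 x3 : R) : 0 <= x1 -> 0 <= x2 -> 0 <= x3 -> 4^-1 * x1 + x2 + x3 = 0 ->
  x2 = 0 /\ x3 = 0 by move=> *; split; lra.
move/(aux _ _ _ (p0 leb u1) (p0 leb (derive1 u1)) (p0 up u2)) => [e1 e2].
split; last exact: (L2on_sqr_int0 mD u2L e2).
move=> x ax xb; have := U.1.1.2 _ _ ax; rewrite ua subr0 => ->.
transitivity (\int[leb]_(t in `[a, x[) (0 : R)); last by rewrite Rintegral_cst//= ?mul0r//.
apply: ae_Rintegral => //.
  by apply: measurable_funS du1L.1 => //; exact: itvcoS (ltW xb).
apply: ae_impl (L2on_sqr_int0 mD du1L e1) => t h tx; apply: h.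
by apply: itvcoS tx => //; exact: ltW.
Qed.

(** The real or the imaginary part of a pair of the relation on the line,
    together with the derivative [p]. *)
Definition real_pair f1 f2 p g1 g2 := [/\ solution om up f1 p g1 g2, local_element f1 f2,
  local_element g1 g2 & {ae up, forall x, f2 x = g1 x}].

Lemma local_element_admissible g1 g2 : local_element g1 g2 -> admissible up g1 g2.
Proof. by move=> [s L]; exact: (sobolev_L2_admissible lup s L). Qed.

(** Green's formula in terms of the energy: the momenta [p] and [q] may be
    replaced by the derivatives, and the second components of [f] and [k] by
    the first components of [g] and [l], as they agree almost everywhere. *)
Lemma energy_green a b f1 f2 p g1 g2 k1 k2 q l1 l2 : a <= b ->
  real_pair f1 f2 p g1 g2 -> real_pair k1 k2 q l1 l2 ->
  energy a b f1 f2 l1 l2 - energy a b g1 g2 k1 k2 =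
  p b * l1 b - p a * l1 a - (q b * g1 b - q a * g1 a).
Proof.
move=> ab [solf Fl Gl fg] [solk Kl Ll kl]; have mD := measurable_itv `[a, b[%R.
have adg := local_element_admissible Gl; have adl := local_element_admissible Ll.
have [f1L df1L f2L] := local_element_square_integrable a b Fl.
have [k1L dk1L k2L] := local_element_square_integrable a b Kl.
have [g1L dg1L g2L] := local_element_square_integrable a b Gl.
have [l1L dl1L l2L] := local_element_square_integrable a b Ll.
have [mg1 bg1 ig2] := adg; have [ml1 bl1 il2] := adl.
have pL := (solution_sobolev adg solf).2 a b; have qL := (solution_sobolev adl solk).2 a b.
have mg1' : measurable_fun (`[a, b[%classic : set (measurableTypeR R)) g1 by exact: measurable_funS mg1.
have ml1' : measurable_fun (`[a, b[%classic : set (measurableTypeR R)) l1 by exact: measurable_funS ml1.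
rewrite -(green_formula (f2 := f2) (k2 := k2) lup ab adg adl solf solk Gl.1.1 Ll.1.1).
- congr (_ - _); rewrite /energy /pairing; congr (_ + _ + _).
    apply: ae_Rintegral => //.
    + by apply: measurable_funM; [exact: df1L.1|exact: dl1L.1].
    + by apply: measurable_funM; [exact: pL.1|exact: dl1L.1].
    + by apply: ae_impl (primitive_derive solf.1) => t [_ ->].
  apply: ae_Rintegral => //.
  + by apply: measurable_funM; [exact: dg1L.1|exact: dk1L.1].
  + by apply: measurable_funM; [exact: dg1L.1|exact: qL.1].
  + by apply: ae_impl (primitive_derive solk.1) => t [_ ->].
- by apply: locintM.
- by apply: locintM.
- apply: ae_Rintegral => //; first by apply: measurable_funM; [exact: f2L.1|exact: l2L.1].
    by apply: measurable_funM => //; exact: l2L.1.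
  by apply: ae_impl fg => t ->.
- apply: ae_Rintegral => //; first by apply: measurable_funM; [exact: g2L.1|exact: k2L.1].
    by apply: measurable_funM => //; exact: g2L.1.
  by apply: ae_impl kl => t -> _; rewrite mulrC.
Qed.

End RealEnergy.

(** * The Hilbert space H([a, b)) *)

Section EnergySpace.
Context {R : realType} (om : loc_charge R)
  (up : {measure set (measurableTypeR R) -> \bar R}) (lup : locfin up).
Context {a b : R} (ab : a < b).
Implicit Types (mu : {measure set (measurableTypeR R) -> \bar R}).
Implicit Types (f g h : elt R) (F G K : elt R * elt R) (u v w : R -> R) (p q : R -> R[i]) (x y c d : R).

Notation D := (`[a, b[%classic : set (measurableTypeR R)).
Notation E := (energy up a b).
Notation square_integrable := (square_integrable up a b).

(** Derivatives at [a] may differ, as they see values to the left of [a]; this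
    single point is a Lebesgue null set. *)
Lemma derive1_local u v : (forall x, a <= x -> x < b -> u x = v x) ->
  forall x, a < x -> x < b -> derive1 u x = derive1 v x.
Proof.
move=> uv x ax xb; rewrite !derive1E; apply: (@near_eq_derive R R R); near=> t; rewrite uv//.
- by apply: ltW; near: t; exact: lt_nbhsr.
- by near: t; exact: lt_nbhsl.
Unshelve. all: by end_near. Qed.

Lemma ae_interior (P : R -> Prop) : (forall x, a < x -> x < b -> P x) ->
  {ae (leb : {measure set (measurableTypeR R) -> \bar R}), forall x, D x -> P x}.
Proof.
move=> HP; exists [set a]; split; [exact: measurable_set1|exact: lebesgue_measure_set1|].
move=> x /= nP; apply: contrapT => xa; apply: nP; rewrite in_itv /= => /andP[ax xb].
by apply: HP => //; rewrite lt_neqAle ax andbT; apply/eqP => e; apply: xa.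
Qed.

Lemma measurable_fun_off_point u v : measurable_fun D u ->
  (forall x, a < x -> x < b -> u x = v x) -> measurable_fun D v.
Proof.
move=> mu_ uv.
apply: (@eq_measurable_fun _ _ _ _ _ (fun x => if x == a then v a else u x)).
  move=> x; rewrite inE /= in_itv /= => /andP[ax xb]; case: eqP => [->//|/eqP xa].
  by apply: uv => //; rewrite lt_neqAle eq_sym xa.
apply: measurable_fun_if => //.
  apply: (measurable_fun_bool true) => /=.
  rewrite (_ : _ @^-1` _ = [set a]); first by apply: measurableI => //; exact: measurable_set1.
  by apply/seteqP; split=> x /= /eqP.
by apply: measurable_funS mu_ => //; exact: subIsetl.
Qed.

Lemma energy_congr u1 u2 u1' u2' v1 v2 v1' v2' :
  square_integrable u1 u2 -> square_integrable u1' u2' ->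
  square_integrable v1 v2 -> square_integrable v1' v2' ->
  (forall x, a <= x -> x < b -> u1 x = u1' x) -> (forall x, a <= x -> x < b -> v1 x = v1' x) ->
  {ae up, forall x, D x -> u2 x = u2' x} -> {ae up, forall x, D x -> v2 x = v2' x} ->
  E u1 u2 v1 v2 = E u1' u2' v1' v2'.
Proof.
move=> [_ [du _] [mu2 _]] [_ [du' _] [mu2' _]] [_ [dv _] [mv2 _]] [_ [dv' _] [mv2' _]] u1E v1E u2E v2E.
have E1 : \int[leb]_(t in D) (u1 t * v1 t) = \int[leb]_(t in D) (u1' t * v1' t).
  apply: eq_Rintegral => x; rewrite inE /= in_itv /= => /andP[ax xb].
  by rewrite (u1E x ax xb) (v1E x ax xb).
have E2 : \int[leb]_(t in D) (derive1 u1 t * derive1 v1 t) =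
    \int[leb]_(t in D) (derive1 u1' t * derive1 v1' t).
  apply: ae_Rintegral; [exact: measurable_itv|exact: measurable_funM|exact: measurable_funM|].
  apply: ae_interior => x ax xb.
  by rewrite (derive1_local u1E ax xb) (derive1_local v1E ax xb).
have E3 : \int[up]_(t in D) (u2 t * v2 t) = \int[up]_(t in D) (u2' t * v2' t).
  apply: ae_Rintegral; [exact: measurable_itv|exact: measurable_funM|exact: measurable_funM|].
  by apply: ae_impl (ae_and u2E v2E) => x [h1 h2] Dx; rewrite (h1 Dx) (h2 Dx).
by rewrite /energy /pairing E1 E2 E3.
Qed.

Lemma H_square_integrable f : H up a b f ->
  square_integrable (rep f.1) (rep f.2) /\ square_integrable (imp f.1) (imp f.2).
Proof.
move=> [[_ fL dL] f2L].
have [fr fi] := (L2P _ _ (measurable_itv _)).1 fL.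
have [dr di] := (L2_cderivP _ _ (measurable_itv _)).1 dL.
have [f2r f2i] := (L2P _ _ (measurable_itv _)).1 f2L.
exact: (conj (And3 fr dr f2r) (And3 fi di f2i)).
Qed.

Lemma HlocP f : Hloc up f <->
  local_element up (rep f.1) (rep f.2) /\ local_element up (imp f.1) (imp f.2).
Proof.
split=> [[/H1locP[h1 h2] /L2loc_parts[k1 k2]]|[[h1 k1] [h2 k2]]].
  exact: (conj (conj h1 k1) (conj h2 k2)).
exact: (conj ((H1locP _).2 (conj h1 h2)) ((L2loc_parts _ _).2 (conj k1 k2))).
Qed.

Lemma Hloc_H f : Hloc up f -> H up a b f.
Proof. by move=> [h1 h2]; split; [exact: H1loc_H1|exact: h2]. Qed.

Lemma ReMconj (z w : R[i]) : complex.Re (z * w^*) = complex.Re z * complex.Re w + complex.Im z * complex.Im w.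
Proof. by case: z => ? ?; case: w => ? ? /=; ring. Qed.

Lemma ImMconj (z w : R[i]) : complex.Im (z * w^*) = complex.Im z * complex.Re w - complex.Re z * complex.Im w.
Proof. by case: z => ? ?; case: w => ? ? /=; ring. Qed.

(** The scalar product reduces to the real energy form, to which the real
    theory applies. *)
Lemma ip_parts f g : H up a b f -> H up a b g ->
  complex.Re (ip up a b f g) = E (rep f.1) (rep f.2) (rep g.1) (rep g.2) +
    E (imp f.1) (imp f.2) (imp g.1) (imp g.2) /\
  complex.Im (ip up a b f g) = E (imp f.1) (imp f.2) (rep g.1) (rep g.2) -
    E (rep f.1) (rep f.2) (imp g.1) (imp g.2).
Proof.
move=> /H_square_integrable[[a1 a2 a3] [b1 b2 b3]] /H_square_integrable[[c1 c2 c3] [d1 d2 d3]].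
have mD : measurable D := measurable_itv _.
have ED mu u v w k : L2on mu D u -> L2on mu D v -> L2on mu D w -> L2on mu D k ->
   \int[mu]_(x in D) (u x * v x + w x * k x) =
   \int[mu]_(x in D) (u x * v x) + \int[mu]_(x in D) (w x * k x).
  by move=> uL vL wL kL; rewrite (RintegralD mD (L2on_integrableM mD uL vL) (L2on_integrableM mD wL kL)).
have EB mu u v w k : L2on mu D u -> L2on mu D v -> L2on mu D w -> L2on mu D k ->
   \int[mu]_(x in D) (u x * v x - w x * k x) =
   \int[mu]_(x in D) (u x * v x) - \int[mu]_(x in D) (w x * k x).
  by move=> uL vL wL kL; rewrite (RintegralB mD (L2on_integrableM mD uL vL) (L2on_integrableM mD wL kL)).
have Er (u v : R -> R[i]) : rep (fun x => u x * (v x)^*) = (fun x => rep u x * rep v x + imp u x * imp v x).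
  by apply/funext => x; exact: ReMconj.
have Ei (u v : R -> R[i]) : imp (fun x => u x * (v x)^*) = (fun x => imp u x * rep v x - rep u x * imp v x).
  by apply/funext => x; exact: ImMconj.
have cr mu (u : R -> R[i]) : complex.Re (cintegral mu D u) = \int[mu]_(x in D) rep u x by [].
have ci mu (u : R -> R[i]) : complex.Im (cintegral mu D u) = \int[mu]_(x in D) imp u x by [].
have Erd : rep (fun x => cderiv f.1 x * (cderiv g.1 x)^*) =
    (fun x => derive1 (rep f.1) x * derive1 (rep g.1) x + derive1 (imp f.1) x * derive1 (imp g.1) x).
  exact: Er.
have Eid : imp (fun x => cderiv f.1 x * (cderiv g.1 x)^*) =
    (fun x => derive1 (imp f.1) x * derive1 (rep g.1) x - derive1 (rep f.1) x * derive1 (imp g.1) x).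
  exact: Ei.
rewrite /ip !Re_add !Im_add Re_4V Im_4V !cr !ci Erd Eid !Er !Ei /energy /pairing.
rewrite (ED _ _ _ _ _ a1 c1 b1 d1) (ED _ _ _ _ _ a2 c2 b2 d2) (ED _ _ _ _ _ a3 c3 b3 d3).
rewrite (EB _ _ _ _ _ b1 c1 a1 d1) (EB _ _ _ _ _ b2 c2 a2 d2) (EB _ _ _ _ _ b3 c3 a3 d3).
have aux1 (x1 x2 x3 y1 y2 y3 : R) : 4^-1 * (x1 + y1) + (x2 + y2) + (x3 + y3) =
    4^-1 * x1 + x2 + x3 + (4^-1 * y1 + y2 + y3) by ring.
have aux2 (x1 x2 x3 y1 y2 y3 : R) : 4^-1 * (x1 - y1) + (x2 - y2) + (x3 - y3) =
    4^-1 * x1 + x2 + x3 - (4^-1 * y1 + y2 + y3) by ring.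
exact: (conj (aux1 _ _ _ _ _ _) (aux2 _ _ _ _ _ _)).
Qed.

Lemma eq_on_parts f g : eq_on up a b f g ->
  [/\ forall x, a <= x -> x < b -> rep f.1 x = rep g.1 x,
      forall x, a <= x -> x < b -> imp f.1 x = imp g.1 x,
      {ae up, forall x, D x -> rep f.2 x = rep g.2 x} &
      {ae up, forall x, D x -> imp f.2 x = imp g.2 x}].
Proof.
move=> [e1 e2]; split.
- by move=> x ax xb; rewrite e1// in_itv /= ax.
- by move=> x ax xb; rewrite e1// in_itv /= ax.
- by apply: ae_impl e2 => x h Dx; rewrite h.
- by apply: ae_impl e2 => x h Dx; rewrite h.
Qed.

Lemma ip_eq_on f f' g g' : H up a b f -> H up a b f' -> H up a b g -> H up a b g' ->
  eq_on up a b f f' -> eq_on up a b g g' -> ip up a b f g = ip up a b f' g'.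
Proof.
move=> Hf Hf' Hg Hg' /eq_on_parts[e1 e2 e3 e4] /eq_on_parts[h1 h2 h3 h4].
have [fr fi] := H_square_integrable Hf; have [fr' fi'] := H_square_integrable Hf'.
have [gr gi] := H_square_integrable Hg; have [gr' gi'] := H_square_integrable Hg'.
have [I1 I2] := ip_parts Hf Hg; have [J1 J2] := ip_parts Hf' Hg'.
apply/complex_eqP; rewrite I1 I2 J1 J2.
rewrite (energy_congr fr fr' gr gr' e1 h1 e3 h3) (energy_congr fi fi' gi gi' e2 h2 e4 h4).
by rewrite (energy_congr fi fi' gr gr' e2 h1 e4 h3) (energy_congr fr fr' gi gi' e1 h2 e3 h4).
Qed.

Definition agree f g := forall x, a <= x -> x < b -> f.1 x = g.1 x /\ f.2 x = g.2 x.

Lemma agree_eq_on f g : agree f g -> eq_on up a b f g.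
Proof.
move=> fg; split; first by move=> x; rewrite in_itv /= => /andP[ax xb]; have [] := fg x ax xb.
by apply: aeW => x; rewrite in_itv /= => /andP[ax xb]; have [] := fg x ax xb.
Qed.

Lemma H_extension f : H up a b f -> exists2 g, Hloc up g & agree f g.
Proof.
move=> [f1H f2L]; have [f2r f2i] := (L2P _ _ (measurable_itv _)).1 f2L.
have [F1 HF1 E] := H1_extension ab f1H.
exists (F1, fun x => (((rep f.2) \_ D) x +i* ((imp f.2) \_ D) x)%C).
  split => //=; apply/L2loc_parts; split; exact: L2loc_restrict.
move=> x ax xb /=; rewrite E//; split => //; rewrite !patchE.
by rewrite mem_set/= ?in_itv/= ?ax//; case: (f.2 x).
Qed.

(** Membership in H([a, b)) depends only on the values on [`[a, b[]: the
    derivative may change at [a] alone. *)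
Lemma agree_H f g : Hloc up g -> agree f g -> H up a b f.
Proof.
move=> Hg fg; have [[acg _ dgL] g2L] := Hloc_H Hg; have mD : measurable D := measurable_itv _.
have [[gr dgr g2r] [gi dgi g2i]] := H_square_integrable (Hloc_H Hg).
have inD (P : R -> Prop) : (forall x, a <= x -> x < b -> P x) -> forall x, D x -> P x.
  by move=> h x; rewrite /= in_itv /= => /andP[]; exact: h.
split; [split|].
- move=> x y xy xyD e e0; have [d d0 dP] := acg x y xy xyD e e0.
  have fE z : x <= z -> z <= y -> f.1 z = g.1 z.
    move=> xz zy; have /= := xyD z; rewrite !in_itv /= xz zy => /(_ isT)/andP[az zb].
    exact: (fg z az zb).1.
  exists d => // n s t st tr sd; apply: le_lt_trans (dP n s t st tr sd).
  apply: ler_sum => i _; have [? [? ?]] := st i.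
  by rewrite !fE//; lra.
- apply/(L2P _ _ mD); split; [apply: L2on_ext gr _|apply: L2on_ext gi _].
    by apply: inD => x ax xb; rewrite (fg x ax xb).1.
  by apply: inD => x ax xb; rewrite (fg x ax xb).1.
- have er x : a <= x -> x < b -> rep g.1 x = rep f.1 x by move=> ax xb; rewrite (fg x ax xb).1.
  have ei x : a <= x -> x < b -> imp g.1 x = imp f.1 x by move=> ax xb; rewrite (fg x ax xb).1.
  apply/(L2_cderivP _ _ mD); split.
    apply: (L2on_ae mD dgr); last exact: ae_interior (derive1_local er).
    exact: measurable_fun_off_point dgr.1 (derive1_local er).
  apply: (L2on_ae mD dgi); last exact: ae_interior (derive1_local ei).
  exact: measurable_fun_off_point dgi.1 (derive1_local ei).
- apply/(L2P _ _ mD); split; [apply: L2on_ext g2r _|apply: L2on_ext g2i _].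
    by apply: inD => x ax xb; rewrite (fg x ax xb).2.
  by apply: inD => x ax xb; rewrite (fg x ax xb).2.
Qed.

Lemma parts_sub (u v : R -> R[i]) : rep (u - v) = (fun x => rep u x - rep v x) /\
  imp (u - v) = (fun x => imp u x - imp v x).
Proof.
by split; apply/funext => x; rewrite -[(u - v) x]/(u x - v x) ?Re_add ?Im_add ?Re_opp ?Im_opp.
Qed.

Lemma Hloc_sub f g : Hloc up f -> Hloc up g -> Hloc up (f - g).
Proof.
move=> /HlocP[fr fi] /HlocP[gr gi]; apply/HlocP.
have [-> ->] := parts_sub f.1 g.1; have [-> ->] := parts_sub f.2 g.2.
by split; exact: local_elementB.
Qed.

Lemma agree_sub f f' g g' : agree f f' -> agree g g' -> agree (f - g) (f' - g').
Proof.
move=> ff gg x ax xb; have [e1 e2] := ff x ax xb; have [h1 h2] := gg x ax xb.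
rewrite -[(f - g).1 x]/(f.1 x - g.1 x) -[(f' - g').1 x]/(f'.1 x - g'.1 x).
by rewrite -[(f - g).2 x]/(f.2 x - g.2 x) -[(f' - g').2 x]/(f'.2 x - g'.2 x) e1 e2 h1 h2.
Qed.

Lemma H_sub f g : H up a b f -> H up a b g -> H up a b (f - g).
Proof.
move=> /H_extension[f' Hf ff] /H_extension[g' Hg gg].
by apply: agree_H (agree_sub ff gg); exact: Hloc_sub.
Qed.

(** Additivity holds for the extensions to the line, where the derivative of a
    difference is almost everywhere the difference of the derivatives. *)
Lemma ip_sub f g h : H up a b f -> H up a b g -> H up a b h ->
  ip up a b (f - g) h = ip up a b f h - ip up a b g h.
Proof.
move=> Hf Hg Hh; have Hfg := H_sub Hf Hg.
have [f' Hf' ff] := H_extension Hf; have [g' Hg' gg] := H_extension Hg.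
have [h' Hh' hh] := H_extension Hh; have Hfg' := Hloc_sub Hf' Hg'.
rewrite (ip_eq_on Hfg (Hloc_H Hfg') Hh (Hloc_H Hh') (agree_eq_on (agree_sub ff gg)) (agree_eq_on hh)).
rewrite (ip_eq_on Hf (Hloc_H Hf') Hh (Hloc_H Hh') (agree_eq_on ff) (agree_eq_on hh)).
rewrite (ip_eq_on Hg (Hloc_H Hg') Hh (Hloc_H Hh') (agree_eq_on gg) (agree_eq_on hh)).
have [I1 I2] := ip_parts (Hloc_H Hfg') (Hloc_H Hh').
have [J1 J2] := ip_parts (Hloc_H Hf') (Hloc_H Hh').
have [K1 K2] := ip_parts (Hloc_H Hg') (Hloc_H Hh').
have [fr fi] := (HlocP f').1 Hf'; have [gr gi] := (HlocP g').1 Hg'; have [hr hi] := (HlocP h').1 Hh'.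
apply/complex_eqP; rewrite (Re_add (ip up a b f' h')) (Im_add (ip up a b f' h')).
rewrite (Re_opp (ip up a b g' h')) (Im_opp (ip up a b g' h')) I1 I2 J1 J2 K1 K2.
have [-> ->] := parts_sub f'.1 g'.1; have [-> ->] := parts_sub f'.2 g'.2.
rewrite (energyB a b fr gr hr) (energyB a b fi gi hi) (energyB a b fi gi hr) (energyB a b fr gr hi).
by split; ring.
Qed.

Let young_small (e x1 x2 x3 x4 f1 f2 g1 g2 : R) : 0 < e -> f1 + f2 < e ^+ 2 ->
  `|x1| <= 2^-1 * (e^-1 * f1 + e * g1) -> `|x2| <= 2^-1 * (e^-1 * f2 + e * g2) ->
  `|x3| <= 2^-1 * (e^-1 * f2 + e * g1) -> `|x4| <= 2^-1 * (e^-1 * f1 + e * g2) ->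
  `|x1 + x2| <= 2^-1 * e * (1 + (g1 + g2)) /\ `|x3 - x4| <= 2^-1 * e * (1 + (g1 + g2)).
Proof.
move=> e0 fe.
have : e^-1 * f1 + e^-1 * f2 < e.
  by rewrite -mulrDr mulrC ltr_pdivrMr// -expr2.
move: (e^-1 * f1) (e^-1 * f2) => F1 F2 Fe.
rewrite !ler_norml => /andP[? ?] /andP[? ?] /andP[? ?] /andP[? ?].
by split; apply/andP; split; lra.
Qed.

(** Since the energy is positive, the pairing is continuous in its first
    argument for the norm. *)
Lemma ip_small f g e : H up a b f -> H up a b g -> 0 < e -> hnorm up a b f < e ->
  `|complex.Re (ip up a b f g)| <= 2^-1 * e * (1 + complex.Re (ip up a b g g)) /\
  `|complex.Im (ip up a b f g)| <= 2^-1 * e * (1 + complex.Re (ip up a b g g)).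
Proof.
move=> Hf Hg e0 fe; have [fr fi] := H_square_integrable Hf; have [gr gi] := H_square_integrable Hg.
have e1 : 0 < e^-1 by rewrite invr_gt0.
have [I1 I2] := ip_parts Hf Hg; have [F1 _] := ip_parts Hf Hf; have [G1 _] := ip_parts Hg Hg.
have N0 := addr_ge0 (energy_ge0 up a b (rep f.1) (rep f.2)) (energy_ge0 up a b (imp f.1) (imp f.2)).
have Ne : complex.Re (ip up a b f f) < e ^+ 2.
  by rewrite -(sqr_sqrtr (a := complex.Re _)) ?F1// -F1 ltr_pXn2r ?nnegrE ?sqrtr_ge0 ?(ltW e0).
have y1 := energy_young fr gr e1; have y2 := energy_young fi gi e1.
have y3 := energy_young fi gr e1; have y4 := energy_young fr gi e1.
rewrite invrK in y1 y2 y3 y4; rewrite F1 in Ne; rewrite I1 I2 G1.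
exact: (young_small e0 Ne y1 y2 y3 y4).
Qed.

End EnergySpace.

(** * The adjoint relations *)

Section Adjoints.
Context {R : realType} (om : loc_charge R)
  (up : {measure set (measurableTypeR R) -> \bar R}) (lup : locfin up).
Context {a b : R} (ab : a < b).
Implicit Types (f g h : elt R) (F G K : elt R * elt R) (u v w : R -> R) (p q : R -> R[i]) (x y c d : R).

Lemma Tloc_with_parts p F : Tloc_with om up p F <->
  real_pair om up (rep F.1.1) (rep F.1.2) (rep p) (rep F.2.1) (rep F.2.2) /\
  real_pair om up (imp F.1.1) (imp F.1.2) (imp p) (imp F.2.1) (imp F.2.2).
Proof.
split=> [[/HlocP[f1 f2] /HlocP[g1 g2] [sr si] e]|[[sr f1 g1 er] [si f2 g2 ei]]].
  have er : {ae up, forall x, rep F.1.2 x = rep F.2.1 x} by apply: ae_impl e => x ->.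
  have ei : {ae up, forall x, imp F.1.2 x = imp F.2.1 x} by apply: ae_impl e => x ->.
  exact: (conj (And4 sr f1 g1 er) (And4 si f2 g2 ei)).
split; [exact/HlocP|exact/HlocP|exact: (conj sr si)|].
by apply: ae_impl (ae_and er ei) => x /complex_eqP.
Qed.

Lemma Tloc_with_solution u v s t g : Hloc up g -> solution om up u s (rep g.1) (rep g.2) ->
  solution om up v t (imp g.1) (imp g.2) ->
  Tloc_with om up (fun x => (s x +i* t x)%C) ((fun x => (u x +i* v x)%C, g.1), g).
Proof.
move=> Hg su sv; have [gr gi] := (HlocP up g).1 Hg.
have [adr adi] := Hloc_admissible lup Hg.
have L w w2 : admissible up w w2 -> L2loc up w by move=> [mw bw _]; exact: L2loc_bounded.
have [su' _] := sobolev_derive1 (solution_sobolev adr su).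
have [sv' _] := sobolev_derive1 (solution_sobolev adi sv).
have er : {ae up, forall x, rep g.1 x = rep g.1 x} by exact: aeW.
have ei : {ae up, forall x, imp g.1 x = imp g.1 x} by exact: aeW.
apply/Tloc_with_parts; exact: (conj (And4 su (conj su' (L _ _ adr)) gr er)
  (And4 sv (conj sv' (L _ _ adi)) gi ei)).
Qed.

Definition boundary_form (p g q l : R -> R) := p b * l b - p a * l a - (q b * g b - q a * g a).

(** Green's formula for complex pairs: the formula for real pairs, applied to
    the four combinations of real and imaginary parts. *)
Lemma green_parts p q F K : Tloc_with om up p F -> Tloc_with om up q K ->
  complex.Re (ip up a b F.1 K.2) - complex.Re (ip up a b F.2 K.1) =
    boundary_form (rep p) (rep F.2.1) (rep q) (rep K.2.1) +
    boundary_form (imp p) (imp F.2.1) (imp q) (imp K.2.1) /\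
  complex.Im (ip up a b F.1 K.2) - complex.Im (ip up a b F.2 K.1) =
    boundary_form (imp p) (imp F.2.1) (rep q) (rep K.2.1) -
    boundary_form (rep p) (rep F.2.1) (imp q) (imp K.2.1).
Proof.
move=> FT KT; have [HF1 HF2 _ _] := FT; have [HK1 HK2 _ _] := KT.
have [Fr Fi] := (Tloc_with_parts p F).1 FT; have [Kr Ki] := (Tloc_with_parts q K).1 KT.
have [I1 I2] := ip_parts (Hloc_H (a := a) (b := b) HF1) (Hloc_H HK2).
have [J1 J2] := ip_parts (Hloc_H (a := a) (b := b) HF2) (Hloc_H HK1).
have g1 := energy_green lup (ltW ab) Fr Kr; have g2 := energy_green lup (ltW ab) Fi Ki.
have g3 := energy_green lup (ltW ab) Fi Kr; have g4 := energy_green lup (ltW ab) Fr Ki.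
rewrite I1 I2 J1 J2 /boundary_form -g1 -g2 -g3 -g4.
have aux1 (x1 x2 x3 x4 : R) : x1 + x2 - (x3 + x4) = x1 - x3 + (x2 - x4) by ring.
have aux2 (x1 x2 x3 x4 : R) : x1 - x2 - (x3 - x4) = x1 - x3 - (x2 - x4) by ring.
exact: (conj (aux1 _ _ _ _) (aux2 _ _ _ _)).
Qed.

Definition vanishing_data p G := [/\ G.2.1 a = 0, p a = 0, G.2.1 b = 0 & p b = 0].

Lemma green_vanishing p q F K : Tloc_with om up p F -> Tloc_with om up q K ->
  vanishing_data p F \/ vanishing_data q K -> ip up a b F.1 K.2 = ip up a b F.2 K.1.
Proof.
move=> FT KT Z; have [E1 E2] := green_parts FT KT.
apply/complex_eqP; split; apply/eqP; rewrite -subr_eq0; apply/eqP.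
  rewrite E1 /boundary_form; case: Z => -[-> -> -> ->] /=; ring.
rewrite E2 /boundary_form; case: Z => -[-> -> -> ->] /=; ring.
Qed.

Lemma eq_on_refl f : eq_on up a b f f.
Proof. by split => //; exact: aeW. Qed.

Lemma Tloc_with_Tmax p F : Tloc_with om up p F -> Tmax om up a b F.
Proof.
move=> FT; have [HF1 HF2 _ _] := FT.
split; [exact: Hloc_H|exact: Hloc_H|].
exists F; first by have [] := Tloc_with_left_deriv lup FT.
by split; exact: eq_on_refl.
Qed.

Lemma Tmax_lift F : Tmax om up a b F ->
  exists G p, Tloc_with om up p G /\ restricts up a b G F.
Proof.
by move=> [_ _ [G GT GF]]; have [p Gp] := (TlocP om lup G).1 GT; exists G, p.
Qed.

Lemma Tmin_lift F : Tmin om up a b F ->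
  exists G p, [/\ Tloc_with om up p G, restricts up a b G F & vanishing_data p G].
Proof.
by move=> [_ [G [p [GT GF Gp Z]]]]; exists G, p; split => //; exact: left_deriv_Tloc_with.
Qed.

Lemma Tloc_with_Tmin p F : Tloc_with om up p F -> vanishing_data p F -> Tmin om up a b F.
Proof.
move=> FT Z; split; first exact: Tloc_with_Tmax FT.
have [h1 h2] := Tloc_with_left_deriv lup FT.
by exists F, p; split => //; split; exact: eq_on_refl.
Qed.

Lemma ip_restricts F G K L : H up a b F.1 -> H up a b F.2 -> H up a b K.1 -> H up a b K.2 ->
  Hloc up G.1 -> Hloc up G.2 -> Hloc up L.1 -> Hloc up L.2 ->
  restricts up a b G F -> restricts up a b L K ->
  ip up a b F.1 K.2 = ip up a b G.1 L.2 /\ ip up a b F.2 K.1 = ip up a b G.2 L.1.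
Proof.
move=> HF1 HF2 HK1 HK2 HG1 HG2 HL1 HL2 [GF1 GF2] [LK1 LK2].
by split; apply: ip_eq_on => //; exact: Hloc_H.
Qed.

Lemma Tmax_Tmin_green F K : Tmax om up a b F -> Tmax om up a b K ->
  Tmin om up a b F \/ Tmin om up a b K -> ip up a b F.1 K.2 = ip up a b F.2 K.1.
Proof.
move=> FM KM Z; have [HF1 HF2 _] := FM; have [HK1 HK2 _] := KM.
suff [G [p [L [q [GT LT GF LK V]]]]] : exists G p L q, [/\ Tloc_with om up p G,
    Tloc_with om up q L, restricts up a b G F, restricts up a b L K &
    vanishing_data p G \/ vanishing_data q L].
  have [HG1 HG2 _ _] := GT; have [HL1 HL2 _ _] := LT.
  have [-> ->] := ip_restricts HF1 HF2 HK1 HK2 HG1 HG2 HL1 HL2 GF LK.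
  exact: (green_vanishing GT LT V).
case: Z => [/Tmin_lift[G [p [GT GF V]]]|/Tmin_lift[L [q [LT LK V]]]].
  by have [L [q [LT LK]]] := Tmax_lift KM; exists G, p, L, q; split => //; left.
by have [G [p [GT GF]]] := Tmax_lift FM; exists G, p, L, q; split => //; right.
Qed.

(** The heart of the theorem. Let [g] extend [F.2], and let [f] solve the
    equation with source [g] and the same values as [F.1] at both end points.
    The difference [r] of [F.1] and [f] vanishes at the end points, so solving
    the Neumann problem with source [r] gives a pair [K] of the minimal
    relation. Testing the adjoint relation against [K] shows that [r] is
    orthogonal to itself. *)
Lemma adjoint_Tmin_sub F : adjoint up a b (Tmin om up a b) F -> Tmax om up a b F.
Proof.
move=> [HF1 HF2 FK].
have [u Hu Fu] := H_extension ab HF1; have [g Hg Fg] := H_extension ab HF2.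
have [adr adi] := Hloc_admissible lup Hg.
have [fr [pr [sr [fra frb]]]] := dirichlet_problem om (rep u.1 a) (rep u.1 b) ab adr.
have [fi [pi [si [fia fib]]]] := dirichlet_problem om (imp u.1 a) (imp u.1 b) ab adi.
have GT := Tloc_with_solution Hg sr si.
set p := (fun x => (pr x +i* pi x)%C) in GT; set f := (_, g.1) in GT.
have [Hf _ _ _] := GT; rewrite /= in Hf.
have Hr := Hloc_sub Hu Hf; set r := u - f in Hr.
have ra : r.1 a = 0.
  by rewrite -[r.1 a]/(u.1 a - (fr a +i* fi a)%C) fra fia; case: (u.1 a) => ? ?; rewrite subrr.
have rb : r.1 b = 0.
  by rewrite -[r.1 b]/(u.1 b - (fr b +i* fi b)%C) frb fib; case: (u.1 b) => ? ?; rewrite subrr.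
have [rdr rdi] := Hloc_admissible lup Hr.
have [hr [qr [tr [qra qrb]]]] := neumann_problem om 0 0 ab rdr.
have [hi [qi [ti [qia qib]]]] := neumann_problem om 0 0 ab rdi.
have KT := Tloc_with_solution Hr tr ti.
set q := (fun x => (qr x +i* qi x)%C) in KT; set K := (_, r) in KT.
have KV : vanishing_data q K by split => //=; rewrite /q ?qra ?qia ?qrb ?qib.
have Kmin := Tloc_with_Tmin KT KV.
have E1 : ip up a b F.1 r = ip up a b F.2 K.1 := FK K Kmin; have [HK1 _ _ _] := KT.
have E2 : ip up a b f r = ip up a b g K.1 := green_vanishing GT KT (or_intror KV).
have Hu' : H up a b u by exact: Hloc_H. have Hg' : H up a b g by exact: Hloc_H.
have Hf' : H up a b f by exact: Hloc_H. have Hr' : H up a b r by exact: Hloc_H.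
have HK1' : H up a b K.1 by exact: Hloc_H.
have E3 := ip_eq_on HF1 Hu' Hr' Hr' (agree_eq_on up Fu) (eq_on_refl r).
have E4 := ip_eq_on HF2 Hg' HK1' HK1' (agree_eq_on up Fg) (eq_on_refl K.1).
have E0 : ip up a b r r = 0.
  by rewrite {1}/r (ip_sub ab Hu' Hf' Hr') -E3 E2 -E4 E1 subrr.
have [I1 _] := ip_parts Hr' Hr'; rewrite E0 in I1.
have [lr li] := (HlocP up r).1 Hr.
have aux (s t : R) : 0 <= s -> 0 <= t -> 0 = s + t -> s = 0 /\ t = 0 by move=> *; split; lra.
have [z1 z2] := aux _ _ (energy_ge0 up a b _ _) (energy_ge0 up a b _ _) I1.
have [u1 u2] := energy_eq0 lr (congr1 (@complex.Re R) ra) z1.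
have [v1 v2] := energy_eq0 li (congr1 (@complex.Im R) ra) z2.
split => //; exists (f, g); first exact: (Tloc_with_left_deriv lup GT).1.
split; last exact: agree_eq_on.
have uE x : a <= x -> x < b -> u.1 x = f.1 x.
  move=> ax xb; apply/eqP; rewrite -subr_eq0; apply/eqP/complex_eqP.
  exact: (conj (u1 x ax xb) (v1 x ax xb)).
split.
  by move=> x; rewrite in_itv /= => /andP[ax xb]; rewrite (Fu x ax xb).1 uE.
apply: ae_impl (ae_and u2 v2) => x [e1 e2] xab.
have /andP[ax xb] := xab; rewrite (Fu x ax xb).2.
apply/eqP; rewrite -subr_eq0; apply/eqP/complex_eqP.
exact: (conj (e1 xab) (e2 xab)).
Qed.

Lemma sobolev_affine c d : sobolev (fun x => c + d * x) (derive1 (fun x => c + d * x)).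
Proof.
have id : locint leb (fun _ : R => d) by apply: continuous_locint => x; exact: cvg_cst.
have pr : primitive (fun x => c + d * x) (fun _ : R => d).
  by split => // x y xy; rewrite (int_constant (k := d))//; ring.
have L : L2loc leb (fun _ : R => d).
  by apply: L2loc_bounded => //; [exact: locfin_leb|exact: locbounded_cst].
exact: (sobolev_derive1 (conj pr L)).1.
Qed.

(** Take an affine right-hand side with the prescribed end values and solve the
    Neumann problem for it. *)
Lemma Tloc_with_boundary (l0 l1 q0 q1 : R) : exists K q, [/\ Tloc_with om up q K,
  [/\ complex.Re (K.2.1 a) = l0, complex.Re (K.2.1 b) = l1, complex.Re (q a) = q0 &
      complex.Re (q b) = q1] &
  [/\ complex.Im (K.2.1 a) = 0, complex.Im (K.2.1 b) = 0, complex.Im (q a) = 0 &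
      complex.Im (q b) = 0]].
Proof.
have ba : b - a != 0 by rewrite gt_eqF// subr_gt0.
pose d := (l1 - l0) / (b - a); pose c := l0 - d * a.
pose L : elt R := ((fun x => ((c + d * x) +i* (0 + 0 * x))%C), (fun=> 0)).
have z : L2loc up (fun _ : R => 0) by apply: L2loc_bounded => //; exact: locbounded_cst.
have HL : Hloc up L.
  by apply/HlocP; exact: (conj (conj (sobolev_affine c d) z) (conj (sobolev_affine 0 0) z)).
have [adr adi] := Hloc_admissible lup HL.
have [k [q [sk [qa qb]]]] := neumann_problem om q0 q1 ab adr.
have [k' [q' [sk' [qa' qb']]]] := neumann_problem om 0 0 ab adi.
have KT := Tloc_with_solution HL sk sk'.
exists ((fun x => (k x +i* k' x)%C, L.1), L), (fun x => (q x +i* q' x)%C).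
split; [exact: KT| |].
  by rewrite /= qa qb; split => //; rewrite /c /d; field.
by rewrite /= qa' qb' !mul0r addr0.
Qed.

Lemma boundary_form_nondegenerate (p g : R -> R) :
  (forall l0 l1 q0 q1 : R, p b * l1 - p a * l0 - (q1 * g b - q0 * g a) = 0) ->
  [/\ g a = 0, p a = 0, g b = 0 & p b = 0].
Proof.
move=> Z; have := Z 1 0 0 0; have := Z 0 1 0 0; have := Z 0 0 1 0; have := Z 0 0 0 1.
by rewrite !mulr0 !mulr1 !mul0r !mul1r => *; split; lra.
Qed.

(** Testing against the pairs with prescribed boundary values shows that the
    boundary form of [F] vanishes identically, so that all its boundary
    values are zero. *)
Lemma adjoint_Tmax_sub F : Tmax om up a b F -> adjoint up a b (Tmax om up a b) F ->
  Tmin om up a b F.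
Proof.
move=> FM [HF1 HF2 FK]; split => //; have [G [p [GT GF]]] := Tmax_lift FM.
have [HG1 HG2 _ _] := GT; have [h1 h2] := Tloc_with_left_deriv lup GT.
have Z (l0 l1 q0 q1 : R) :
    complex.Re (p b) * l1 - complex.Re (p a) * l0 -
      (q1 * complex.Re (G.2.1 b) - q0 * complex.Re (G.2.1 a)) = 0 /\
    complex.Im (p b) * l1 - complex.Im (p a) * l0 -
      (q1 * complex.Im (G.2.1 b) - q0 * complex.Im (G.2.1 a)) = 0.
  have [K [q [KT [la lb qa qb] [la' lb' qa' qb']]]] := Tloc_with_boundary l0 l1 q0 q1.
  have KM := Tloc_with_Tmax KT; have [HK1 HK2 _] := KM; have [HL1 HL2 _ _] := KT.
  have KK : restricts up a b K K by split; exact: eq_on_refl.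
  have [E1 E2] := ip_restricts HF1 HF2 HK1 HK2 HG1 HG2 HL1 HL2 GF KK.
  have := green_parts GT KT.
  rewrite -E1 -E2 (FK K KM) !subrr /boundary_form la lb qa qb la' lb' qa' qb'.
  by rewrite !mulr0 !mul0r !subr0 addr0 => -[<- <-].
have [ga pa gb pb] := boundary_form_nondegenerate (p := rep p) (g := rep G.2.1)
  (fun l0 l1 q0 q1 : R => (Z l0 l1 q0 q1).1).
have [ga' pa' gb' pb'] := boundary_form_nondegenerate (p := imp p) (g := imp G.2.1)
  (fun l0 l1 q0 q1 : R => (Z l0 l1 q0 q1).2).
exists G, p; split => //; split; apply/complex_eqP.
- exact: (conj ga ga').
- exact: (conj pa pa').
- exact: (conj gb gb').
- exact: (conj pb pb').
Qed.

Let small_difference (e m n x y z : R) : `|x - z| <= 2^-1 * e * (1 + m) ->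
  `|y - z| <= 2^-1 * e * (1 + n) -> `|x - y| <= e * (2^-1 * (1 + m) + 2^-1 * (1 + n)).
Proof.
rewrite !ler_norml => /andP[? ?] /andP[? ?].
by apply/andP; split; lra.
Qed.

(** An adjoint relation is an intersection of kernels of continuous
    functionals. *)
Lemma adjoint_closed (S : relation R) : (forall K, S K -> H up a b K.1 /\ H up a b K.2) ->
  closed_rel up a b (adjoint up a b S).
Proof.
move=> SH F HF1 HF2 cl; split => // K SK; have [HK1 HK2] := SH K SK.
have [N1 _] := ip_parts HK1 HK1; have [N2 _] := ip_parts HK2 HK2.
pose M := 2^-1 * (1 + complex.Re (ip up a b K.2 K.2)) + 2^-1 * (1 + complex.Re (ip up a b K.1 K.1)).
have M0 : 0 < M.
  have := energy_ge0 up a b (rep K.1.1) (rep K.1.2); have := energy_ge0 up a b (imp K.1.1) (imp K.1.2).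
  have := energy_ge0 up a b (rep K.2.1) (rep K.2.2); have := energy_ge0 up a b (imp K.2.1) (imp K.2.2).
  rewrite /M N1 N2.
  move: (energy _ _ _ _ _ _ _) (energy _ _ _ _ _ _ _) (energy _ _ _ _ _ _ _) (energy _ _ _ _ _ _ _).
  by move=> *; lra.
have key e : 0 < e ->
    `|complex.Re (ip up a b F.1 K.2) - complex.Re (ip up a b F.2 K.1)| <= e * M /\
    `|complex.Im (ip up a b F.1 K.2) - complex.Im (ip up a b F.2 K.1)| <= e * M.
  move=> e0; have [L [HL1 HL2 LK] [n1 n2]] := cl e e0; have LKE := LK K SK.
  have [r1 i1] := ip_small (H_sub ab HF1 HL1) HK2 e0 n1.
  have [r2 i2] := ip_small (H_sub ab HF2 HL2) HK1 e0 n2.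
  move: r1 i1 r2 i2; rewrite (ip_sub ab HF1 HL1 HK2) (ip_sub ab HF2 HL2 HK1) LKE.
  rewrite (Re_add (ip up a b F.1 K.2)) (Im_add (ip up a b F.1 K.2)).
  rewrite (Re_add (ip up a b F.2 K.1)) (Im_add (ip up a b F.2 K.1)).
  rewrite !(Re_opp (ip up a b L.2 K.1)) !(Im_opp (ip up a b L.2 K.1)) => r1 i1 r2 i2.
  exact: (conj (small_difference r1 r2) (small_difference i1 i2)).
have zero (s : R) : (forall e, 0 < e -> `|s| <= e * M) -> s = 0.
  move=> sM; apply/eqP; rewrite -normr_le0; apply/ler_addgt0Pr => e e0; rewrite add0r.
  by have := sM (e / M) (divr_gt0 e0 M0); rewrite (divfK (lt0r_neq0 M0)).
apply/complex_eqP; split; apply/eqP; rewrite -subr_eq0; apply/eqP; apply: zero => e e0.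
  exact: (key e e0).1.
exact: (key e e0).2.
Qed.

End Adjoints.

Theorem theorem3p1 (R : realType) (om : loc_charge R)
  (up : {measure set (measurableTypeR R) -> \bar R})
  (up_locally_finite : forall x y : R, (up (`[x, y[%classic : set R) < +oo)%E)
  (a b : R) (ab : a < b) :
  [/\ symmetric_rel up a b (Tmin om up a b),
      adjoint up a b (Tmin om up a b) = Tmax om up a b,
      adjoint up a b (Tmax om up a b) = Tmin om up a b,
      closed_rel up a b (Tmin om up a b) &
      closed_rel up a b (Tmax om up a b)].
Proof.
have lup : locfin up := up_locally_finite.
have minmax : Tmin om up a b `<=` Tmax om up a b by move=> F [].
have maxH F : Tmax om up a b F -> H up a b F.1 /\ H up a b F.2 by case.
have E1 : adjoint up a b (Tmin om up a b) = Tmax om up a b.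
  apply/seteqP; split=> [F|F FM]; first exact: (adjoint_Tmin_sub lup ab).
  have [HF1 HF2] := maxH F FM; split => // K KT.
  by apply: (Tmax_Tmin_green lup ab FM (minmax K KT)); right.
have E2 : adjoint up a b (Tmax om up a b) = Tmin om up a b.
  apply/seteqP; split=> [F FA|F FT].
    have FM : Tmax om up a b F.
      by rewrite -E1; have [HF1 HF2 FK] := FA; split => // K /minmax; exact: FK.
    exact: (adjoint_Tmax_sub lup ab FM FA).
  have FM := minmax F FT; have [HF1 HF2] := maxH F FM; split => // K KM.
  by apply: (Tmax_Tmin_green lup ab FM KM); left.
split => //.
- by rewrite /symmetric_rel E1.
- by rewrite -E2; exact: (adjoint_closed ab maxH).
- by rewrite -E1; apply: (adjoint_closed ab) => K /minmax; exact: maxH.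
Qed.
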